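(* Let $X_n$ denote the additive functional induced by the toll sequence $(\log n)_{n\ge1}$ (the shape functional) on a uniformly random binary tree with $n$ nodes. Let \[ C_0:=\sum_{n=1}^\infty(\log n)\frac{\beta_n}{4^n},\qquad \beta_n=\frac1{n+1}\binom{2n}{n},\qquad \sigma^2:=8(1-\log2). \] Then \[ \frac{X_n-C_0(n+1)}{\sqrt{n\log n}}\xrightarrow{\ \mathcal L\ }\mathcal N(0,\sigma^2)\quad\text{and}\quad\frac{X_n-\mathbb{E}X_n}{\sqrt{\operatorname{Var}X_n}}\xrightarrow{\ \mathcal L\ }\mathcal N(0,1). \]
   Context: Binary trees: a binary tree is either empty (0 nodes) or consists of a root together with an ordered pair $(L(T),R(T))$ of binary trees. $|T|$ is the number of nodes. Given a toll sequence $(b_n)_{n\ge1}$, the induced additive tree functional $f$ is defined by $f(\emptyset)=0$ and $f(T)=f(L(T))+f(R(T))+b_{|T|}$ for $|T|\ge1$. $X_n:=f(T_n)$ where $T_n$ is uniformly distributed over the $\beta_n$ binary trees with $n$ nodes. $\xrightarrow{\mathcal L}$ is convergence in distribution. *)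

(* Defs.v *)
From Stdlib Require Import Reals List.
From Coquelicot Require Import Coquelicot.
Open Scope R_scope.

Inductive btree : Type := Empty | Node (l r : btree).

Fixpoint bsize (t : btree) : nat :=
  match t with Empty => 0%nat | Node l r => S (bsize l + bsize r) end.

Fixpoint addfun (b : nat -> R) (t : btree) : R :=
  match t with
  | Empty => 0
  | Node l r => addfun b l + addfun b r + b (bsize (Node l r))
  end.

Definition shape (t : btree) : R := addfun (fun n => ln (INR n)) t.

Definition beta (n : nat) : R := Binomial.C (2 * n) n / INR (n + 1).

Definition C0 : R := Series (fun k => ln (INR (S k)) * beta (S k) / 4 ^ (S k)).

Definition sigma2 : R := 8 * (1 - ln 2).

(* "L enumerates exactly the binary trees with n nodes, without repetition":
   the uniform distribution on the beta_n trees of size n is the uniform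
   distribution on the list L. *)
Definition enumerates (L : list btree) (n : nat) : Prop :=
  NoDup L /\ forall t, In t L <-> bsize t = n.

Definition prob_le (L : list btree) (g : btree -> R) (x : R) : R :=
  INR (length (filter (fun t => if Rle_dec (g t) x then true else false) L))
  / INR (length L).

Definition mean (L : list btree) (g : btree -> R) : R :=
  fold_right Rplus 0 (map g L) / INR (length L).

Definition variance (L : list btree) (g : btree -> R) : R :=
  mean L (fun t => (g t - mean L g) ^ 2).

Definition normal_cdf (s2 x : R) : R :=
  RInt_gen (fun u => / sqrt (2 * PI * s2) * exp (- u ^ 2 / (2 * s2)))
           (Rbar_locally m_infty) (at_point x).

(* Convergence in distribution of g_n(T_n), T_n uniform on L n, to N(0,s2):
   the CDFs converge at every continuity point of the (continuous) limit CDF,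
   i.e. at every real x. *)
Definition conv_normal (L : nat -> list btree) (g : nat -> btree -> R) (s2 : R)
  : Prop :=
  forall x : R, is_lim_seq (fun n => prob_le (L n) (g n) x) (normal_cdf s2 x).

(* Main.v *)
Require Import Defs.
From Stdlib Require Import Reals List Factorial Arith Lra Lia Permutation.
From Coquelicot Require Import Coquelicot.
Open Scope R_scope.

(* Write Y = X_n - C0 (n+1): an additive functional with toll ln n and value -C0 on the
   empty tree.  Splitting a tree at its root gives recursions for the mean m(n), the
   variance, and the law of Y.

   Mean.  The toll h_n - 2 with h_n = sum_{i <= n} 2/(2i-1) = ln n + const + O(1/n) (and
   value -2 on the empty tree) has the closed-form mean -2 4^n / binom(2n,n).  The remaining
   toll has, up to a constant, mean O(ln n); the choice of C0 makes its linear term vanish.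

   Limit law.  Let u(x,w) be the distribution function of N(0,w) at x, a solution of
   u_w = u_xx / 2, and put v(n) = sigma2 (n+1) h_n.  Comparing E u(x - Y, w) with
   u(x - m(n), w + v(n)), uniformly in x and w >= tau^2, the error of a tree is at most the
   expected sum over its nodes of the one-step errors
   E u(x - D, w + W) - u(x, w), where D and W are the increments of m and v at a split.
   As E D = 0 and E (D^2 + W) = o(sqrt n) (this identifies sigma2), Taylor expansion makes
   the one-step error small enough for the sum to be negligible when tau^2 is a small
   multiple of n ln n.  Letting this multiple tend to 0 gives both limit laws, since the
   same recursion shows that the variance is equivalent to v(n). *)

(** * Finite sums *)

(** A node with n descendants adds about sqrt n to the variance, and all scales of subtree sizes
    contribute equally to the resulting n ln n. After scaling, the root split degenerates, since one
    subtree typically carries almost all nodes; no contraction is available, and errors must be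
    added up over the whole tree. Explicit solutions of the recursion do this: a toll sqrt n costs n
    ln n, a toll 1 costs n, a toll n costs n^(3/2). With tau^2 of order n ln n the Taylor remainders
    have total size n^(3/2) / tau^3 and n^2 / tau^4, so they vanish only by powers of ln n. The
    second-order term carries the weight 1 / tau^2 and would not vanish at all if its mean were of
    order sqrt n per node; this forces the exact evaluation of E (D^2 + W).

    The sums h_n stand in for ln n because the convolutions that arise are then coefficients of
    products of powers of 1-z and ln (1-z), so averages over the root split have closed forms. *)

Definition lsum {A : Type} (f : A -> R) (l : list A) : R :=
  fold_right Rplus 0 (map f l).

Lemma lsum_cons {A : Type} (f : A -> R) x l : lsum f (x :: l) = f x + lsum f l.
Proof. reflexivity. Qed.

Lemma lsum_app {A : Type} (f : A -> R) l1 l2 : lsum f (l1 ++ l2) = lsum f l1 + lsum f l2.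
Proof.
  induction l1 as [|x l1 IH]; simpl; unfold lsum in *; simpl; [lra|].
  rewrite IH; ring.
Qed.

Lemma lsum_ext {A : Type} (f g : A -> R) l :
  (forall x, In x l -> f x = g x) -> lsum f l = lsum g l.
Proof.
  induction l as [|x l IH]; intros H; [reflexivity|].
  rewrite !lsum_cons, IH, (H x); [reflexivity|left; reflexivity|].
  intros y Hy; apply H; right; exact Hy.
Qed.

Lemma lsum_plus {A : Type} (f g : A -> R) l :
  lsum (fun x => f x + g x) l = lsum f l + lsum g l.
Proof.
  induction l as [|x l IH]; [unfold lsum; simpl; lra|].
  rewrite !lsum_cons, IH; ring.
Qed.

Lemma lsum_scal {A : Type} (f : A -> R) a l : lsum (fun x => a * f x) l = a * lsum f l.
Proof.
  induction l as [|x l IH]; [unfold lsum; simpl; lra|].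
  rewrite !lsum_cons, IH; ring.
Qed.

Lemma lsum_minus {A : Type} (f g : A -> R) l :
  lsum (fun x => f x - g x) l = lsum f l - lsum g l.
Proof.
  induction l as [|x l IH]; [unfold lsum; simpl; lra|].
  rewrite !lsum_cons, IH; ring.
Qed.

Lemma lsum_const {A : Type} a (l : list A) : lsum (fun _ => a) l = INR (length l) * a.
Proof.
  induction l as [|x l IH]; [unfold lsum; simpl; lra|].
  rewrite lsum_cons, IH; simpl length; rewrite S_INR; ring.
Qed.

Lemma lsum_le {A : Type} (f g : A -> R) l :
  (forall x, In x l -> f x <= g x) -> lsum f l <= lsum g l.
Proof.
  induction l as [|x l IH]; intros H; [unfold lsum; simpl; lra|].
  rewrite !lsum_cons. apply Rplus_le_compat.
  - apply H; left; reflexivity.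
  - apply IH; intros y Hy; apply H; right; exact Hy.
Qed.

Lemma lsum_abs {A : Type} (f : A -> R) l : Rabs (lsum f l) <= lsum (fun x => Rabs (f x)) l.
Proof.
  induction l as [|x l IH]; [unfold lsum; simpl; rewrite Rabs_R0; lra|].
  rewrite !lsum_cons. eapply Rle_trans; [apply Rabs_triang|lra].
Qed.

Lemma lsum_perm {A : Type} (f : A -> R) l1 l2 : Permutation l1 l2 -> lsum f l1 = lsum f l2.
Proof.
  induction 1; rewrite ?lsum_cons; try lra; reflexivity.
Qed.

Lemma lsum_map {A B : Type} (f : B -> R) (g : A -> B) l :
  lsum f (map g l) = lsum (fun x => f (g x)) l.
Proof. unfold lsum; rewrite map_map; reflexivity. Qed.

Lemma lsum_flat_map {A B : Type} (f : B -> R) (g : A -> list B) l :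
  lsum f (flat_map g l) = lsum (fun x => lsum f (g x)) l.
Proof.
  induction l as [|x l IH]; [reflexivity|].
  simpl flat_map; rewrite lsum_app, IH; reflexivity.
Qed.

Definition rsum (n : nat) (f : nat -> R) : R := lsum f (seq 0 n).

Lemma rsum_S n f : rsum (S n) f = rsum n f + f n.
Proof.
  unfold rsum; rewrite seq_S, lsum_app; unfold lsum at 2; simpl; ring.
Qed.

Lemma rsum_S_l n f : rsum (S n) f = f 0%nat + rsum n (fun k => f (S k)).
Proof.
  unfold rsum; simpl seq; rewrite lsum_cons, <- seq_shift, lsum_map; reflexivity.
Qed.

Lemma rsum_ext n f g :
  (forall k, (k < n)%nat -> f k = g k) -> rsum n f = rsum n g.
Proof. intros H; apply lsum_ext; intros k Hk; apply in_seq in Hk; apply H; lia. Qed.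

Lemma rsum_le n f g :
  (forall k, (k < n)%nat -> f k <= g k) -> rsum n f <= rsum n g.
Proof. intros H; apply lsum_le; intros k Hk; apply in_seq in Hk; apply H; lia. Qed.

Lemma rsum_plus n f g : rsum n (fun k => f k + g k) = rsum n f + rsum n g.
Proof. apply lsum_plus. Qed.

Lemma rsum_minus n f g : rsum n (fun k => f k - g k) = rsum n f - rsum n g.
Proof. apply lsum_minus. Qed.

Lemma rsum_scal n a f : rsum n (fun k => a * f k) = a * rsum n f.
Proof. apply lsum_scal. Qed.

Lemma rsum_rev n f : rsum n f = rsum n (fun k => f (n - 1 - k)%nat).
Proof.
  induction n as [|n IH]; [reflexivity|].
  rewrite rsum_S, IH, rsum_S_l, Rplus_comm.
  f_equal; [f_equal; lia|].
  apply rsum_ext; intros k Hk; f_equal; lia.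
Qed.

(** * Catalan convolutions *)

(* Central binomial coefficients [C(2n,n) / 4^n]: the Taylor coefficients of
   [(1-z)^(-1/2)]. *)
Fixpoint cb (n : nat) : R :=
  match n with
  | O => 1
  | S n => cb n * (2 * INR n + 1) / (2 * INR n + 2)
  end.

(* The probability [beta n / 4^n] that a critical binary Galton-Watson tree has
   [n] nodes, up to a factor 2. *)
Definition pt (n : nat) : R := cb n / (INR n + 1).

(** Logarithmic derivative in a, at a = 1/2, of the n-th coefficient of (1-z)^(-a). Hence
    [cb n * hodd n] is the coefficient of -ln (1-z) (1-z)^(-1/2). *)
Fixpoint hodd (n : nat) : R :=
  match n with
  | O => 0
  | S n => hodd n + 2 / (2 * INR n + 1)
  end.

Fixpoint harm (n : nat) : R :=
  match n with
  | O => 0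
  | S n => harm n + / (INR n + 1)
  end.

Ltac posn := repeat match goal with
  | n : nat |- _ =>
    lazymatch goal with
    | _ : 0 <= INR n |- _ => fail
    | _ => pose proof (pos_INR n)
    end
  end.

Lemma cb_S n : 2 * (INR n + 1) * cb (S n) = (2 * INR n + 1) * cb n.
Proof. simpl cb; posn; field; lra. Qed.

Lemma cb_pos n : 0 < cb n.
Proof.
  induction n as [|n IH]; simpl cb; [lra|]. posn.
  apply Rdiv_lt_0_compat; [apply Rmult_lt_0_compat|]; lra.
Qed.

Lemma pt_S n : 2 * (INR n + 2) * pt (S n) = (2 * INR n + 1) * pt n.
Proof. unfold pt; rewrite S_INR; simpl cb; posn; field; lra. Qed.

Lemma pt_pos n : 0 < pt n.
Proof. unfold pt; posn; apply Rdiv_lt_0_compat; [apply cb_pos|lra]. Qed.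

Lemma pt_0 : pt 0 = 1.
Proof. unfold pt; simpl; field. Qed.

Lemma cb_pt n : cb n = (INR n + 1) * pt n.
Proof. unfold pt; posn; field; lra. Qed.

Lemma pt_beta n : pt n = beta n / 4 ^ n.
Proof.
  unfold beta, pt, Binomial.C.
  replace (2 * n - n)%nat with n by lia.
  rewrite plus_INR; simpl (INR 1).
  assert (H : cb n = INR (fact (2 * n)) / (INR (fact n) * INR (fact n)) / 4 ^ n).
  { induction n as [|n IH]; [simpl; field|].
    replace (2 * S n)%nat with (S (S (2 * n))) by lia.
    rewrite !fact_simpl, !mult_INR, !S_INR, mult_INR.
    simpl cb; rewrite IH. simpl (INR 2); simpl (4 ^ S n). posn.
    field. repeat split; try lra; try apply INR_fact_neq_0. apply pow_nonzero; lra. }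
  rewrite H. posn. field.
  repeat split; try lra; try apply INR_fact_neq_0. apply pow_nonzero; lra.
Qed.

Lemma hodd_ge0 n : 0 <= hodd n.
Proof.
  induction n as [|n IH]; simpl; [lra|]. posn.
  assert (0 < 2 / (2 * INR n + 1)) by (apply Rdiv_lt_0_compat; lra). lra.
Qed.

(* Convolution identities below are coefficient identities between powers of
   [1-z] and [ln (1-z)]; each is proved from the first-order recurrences of the
   coefficients, the convolution [sum x_j y_(n-j)] being weighted by [n = j + (n-j)]. *)

Lemma conv_shift (x y : nat -> R) n :
  rsum n (fun j => x (S j) * y (n - 1 - j)%nat) =
  rsum (S n) (fun j => x j * y (n - j)%nat) - x 0%nat * y n.
Proof.
  rewrite rsum_S_l, Nat.sub_0_r.
  replace (rsum n (fun k => x (S k) * y (n - S k)%nat))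
    with (rsum n (fun j => x (S j) * y (n - 1 - j)%nat)); [ring|].
  apply rsum_ext; intros k Hk; do 2 f_equal; lia.
Qed.

(** The reflection k -> n - k preserves the product, so the weight k averages to n / 2. *)
Lemma rsum_weight (x : nat -> R) n a :
  rsum (S n) (fun k => (2 * INR k + a) * x k * x (n - k)%nat)
  = (INR n + a) * rsum (S n) (fun k => x k * x (n - k)%nat).
Proof.
  set (T := rsum (S n) (fun k => INR k * x k * x (n - k)%nat)).
  assert (E : T = rsum (S n) (fun k => INR (n - k) * x k * x (n - k)%nat)).
  { unfold T; rewrite rsum_rev. apply rsum_ext; intros k Hk.
    replace (S n - 1 - k)%nat with (n - k)%nat by lia.
    replace (n - (n - k))%nat with k by lia. ring. }
  assert (E2 : rsum (S n) (fun k => INR (n - k) * x k * x (n - k)%nat) =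
     INR n * rsum (S n) (fun k => x k * x (n - k)%nat) - T).
  { unfold T; rewrite <- rsum_scal, <- rsum_minus. apply rsum_ext; intros k Hk.
    rewrite minus_INR by lia. ring. }
  rewrite (rsum_ext _ _ (fun k => 2 * (INR k * x k * x (n - k)%nat)
            + a * (x k * x (n - k)%nat))) by (intros; ring).
  rewrite rsum_plus, !rsum_scal. fold T. lra.
Qed.

(** Coefficient form of P = 1 + (z/4) P^2 for the generating function P of [pt], the Catalan
    equation at z/4. *)
Lemma pt_conv n : rsum (S n) (fun k => pt k * pt (n - k)%nat) = 4 * pt (S n).
Proof.
  induction n as [|n IH].
  - unfold rsum, lsum; simpl. rewrite pt_0. unfold pt; simpl; field.
  - pose proof (rsum_weight pt n 1) as E1. rewrite IH in E1.
    pose proof (rsum_weight pt (S n) 2) as E2.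
    rewrite rsum_S_l, pt_0, Nat.sub_0_r in E2; simpl (INR 0) in E2.
    rewrite (rsum_ext (S n) (fun k => (2 * INR (S k) + 2) * pt (S k) * pt (S n - S k)%nat)
      (fun k => (2 * INR k + 1) * pt k * pt (n - k)%nat)) in E2.
    + rewrite E1, S_INR in E2. pose proof (pt_S (S n)) as H. rewrite S_INR in H. posn.
      apply (Rmult_eq_reg_l (INR n + 3)); [|lra]. nra.
    + intros k Hk; rewrite <- pt_S, S_INR. simpl (S n - S k)%nat. ring.
Qed.

Lemma cb_conv n : rsum (S n) (fun k => cb k * cb (n - k)%nat) = 1.
Proof.
  induction n as [|n IH].
  - unfold rsum, lsum; simpl; ring.
  - pose proof (rsum_weight cb n 1) as E1. rewrite IH in E1.
    pose proof (rsum_weight cb (S n) 0) as E2.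
    rewrite rsum_S_l, Nat.sub_0_r in E2; simpl (INR 0) in E2.
    rewrite (rsum_ext (S n) (fun k => (2 * INR (S k) + 0) * cb (S k) * cb (S n - S k)%nat)
      (fun k => (2 * INR k + 1) * cb k * cb (n - k)%nat)) in E2.
    + rewrite E1, S_INR in E2. posn. apply (Rmult_eq_reg_l (INR n + 1)); lra.
    + intros k Hk; rewrite <- cb_S, S_INR. simpl (S n - S k)%nat. ring.
Qed.

(* [x = cb * hodd] and [x = cb] satisfy [2 (j+1) x_(j+1) = (2j+1) x_j + 2 y_j]
   with [y = cb] and [y = 0] respectively. *)
Lemma conv_pt_step (x y : nat -> R) n :
  (forall j, 2 * (INR j + 1) * x (S j) = (2 * INR j + 1) * x j + 2 * y j) ->
  2 * (INR n + 1) * rsum (S n) (fun j => x j * pt (n - j)%nat) - 2 * x n =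
  2 * INR n * rsum n (fun j => x j * pt (n - 1 - j)%nat)
  + 2 * rsum n (fun j => y j * pt (n - 1 - j)%nat).
Proof.
  intros Hx.
  rewrite <- !(rsum_scal n).
  rewrite <- rsum_plus.
  rewrite (rsum_ext n (fun k => 2 * INR n * (x k * pt (n - 1 - k)%nat)
      + 2 * (y k * pt (n - 1 - k)%nat))
    (fun k => 2 * (INR (S k) * x (S k) * pt (n - 1 - k)%nat) +
              2 * ((INR (n - k) + 1) * (x k * pt (n - k)%nat)))).
  2:{ intros k Hk. pose proof (Hx k) as H1.
      replace (n - k)%nat with (S (n - 1 - k)) by lia.
      pose proof (pt_S (n - 1 - k)) as H2.
      assert (E : INR (n - 1 - k) = INR n - 1 - INR k).
      { rewrite !minus_INR by lia. simpl; ring. }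
      rewrite S_INR, E in *. rewrite S_INR.
      replace (2 * ((INR (n - 1 - k) + 1 + 1) * (x k * pt (S (n - 1 - k))))) with
        (x k * (2 * (INR (n-1-k) + 2) * pt (S (n - 1 - k)))) by ring.
      rewrite E, H2.
      replace (2 * ((INR k + 1) * x (S k) * pt (n - 1 - k))) with
        (2 * (INR k + 1) * x (S k) * pt (n - 1 - k)) by ring.
      rewrite H1. ring. }
  rewrite rsum_plus, !rsum_scal.
  rewrite (conv_shift (fun j => INR j * x j) pt n); simpl (INR 0).
  rewrite <- (rsum_scal (S n)).
  rewrite (rsum_S n), (rsum_S n (fun j => INR j * x j * pt (n - j)%nat)), Nat.sub_diag, pt_0.
  rewrite (rsum_ext n (fun k => 2 * (INR n + 1) * (x k * pt (n - k)%nat))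
     (fun k => 2 * (INR k * x k * pt (n - k)%nat)
               + 2 * ((INR (n - k) + 1) * (x k * pt (n - k)%nat)))).
  - rewrite rsum_plus, !rsum_scal. ring.
  - intros k Hk; rewrite minus_INR by lia; ring.
Qed.

(** [pt] has generating function 2 (1 - (1-z)^(1/2)) / z, so its product with (1-z)^(-1/2) is 2
    ((1-z)^(-1/2) - 1) / z. *)
Lemma cb_pt_conv n :
  rsum (S n) (fun j => cb j * pt (n - j)%nat) = 2 * cb (S n).
Proof.
  induction n as [|n IH].
  - unfold rsum, lsum; simpl. rewrite pt_0. field.
  - pose proof (conv_pt_step cb (fun _ => 0) (S n)) as E.
    rewrite (rsum_ext (S n) (fun j => cb j * pt (S n - 1 - j)%nat)
              (fun j => cb j * pt (n - j)%nat)) in E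
      by (intros; do 2 f_equal; lia).
    rewrite (rsum_scal (S n) 0 (fun j => pt (S n - 1 - j)%nat)), IH in E.
    assert (H : forall j, 2 * (INR j + 1) * cb (S j) = (2 * INR j + 1) * cb j + 2 * 0).
    { intros j; rewrite cb_S; ring. }
    specialize (E H). pose proof (cb_S (S n)) as Hc. rewrite S_INR in *. posn.
    apply (Rmult_eq_reg_l (INR n + 2)); [|lra]. nra.
Qed.

(** Same product with the additional factor -ln (1-z); the term 2 / (n+1) is the bare logarithm left
    over. *)
Lemma cb_hodd_pt_conv n :
  rsum (S n) (fun j => cb j * hodd j * pt (n - j)%nat)
  = 2 * (cb (S n) * hodd (S n)) - 2 / (INR n + 1).
Proof.
  assert (H : forall j, 2 * (INR j + 1) * (cb (S j) * hodd (S j))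
              = (2 * INR j + 1) * (cb j * hodd j) + 2 * cb j).
  { intros j. rewrite <- Rmult_assoc, cb_S. simpl hodd. posn. field. lra. }
  induction n as [|n IH].
  - unfold rsum, lsum; simpl. field.
  - pose proof (conv_pt_step (fun j => cb j * hodd j) cb (S n) H) as E.
    cbv beta in E.
    rewrite (rsum_ext (S n) (fun j => cb j * hodd j * pt (S n - 1 - j)%nat)
              (fun j => cb j * hodd j * pt (n - j)%nat)) in E
      by (intros; do 2 f_equal; lia).
    rewrite (rsum_ext (S n) (fun j => cb j * pt (S n - 1 - j)%nat)
              (fun j => cb j * pt (n - j)%nat)) in E
      by (intros; do 2 f_equal; lia).
    rewrite IH, cb_pt_conv in E.
    pose proof (H (S n)) as H1. rewrite S_INR in *.
    cbv beta in E. posn.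
    apply (Rmult_eq_reg_l (2 * (INR n + 1 + 1))); [|lra].
    rewrite Rmult_minus_distr_l.
    replace (2 * (INR n + 1 + 1) * (2 * (cb (S (S n)) * hodd (S (S n))))) with
       (2 * (2 * (INR n + 1 + 1) * (cb (S (S n)) * hodd (S (S n))))) by ring.
    rewrite H1.
    replace (2 * (INR n + 1 + 1) * (2 / (INR n + 1 + 1))) with 4 by (field; lra).
    replace (2 * (INR n + 1) * (2 * (cb (S n) * hodd (S n)) - 2 / (INR n + 1))) with
      (4 * (INR n + 1) * (cb (S n) * hodd (S n)) - 4) in E by (field; lra).
    lra.
Qed.

Lemma pt_sum n : rsum n pt = 2 - 2 * cb n.
Proof.
  induction n as [|n IH]; [unfold rsum, lsum; simpl; lra|].
  rewrite rsum_S, IH. pose proof (cb_S n) as H. rewrite (cb_pt n) in *. posn.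
  apply (Rmult_eq_reg_l (INR n + 1)); [|lra]. nra.
Qed.

(** The constant 2 is chosen so that the full sum is 0: the toll [hodd - 2], with value -2 on the
    empty tree, has a mean without linear term. *)
Lemma pt_hodd_sum n :
  rsum (S n) (fun j => pt j * (hodd j - 2)) = - 2 * (cb (S n) * hodd (S n)).
Proof.
  induction n as [|n IH].
  - unfold rsum, lsum; simpl. rewrite pt_0. field.
  - rewrite rsum_S, IH. pose proof (cb_S (S n)) as H. rewrite (cb_pt (S n)) in *.
    change (hodd (S (S n))) with (hodd (S n) + 2 / (2 * INR (S n) + 1)).
    rewrite S_INR in *. posn.
    replace (cb (S (S n))) with ((2 * (INR n + 1) + 1) * pt (S n) / 2).
    + field; lra.
    + apply (Rmult_eq_reg_l (2 * (INR n + 1 + 1))); [|lra]. rewrite H. field.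
Qed.

(** Convolution of [pt] with the coefficients of -ln (1-z). It is needed for the means -2 / [cb k],
    because [pt k / cb k] is 1 / (k+1). *)
Lemma pt_recip_conv n :
  rsum n (fun j => pt j / (INR n - INR j)) = (hodd n - 2) * pt n + 2 / (INR n + 1).
Proof.
  induction n as [|n IH].
  - unfold rsum, lsum; simpl. rewrite pt_0. field.
  - rewrite rsum_S_l, pt_0; simpl (INR 0).
    assert (E : rsum n (fun j => (2 * INR j + 1) * pt j / (INR n - INR j)) =
                (2 * INR n + 1) * rsum n (fun j => pt j / (INR n - INR j)) - 2 * rsum n pt).
    { rewrite <- !rsum_scal, <- rsum_minus. apply rsum_ext; intros k Hk.
      apply lt_INR in Hk. field. lra. }
    rewrite (rsum_ext n _ (fun k => 2 * (INR n + 2) * (pt (S k) / (INR (S n) - INR (S k)))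
                              - 2 * pt (S k))) in E.
    + rewrite rsum_minus, !rsum_scal in E.
      pose proof (pt_sum (S n)) as Hs. rewrite rsum_S_l, pt_0 in Hs.
      rewrite pt_sum, IH in E. rewrite S_INR in *.
      pose proof (pt_S n) as H. rewrite (cb_pt (S n)), S_INR in Hs.
      rewrite (cb_pt n) in E. posn.
      simpl hodd.
      set (s1 := rsum n (fun k => pt (S k) / (INR n + 1 - INR (S k)))) in *.
      set (s2 := rsum n (fun k => pt (S k))) in *.
      assert (Hp : pt (S n) = (2 * INR n + 1) * pt n / (2 * (INR n + 2))).
      { rewrite <- H; field; lra. }
      assert (E2 : s2 = 1 - 2 * ((INR n + 2) * pt (S n))) by lra.
      replace s1 with (((2 * INR n + 1) * ((hodd n - 2) * pt n + 2 / (INR n + 1)) -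
        2 * (2 - 2 * ((INR n + 1) * pt n)) + 2 * s2) / (2 * (INR n + 2))).
      * rewrite E2, Hp; field; lra.
      * rewrite <- E; field; lra.
    + intros k Hk. apply lt_INR in Hk. rewrite <- pt_S, !S_INR. field. lra.
Qed.

Lemma recip_conv n :
  rsum n (fun j => / ((INR j + 1) * (INR n - INR j))) = 2 * harm n / (INR n + 1).
Proof.
  assert (H : rsum n (fun j => / (INR j + 1)) = harm n).
  { induction n as [|n IH]; [reflexivity|]. rewrite rsum_S, IH. reflexivity. }
  assert (H2 : rsum n (fun j => / (INR n - INR j)) = harm n).
  { rewrite <- H, (rsum_rev n (fun j => / (INR j + 1))). apply rsum_ext; intros k Hk.
    f_equal. rewrite !minus_INR by lia. simpl; ring. }
  replace (2 * harm n / (INR n + 1)) with (/ (INR n + 1) * harm n + / (INR n + 1) * harm n)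
    by (posn; field; lra).
  rewrite <- H at 1; rewrite <- H2, <- !rsum_scal, <- rsum_plus.
  apply rsum_ext; intros k Hk. apply lt_INR in Hk. posn. field. lra.
Qed.

(** * The tree recursion *)

(* The law of the size [k] of the left subtree of a uniform tree with [n + 1] nodes. *)
Definition rootavg (n : nat) (f : nat -> R) : R :=
  rsum (S n) (fun k => pt k * pt (n - k) / (4 * pt (S n)) * f k).

Lemma rootavg_ext n f g :
  (forall k, (k <= n)%nat -> f k = g k) -> rootavg n f = rootavg n g.
Proof. intros H; apply rsum_ext; intros k Hk; rewrite H by lia; reflexivity. Qed.

Lemma rootavg_plus n f g : rootavg n (fun k => f k + g k) = rootavg n f + rootavg n g.
Proof.
  unfold rootavg; rewrite <- rsum_plus; apply rsum_ext; intros; ring.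
Qed.

Lemma rootavg_minus n f g : rootavg n (fun k => f k - g k) = rootavg n f - rootavg n g.
Proof.
  unfold rootavg; rewrite <- rsum_minus; apply rsum_ext; intros; ring.
Qed.

Lemma rootavg_scal n a f : rootavg n (fun k => a * f k) = a * rootavg n f.
Proof.
  unfold rootavg; rewrite <- rsum_scal; apply rsum_ext; intros; ring.
Qed.

Lemma rootavg_const n a : rootavg n (fun _ => a) = a.
Proof.
  unfold rootavg.
  rewrite (rsum_ext _ _ (fun k => a / (4 * pt (S n)) * (pt k * pt (n - k)%nat))).
  - rewrite rsum_scal, pt_conv. pose proof (pt_pos (S n)). field; lra.
  - intros; pose proof (pt_pos (S n)); field; lra.
Qed.

Lemma rootavg_le n f g :
  (forall k, (k <= n)%nat -> f k <= g k) -> rootavg n f <= rootavg n g.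
Proof.
  intros H; apply rsum_le; intros k Hk.
  apply Rmult_le_compat_l; [|apply H; lia].
  pose proof (pt_pos k); pose proof (pt_pos (n - k)); pose proof (pt_pos (S n)).
  apply Rlt_le, Rdiv_lt_0_compat; [apply Rmult_lt_0_compat|]; lra.
Qed.

Lemma rootavg_abs n f : Rabs (rootavg n f) <= rootavg n (fun k => Rabs (f k)).
Proof.
  eapply Rle_trans; [apply lsum_abs|].
  right; apply rsum_ext; intros k Hk.
  rewrite Rabs_mult. f_equal. apply Rabs_pos_eq.
  pose proof (pt_pos k); pose proof (pt_pos (n - k)); pose proof (pt_pos (S n)).
  apply Rlt_le, Rdiv_lt_0_compat; [apply Rmult_lt_0_compat|]; lra.
Qed.

Lemma rootavg_sym n f : rootavg n (fun k => f (n - k)%nat) = rootavg n f.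
Proof.
  unfold rootavg; rewrite (rsum_rev (S n)). apply rsum_ext; intros k Hk.
  replace (S n - 1 - k)%nat with (n - k)%nat by lia.
  replace (n - (n - k))%nat with k by lia.
  pose proof (pt_pos (S n)); field; lra.
Qed.

Lemma rootavg_pair n f :
  rootavg n (fun k => f k + f (n - k)%nat)
  = rsum (S n) (fun k => pt k * f k * pt (n - k)%nat) / (2 * pt (S n)).
Proof.
  rewrite rootavg_plus, rootavg_sym. unfold rootavg.
  pose proof (pt_pos (S n)).
  rewrite (rsum_ext (S n) _ (fun k => / (4 * pt (S n)) * (pt k * f k * pt (n - k)%nat))).
  - rewrite rsum_scal. field; lra.
  - intros; field; lra.
Qed.

(** Makes [/ pt n], of order n^(3/2), an exact solution of the recursion with toll n + 1. *)
Lemma rootavg_recip_pt n :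
  rootavg n (fun k => / pt k + / pt (n - k)) = / pt (S n) - (INR n + 2).
Proof.
  rewrite (rootavg_pair n (fun k => / pt k)).
  rewrite (rsum_ext _ _ (fun k => pt (S n - 1 - k)%nat)).
  - rewrite <- rsum_rev, pt_sum, cb_pt, S_INR. pose proof (pt_pos (S n)). field; lra.
  - intros k Hk. pose proof (pt_pos k).
    replace (S n - 1 - k)%nat with (n - k)%nat by lia. field; lra.
Qed.

(** Makes (n+1) [hodd n] an exact solution for a toll of order sqrt n. This is the source of the n
    ln n variance. *)
Lemma rootavg_var n :
  rootavg n (fun k => (INR k + 1) * hodd k + (INR (n - k) + 1) * hodd (n - k))
  = (INR n + 2) * hodd (S n) - / ((INR n + 1) * pt (S n)).
Proof.
  rewrite (rootavg_pair n (fun k => (INR k + 1) * hodd k)).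
  rewrite (rsum_ext _ _ (fun k => cb k * hodd k * pt (n - k)%nat)).
  - rewrite cb_hodd_pt_conv, cb_pt, S_INR. pose proof (pt_pos (S n)). posn. field; lra.
  - intros; rewrite cb_pt; ring.
Qed.

Lemma rootavg_mean n :
  rootavg n (fun k => - 2 / cb k + - 2 / cb (n - k))
  = - 2 / cb (S n) - (hodd (S n) - 2).
Proof.
  rewrite (rootavg_pair n (fun k => - 2 / cb k)).
  rewrite (rsum_ext _ _ (fun k => - 2 * (pt (S n - 1 - k)%nat / (INR (S n) - INR (S n - 1 - k))))).
  - rewrite rsum_scal, <- (rsum_rev (S n) (fun k => pt k / (INR (S n) - INR k))).
    rewrite pt_recip_conv, cb_pt, S_INR. pose proof (pt_pos (S n)). posn. field; lra.
  - intros k Hk. replace (S n - 1 - k)%nat with (n - k)%nat by lia.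
    rewrite cb_pt, S_INR, !minus_INR by lia. pose proof (pt_pos k). posn. field; lra.
Qed.

Lemma rootavg_cross n :
  rootavg n (fun k => / (cb k * cb (n - k))) = harm (S n) / (2 * cb (S n)).
Proof.
  unfold rootavg. pose proof (pt_pos (S n)).
  rewrite (rsum_ext _ _ (fun k => / (4 * pt (S n)) *
             / ((INR k + 1) * (INR (S n) - INR k)))).
  - rewrite rsum_scal, recip_conv, cb_pt, S_INR. posn. field; lra.
  - intros k Hk. rewrite !cb_pt. rewrite S_INR, minus_INR by lia.
    pose proof (pt_pos k). pose proof (pt_pos (n - k)). posn.
    apply lt_INR in Hk. rewrite S_INR in Hk. field. repeat split; lra.
Qed.

Lemma rootavg_prod n :
  rootavg n (fun k => (INR k + 1) * (INR (n - k) + 1)) = / (4 * pt (S n)).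
Proof.
  unfold rootavg. pose proof (pt_pos (S n)).
  rewrite (rsum_ext _ _ (fun k => / (4 * pt (S n)) * (cb k * cb (n - k)%nat))).
  - rewrite rsum_scal, cb_conv. ring.
  - intros k Hk. rewrite !cb_pt. field. lra.
Qed.

(* Comparison principle for the tree recursion: [g] is a supersolution. *)
Lemma rootavg_compare (N : nat) (f g : nat -> R) :
  f 0%nat <= g 0%nat ->
  (forall n, (n < N)%nat -> exists toll,
    f (S n) <= rootavg n (fun k => f k + f (n - k)%nat) + toll /\
    rootavg n (fun k => g k + g (n - k)%nat) + toll <= g (S n)) ->
  forall n, (n <= N)%nat -> f n <= g n.
Proof.
  intros H0 HS n. induction n as [n IH] using lt_wf_ind. intros Hn.
  destruct n as [|n]; [exact H0|].
  destruct (HS n) as [toll [H1 H2]]; [lia|].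
  eapply Rle_trans; [exact H1|]. eapply Rle_trans; [|exact H2].
  apply Rplus_le_compat_r, rootavg_le. intros k Hk.
  apply Rplus_le_compat; apply IH; lia.
Qed.

Lemma NoDup_flat_map {A B : Type} (f : A -> list B) (l : list A) :
  NoDup l -> (forall x, In x l -> NoDup (f x)) ->
  (forall x y z, In x l -> In y l -> In z (f x) -> In z (f y) -> x = y) ->
  NoDup (flat_map f l).
Proof.
  induction l as [|x l IH]; intros Hl Hf Hd; simpl; [constructor|].
  inversion Hl as [|? ? Hx Hl']; subst.
  apply NoDup_app.
  - apply Hf; left; reflexivity.
  - apply IH; auto.
    + intros y Hy; apply Hf; right; exact Hy.
    + intros y y' z Hy Hy'; apply Hd; right; assumption.
  - intros z Hz Hz'. apply in_flat_map in Hz'. destruct Hz' as [y [Hy Hzy]].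
    apply Hx. rewrite (Hd x y z); simpl; auto.
Qed.

(** * Averages over uniform trees and the root decomposition *)

Section Trees.

Context (L : nat -> list btree) (HL : forall n, enumerates (L n) n).

Lemma trees_0 : L 0 = Defs.Empty :: nil.
Proof.
  destruct (HL 0) as [Hd Hi].
  apply Permutation_length_1_inv, NoDup_Permutation; auto.
  - repeat constructor; simpl; tauto.
  - intros t; rewrite Hi; simpl; split.
    + intros [<-|[]]; reflexivity.
    + destruct t; [left; reflexivity|discriminate].
Qed.

Lemma trees_S n :
  Permutation (L (S n))
    (flat_map (fun k => flat_map (fun l => map (Node l) (L (n - k))) (L k))
       (seq 0 (S n))).
Proof.
  destruct (HL (S n)) as [Hd Hi]. apply NoDup_Permutation; auto.
  - apply NoDup_flat_map.
    + apply seq_NoDup.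
    + intros k Hk. apply NoDup_flat_map.
      * apply HL.
      * intros l Hl. apply FinFun.Injective_map_NoDup; [|apply HL].
        intros r r' H; inversion H; reflexivity.
      * intros l l' z _ _ Hz Hz'. apply in_map_iff in Hz, Hz'.
        destruct Hz as [r [<- _]], Hz' as [r' [E _]]. inversion E; reflexivity.
    + intros k k' z _ _ Hz Hz'. apply in_flat_map in Hz, Hz'.
      destruct Hz as [l [Hl Hz]], Hz' as [l' [Hl' Hz']].
      apply in_map_iff in Hz, Hz'.
      destruct Hz as [r [<- _]], Hz' as [r' [E _]]. inversion E; subst.
      apply HL in Hl, Hl'. congruence.
  - intros t; rewrite Hi, in_flat_map. split.
    + destruct t as [|l r]; simpl; [discriminate|]. intros H.
      exists (bsize l); split; [apply (in_seq (S n)); lia|].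
      apply in_flat_map; exists l; split; [apply HL; reflexivity|].
      apply in_map, HL. lia.
    + intros [k [Hk H]]. apply (in_seq (S n)) in Hk. apply in_flat_map in H.
      destruct H as [l [Hl H]]. apply in_map_iff in H. destruct H as [r [<- Hr]].
      apply HL in Hl, Hr. simpl. lia.
Qed.

Lemma lsum_trees n (F : btree -> R) :
  lsum F (L (S n)) =
  rsum (S n) (fun k => lsum (fun l => lsum (fun r => F (Node l r)) (L (n - k))) (L k)).
Proof.
  rewrite (lsum_perm _ _ _ (trees_S n)), lsum_flat_map.
  apply rsum_ext; intros k _. rewrite lsum_flat_map.
  apply lsum_ext; intros l _. apply lsum_map.
Qed.

Lemma length_trees n : INR (length (L n)) = 4 ^ n * pt n.
Proof.
  induction n as [n IH] using lt_wf_ind.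
  destruct n as [|n].
  - rewrite trees_0, pt_0; simpl; ring.
  - transitivity (lsum (fun _ => 1) (L (S n))); [rewrite lsum_const; ring|].
    rewrite lsum_trees.
    rewrite (rsum_ext _ _ (fun k => 4 ^ n * (pt k * pt (n - k)%nat))).
    + rewrite rsum_scal, pt_conv. simpl. ring.
    + intros k Hk. rewrite (lsum_ext _ (fun _ => INR (length (L (n - k))))).
      * rewrite lsum_const, !IH by lia.
        replace (4 ^ n) with (4 ^ k * 4 ^ (n - k)); [ring|].
        rewrite <- pow_add; f_equal; lia.
      * intros l _. rewrite lsum_const; ring.
Qed.

Lemma trees_nonempty n : 0 < INR (length (L n)).
Proof.
  rewrite length_trees. apply Rmult_lt_0_compat; [apply pow_lt; lra|apply pt_pos].
Qed.

Lemma mean_lsum n F : mean (L n) F = lsum F (L n) / INR (length (L n)).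
Proof. reflexivity. Qed.

Lemma mean_0 F : mean (L 0) F = F Defs.Empty.
Proof. rewrite trees_0; unfold mean; simpl; field. Qed.

(** The left subtree has size k with probability beta_k beta_(n-k) / beta_(n+1); the powers of 4
    cancel up to the single factor 4 in [rootavg]. *)
Lemma mean_S n F :
  mean (L (S n)) F =
  rootavg n (fun k => mean (L k) (fun l => mean (L (n - k)) (fun r => F (Node l r)))).
Proof.
  unfold mean at 1. fold (lsum F (L (S n))). rewrite lsum_trees. unfold rootavg.
  unfold Rdiv at 1. rewrite Rmult_comm, <- rsum_scal. apply rsum_ext; intros k Hk.
  unfold mean. rewrite !length_trees.
  rewrite (lsum_ext (fun l => lsum (fun r => F (Node l r)) (L (n - k)))
    (fun l => (4 ^ (n - k) * pt (n - k)) *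
        (fold_right Rplus 0 (map (fun r => F (Node l r)) (L (n - k)))
          / (4 ^ (n - k) * pt (n - k))))).
  - rewrite lsum_scal. unfold lsum.
    replace (4 ^ S n) with (4 * (4 ^ k * 4 ^ (n - k))).
    + pose proof (pt_pos k). pose proof (pt_pos (n - k)). pose proof (pt_pos (S n)).
      assert (0 < 4 ^ k) by (apply pow_lt; lra).
      assert (0 < 4 ^ (n - k)) by (apply pow_lt; lra).
      field. repeat split; lra.
    + rewrite <- pow_add. simpl. do 2 f_equal; lia.
  - intros l _. pose proof (pt_pos (n - k)). unfold lsum.
    assert (0 < 4 ^ (n - k)) by (apply pow_lt; lra). field. lra.
Qed.

Lemma mean_ext n F G :
  (forall t, bsize t = n -> F t = G t) -> mean (L n) F = mean (L n) G.
Proof.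
  intros H. unfold mean. f_equal. apply lsum_ext. intros t Ht; apply H, HL, Ht.
Qed.

Lemma mean_le n F G : (forall t, F t <= G t) -> mean (L n) F <= mean (L n) G.
Proof.
  intros H. unfold mean, Rdiv. apply Rmult_le_compat_r.
  - apply Rlt_le, Rinv_0_lt_compat, trees_nonempty.
  - apply lsum_le; auto.
Qed.

Lemma mean_plus n F G : mean (L n) (fun t => F t + G t) = mean (L n) F + mean (L n) G.
Proof.
  rewrite !mean_lsum, lsum_plus. field.
  apply Rgt_not_eq, trees_nonempty.
Qed.

Lemma mean_scal n a F : mean (L n) (fun t => a * F t) = a * mean (L n) F.
Proof.
  rewrite !mean_lsum, lsum_scal. field.
  apply Rgt_not_eq, trees_nonempty.
Qed.

Lemma mean_const n a : mean (L n) (fun _ => a) = a.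
Proof.
  rewrite !mean_lsum, lsum_const. field.
  apply Rgt_not_eq, trees_nonempty.
Qed.

End Trees.

(** * Asymptotics of the coefficients *)

Lemma ln_le_sub1 x : 0 < x -> ln x <= x - 1.
Proof.
  intros Hx. destruct (Req_dec (ln x) 0) as [E|E].
  - rewrite E. rewrite <- (exp_ln x Hx), E, exp_0. lra.
  - pose proof (exp_ineq1 (ln x) E). rewrite exp_ln in H; lra.
Qed.

(** The increments of ln satisfy the same two bounds. Hence s n - ln n, corrected by + 1/n or by -
    1/n, is monotone, and the two corrected sequences enclose kappa. *)
Lemma log_asymptotics (s : nat -> R) :
  (forall n, (1 <= n)%nat -> / (INR n + 1) <= s (S n) - s n <= / INR n) ->
  exists kappa, forall n, (1 <= n)%nat -> Rabs (s n - ln (INR n) - kappa) <= / INR n.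
Proof.
  intros Hs.
  set (U := fun n => s (S n) - ln (INR (S n)) + / INR (S n)).
  set (V := fun n => s (S n) - ln (INR (S n)) - / INR (S n)).
  assert (Hln : forall n, / (INR (S n) + 1) <= ln (INR (S (S n))) - ln (INR (S n))
                          <= / INR (S n)).
  { intros n. rewrite (S_INR (S n)). pose proof (lt_0_INR (S n) ltac:(lia)) as Hp.
    split.
    - pose proof (ln_le_sub1 (INR (S n) / (INR (S n) + 1))) as H.
      rewrite ln_div in H by lra.
      assert (0 < INR (S n) / (INR (S n) + 1)) by (apply Rdiv_lt_0_compat; lra).
      specialize (H H0).
      replace (INR (S n) / (INR (S n) + 1) - 1) with (- / (INR (S n) + 1)) in H
        by (field; lra). lra.
    - pose proof (ln_le_sub1 ((INR (S n) + 1) / INR (S n))) as H.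
      rewrite ln_div in H by lra.
      assert (0 < (INR (S n) + 1) / INR (S n)) by (apply Rdiv_lt_0_compat; lra).
      specialize (H H0).
      replace ((INR (S n) + 1) / INR (S n) - 1) with (/ INR (S n)) in H
        by (field; lra). lra. }
  assert (HU : forall n, U (S n) <= U n).
  { intros n. unfold U. pose proof (Hs (S n) ltac:(lia)). pose proof (Hln n).
    rewrite (S_INR (S n)) in *. lra. }
  assert (HV : forall n, V n <= V (S n)).
  { intros n. unfold V. pose proof (Hs (S n) ltac:(lia)). pose proof (Hln n).
    rewrite (S_INR (S n)) in *. lra. }
  assert (HVU : forall n, V n <= U n).
  { intros n. unfold U, V. pose proof (Rinv_0_lt_compat _ (lt_0_INR (S n) ltac:(lia))).
    lra. }
  assert (HU' : forall n k, U (n + k)%nat <= U n).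
  { intros n k; induction k as [|k IH]; [rewrite Nat.add_0_r; lra|].
    rewrite Nat.add_succ_r. eapply Rle_trans; [apply HU|exact IH]. }
  destruct (ex_finite_lim_seq_incr V (U 0%nat)) as [kappa Hk]; [exact HV| |].
  { intros n; eapply Rle_trans; [apply HVU|apply (HU' 0%nat n)]. }
  exists kappa. intros n Hn. destruct n as [|n]; [lia|].
  assert (H1 : V n <= kappa) by (apply is_lim_seq_incr_compare; assumption).
  assert (H2 : Rbar_le kappa (U n)).
  { apply (is_lim_seq_le_loc V (fun _ => U n)); [|exact Hk|apply is_lim_seq_const].
    exists n; intros k Hk'. replace k with (n + (k - n))%nat by lia.
    eapply Rle_trans; [apply HVU|apply HU']. }
  simpl in H2. unfold U, V in *. apply Rabs_le. lra.
Qed.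

Lemma hodd_asymptotics :
  exists kappa, forall n, (1 <= n)%nat ->
    Rabs (hodd n - ln (INR n) - kappa) <= / INR n.
Proof.
  apply log_asymptotics. intros n Hn. simpl hodd.
  apply le_INR in Hn. simpl in Hn.
  replace (hodd n + 2 / (2 * INR n + 1) - hodd n) with (/ ((2 * INR n + 1) / 2))
    by (field; lra).
  split; apply Rinv_le_contravar; lra.
Qed.

Lemma hodd_harm n : hodd n = 2 * harm (2 * n) - harm n.
Proof.
  induction n as [|n IH]; [simpl; lra|].
  replace (2 * S n)%nat with (S (S (2 * n))) by lia.
  simpl hodd; rewrite IH. cbn [harm]. rewrite S_INR, mult_INR. posn. simpl (INR 2).
  field; lra.
Qed.

(** The ln 2 of [sigma2] enters here: the difference is 2 (harm (2n) - harm n), in which Euler's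
    constant cancels. The 3 is 2 * (1/2) + 2, from the errors at 2n and at n. *)
Lemma hodd_sub_harm n :
  Rabs (hodd (S n) - harm (S n) - 2 * ln 2) <= 3 / (INR n + 1).
Proof.
  destruct (log_asymptotics harm) as [g Hg].
  { intros m Hm. cbn [harm]. apply le_INR in Hm. simpl in Hm.
    replace (harm m + / (INR m + 1) - harm m) with (/ (INR m + 1)) by ring.
    split; [lra|]. apply Rinv_le_contravar; lra. }
  pose proof (Hg (S n) ltac:(lia)) as H1.
  pose proof (Hg (2 * S n)%nat ltac:(lia)) as H2.
  pose proof (lt_0_INR (S n) ltac:(lia)) as Hp.
  rewrite mult_INR in H2. replace (INR 2) with 2 in H2 by (simpl; ring).
  rewrite ln_mult in H2 by lra.
  rewrite hodd_harm. rewrite Rinv_mult in H2.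
  replace (3 / (INR n + 1)) with (3 * / INR (S n)) by (rewrite S_INR; reflexivity).
  apply Rabs_le_between in H1, H2. apply Rabs_le. lra.
Qed.

Lemma inv_cb_sq_S n :
  / cb (S n) ^ 2 = / cb n ^ 2 * (2 * INR n + 2) ^ 2 / (2 * INR n + 1) ^ 2.
Proof. simpl cb. pose proof (cb_pos n). posn. field. repeat split; lra. Qed.

Lemma inv_cb_sq_bounds n : 2 * INR n + 1 <= / cb n ^ 2 <= 4 * INR n + 1.
Proof.
  induction n as [|n [IH1 IH2]]; [simpl; lra|].
  rewrite inv_cb_sq_S, S_INR. posn.
  assert (0 < (2 * INR n + 1) ^ 2) by (apply pow_lt; lra).
  split.
  - apply Rle_div_r; [lra|].
    apply Rle_trans with ((2 * INR n + 1) * (2 * INR n + 2) ^ 2); [|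
      apply Rmult_le_compat_r; [apply pow2_ge_0|lra]].
    nra.
  - apply Rle_div_l; [lra|].
    apply Rle_trans with ((4 * INR n + 1) * (2 * INR n + 2) ^ 2).
    + apply Rmult_le_compat_r; [apply pow2_ge_0|lra].
    + nra.
Qed.

(* The constant [A] is [PI], by Wallis' formula, but its value is irrelevant. *)
Lemma inv_cb_sq_linear :
  exists A, 0 <= A <= 4 /\ forall n, A * INR n <= / cb n ^ 2 <= A * (INR n + 1).
Proof.
  set (u := fun n => / cb n ^ 2 / (INR n + /2)).
  assert (Hu : forall n, u n <= u (S n)).
  { intros n. unfold u. rewrite inv_cb_sq_S, S_INR. posn.
    assert (0 < / cb n ^ 2) by (apply Rinv_0_lt_compat, pow_lt, cb_pos).
    apply Rle_div_l; [lra|].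
    replace (/ cb n ^ 2 * (2 * INR n + 2) ^ 2 / (2 * INR n + 1) ^ 2 / (INR n + 1 + /2)
       * (INR n + /2)) with (/ cb n ^ 2 * ((2 * INR n + 2) ^ 2 /
          ((2 * INR n + 1) * (2 * INR n + 3)))).
    2:{ generalize (/ cb n ^ 2); intros; field. lra. }
    rewrite <- (Rmult_1_r (/ cb n ^ 2)) at 1. apply Rmult_le_compat_l; [lra|].
    apply Rle_div_r; nra. }
  destruct (ex_finite_lim_seq_incr u 4) as [A HA]; [exact Hu| |].
  { intros n. unfold u. posn. apply Rle_div_l; [lra|].
    pose proof (inv_cb_sq_bounds n). lra. }
  assert (H1 : forall n, u n <= A) by (intros; apply is_lim_seq_incr_compare; assumption).
  exists A. split; [split|].
  - eapply Rle_trans; [|apply (H1 0%nat)]. unfold u; simpl; lra.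
  - change (Rbar_le A 4).
    apply (is_lim_seq_le u (fun _ => 4)); [|exact HA|apply is_lim_seq_const].
    intros n. unfold u. posn. apply Rle_div_l; [lra|].
    pose proof (inv_cb_sq_bounds n). lra.
  - intros n. split.
    + destruct n as [|n].
      { simpl. lra. }
      (* Divided by n + 1/2 the sequence increases to A; divided by n it decreases, so it dominates
         [u] and stays above A. *)
      set (w := fun n => / cb (S n) ^ 2 / INR (S n)).
      assert (Hw : forall k, w (n + k)%nat <= w n).
      { intros k; induction k as [|k IH]; [rewrite Nat.add_0_r; lra|].
        eapply Rle_trans; [|exact IH]. rewrite Nat.add_succ_r.
        generalize (n + k)%nat; intros m. unfold w.
        rewrite (inv_cb_sq_S (S m)), !S_INR. pose proof (pos_INR m).
        assert (0 < / cb (S m) ^ 2) by (apply Rinv_0_lt_compat, pow_lt, cb_pos).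
        apply Rle_div_l; [lra|].
        replace (/ cb (S m) ^ 2 / (INR m + 1) * (INR m + 1 + 1)) with
          (/ cb (S m) ^ 2 * ((INR m + 2) / (INR m + 1)))
          by (generalize (/ cb (S m) ^ 2); intros; field; lra).
        replace (/ cb (S m) ^ 2 * (2 * (INR m + 1) + 2) ^ 2 / (2 * (INR m + 1) + 1) ^ 2)
          with (/ cb (S m) ^ 2 * ((2 * (INR m + 1) + 2) ^ 2 / (2 * (INR m + 1) + 1) ^ 2))
          by (generalize (/ cb (S m) ^ 2); intros; field; lra).
        apply Rmult_le_compat_l; [lra|].
        apply Rle_div_l; [apply pow_lt; lra|].
        apply (Rmult_le_reg_r (INR m + 1)); [lra|].
        replace ((INR m + 2) / (INR m + 1) * (2 * (INR m + 1) + 1) ^ 2 * (INR m + 1))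
          with ((INR m + 2) * (2 * (INR m + 1) + 1) ^ 2) by (field; lra).
        nra. }
      pose proof (lt_0_INR (S n) ltac:(lia)) as Hp.
      apply Rle_div_r; [lra|]. change (Rbar_le A (w n)).
      apply (is_lim_seq_le_loc u (fun _ => w n)); [|exact HA|apply is_lim_seq_const].
      exists (S n); intros k Hk. destruct k as [|k]; [lia|].
      apply Rle_trans with (w k).
      * unfold u, w. apply Rmult_le_compat_l.
        -- apply Rlt_le, Rinv_0_lt_compat, pow_lt, cb_pos.
        -- pose proof (lt_0_INR (S k) ltac:(lia)). apply Rinv_le_contravar; lra.
      * replace k with (n + (k - n))%nat by lia. apply Hw.
    + pose proof (H1 n) as H. unfold u in H. posn.
      apply (Rle_div_l _ _ (INR n + /2)) in H; [|lra].
      assert (0 <= A).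
      { eapply Rle_trans; [|apply (H1 0%nat)]. unfold u; simpl; lra. }
      nra.
Qed.

Lemma inv_cb_bounds n : sqrt (INR n + 1) <= / cb n <= 2 * sqrt (INR n + 1).
Proof.
  pose proof (inv_cb_sq_bounds n) as [H1 H2]. posn.
  pose proof (Rinv_0_lt_compat _ (cb_pos n)) as Hp.
  rewrite <- pow_inv in *.
  pose proof (sqrt_pos (INR n + 1)) as Hs.
  pose proof (pow2_sqrt (INR n + 1) ltac:(lra)) as Hs2.
  split; apply Rnot_lt_le; intros Hlt; nra.
Qed.

Lemma inv_cb_le i j : (i <= j)%nat -> / cb i <= / cb j.
Proof.
  induction 1 as [|j _ IH]; [lra|]. eapply Rle_trans; [exact IH|].
  pose proof (cb_pos j). posn.
  apply Rinv_le_contravar; [apply cb_pos|]. simpl.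
  apply Rle_div_l; nra.
Qed.

(* The gauge [(n+1)^(1/8)] absorbs all logarithmic factors. *)
Definition root8 (n : nat) : R := sqrt (sqrt (sqrt (INR n + 1))).

Lemma root8_ge1 n : 1 <= root8 n.
Proof.
  assert (H : forall x, 1 <= x -> 1 <= sqrt x).
  { intros x Hx. rewrite <- sqrt_1 at 1. apply sqrt_le_1_alt, Hx. }
  unfold root8. do 3 apply H. posn; lra.
Qed.

Lemma root8_pow4 n : root8 n ^ 4 = sqrt (INR n + 1).
Proof.
  replace (root8 n ^ 4) with ((root8 n ^ 2) ^ 2) by ring.
  unfold root8. rewrite !pow2_sqrt; try apply sqrt_pos. reflexivity.
Qed.

Lemma root8_pow8 n : root8 n ^ 8 = INR n + 1.
Proof.
  replace (root8 n ^ 8) with ((root8 n ^ 4) ^ 2) by ring.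
  rewrite root8_pow4, pow2_sqrt; [reflexivity|]. posn; lra.
Qed.

Lemma root8_le i j : (i <= j)%nat -> root8 i <= root8 j.
Proof.
  intros H. apply le_INR in H. unfold root8. do 3 apply sqrt_le_1_alt. lra.
Qed.

Lemma ln_le_root8 n : ln (INR (S n)) <= 8 * root8 n.
Proof.
  rewrite S_INR, <- root8_pow8. pose proof (root8_ge1 n) as H.
  rewrite ln_pow by lra. pose proof (ln_le_sub1 (root8 n)).
  simpl (INR 8). nra.
Qed.

Lemma hodd_le_root8 : exists K, 0 <= K /\ forall n, hodd n <= K * root8 n.
Proof.
  destruct hodd_asymptotics as [kappa Hk].
  exists (Rabs kappa + 9). split; [pose proof (Rabs_pos kappa); lra|].
  intros n. pose proof (root8_ge1 n) as Hr.
  pose proof (Rabs_pos kappa). pose proof (Rle_abs kappa).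
  destruct n as [|n]; [simpl hodd; nra|].
  specialize (Hk (S n) ltac:(lia)). apply Rabs_le_between in Hk.
  pose proof (ln_le_root8 n). pose proof (root8_le n (S n) ltac:(lia)).
  assert (/ INR (S n) <= 1).
  { rewrite <- Rinv_1. apply Rinv_le_contravar; [lra|]. rewrite S_INR; posn; lra. }
  nra.
Qed.

Lemma harm_le_hodd n : harm n <= hodd n.
Proof.
  induction n as [|n IH]; simpl; [lra|].
  replace (2 / (2 * INR n + 1)) with (/ (INR n + /2)) by (posn; field; lra).
  assert (/ (INR n + 1) <= / (INR n + / 2)) by (posn; apply Rinv_le_contravar; lra).
  lra.
Qed.

(** Discrete version of ln (1 + u) <= 4 sqrt u. The square root is preferred because multiplication
    by m + 1 turns it into sqrt ((m+1) b), which is symmetric in the two subtree sizes. *)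
Lemma hodd_gap m b : hodd (m + b) - hodd m <= 4 * sqrt (INR b / (INR m + 1)).
Proof.
  induction b as [|b IH].
  - rewrite Nat.add_0_r. pose proof (sqrt_pos (INR 0 / (INR m + 1))). lra.
  - rewrite Nat.add_succ_r. simpl hodd. rewrite plus_INR, S_INR. posn.
    set (X := sqrt (INR b / (INR m + 1))) in *.
    set (Y := sqrt ((INR b + 1) / (INR m + 1))).
    assert (HX : X ^ 2 = INR b / (INR m + 1)).
    { apply pow2_sqrt. apply Rdiv_le_0_compat; lra. }
    assert (HY : Y ^ 2 = (INR b + 1) / (INR m + 1)).
    { apply pow2_sqrt. apply Rdiv_le_0_compat; lra. }
    assert (HX0 : 0 <= X) by apply sqrt_pos.
    assert (HXY : X <= Y).
    { apply sqrt_le_1_alt, Rmult_le_compat_r; [|lra].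
      apply Rlt_le, Rinv_0_lt_compat; lra. }
    assert (HY0 : 0 < Y).
    { apply sqrt_lt_R0, Rdiv_lt_0_compat; lra. }
    set (a := INR m + 1) in *.
    assert (Ha : 1 <= a) by (unfold a; lra).
    assert (E : a * (Y ^ 2 - X ^ 2) = 1) by (rewrite HX, HY; field; lra).
    assert (E2 : a * Y ^ 2 = INR b + 1) by (rewrite HY; field; lra).
    (* AM-GM: [2 a Y = 2 sqrt (a (b+1)) <= a + b + 1] *)
    assert (Hag : 2 * a * Y <= a + INR b + 1).
    { assert (0 <= a * (Y - 1) ^ 2) by (apply Rmult_le_pos; [lra|apply pow2_ge_0]). nra. }
    assert (Hs : 1 <= (a + INR b + 1) * (Y - X)).
    { apply Rle_trans with (2 * a * Y * (Y - X)).
      - rewrite <- E. nra.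
      - apply Rmult_le_compat_r; lra. }
    assert (H2 : 2 / (2 * (INR m + INR b) + 1) <= 4 * (Y - X)).
    { apply Rle_div_l; [lra|]. fold a in Hs. unfold a in Hs. nra. }
    lra.
Qed.

(** * The mean *)

Lemma rsum_triangle (f : nat -> nat -> R) n :
  rsum n (fun k => rsum (S k) (fun j => f j (k - j)%nat)) =
  rsum n (fun j => rsum (n - j) (fun i => f j i)).
Proof.
  induction n as [|n IH]; [reflexivity|].
  rewrite rsum_S, IH, (rsum_S n (fun j => rsum (S n - j) _)).
  rewrite (rsum_S n), Nat.sub_diag.
  rewrite (rsum_ext n (fun j => rsum (S n - j) (fun i => f j i))
    (fun j => rsum (n - j) (fun i => f j i) + f j (n - j)%nat)).
  - rewrite rsum_plus. replace (S n - n)%nat with 1%nat by lia.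
    rewrite (rsum_S 0 (fun i => f n i)).
    replace (rsum 0 (fun i => f n i)) with 0 by reflexivity. ring.
  - intros k Hk. replace (S n - k)%nat with (S (n - k)) by lia. apply rsum_S.
Qed.

(* Expectation of the additive functional with toll [t n] on trees of size [n]
   (and value [t 0] on the empty tree). *)
Definition toll_mean (t : nat -> R) (n : nat) : R :=
  rsum (S n) (fun j => cb (n - j) * (pt j * t j)) / pt n.

Lemma toll_mean_0 t : toll_mean t 0 = t 0%nat.
Proof. unfold toll_mean, rsum, lsum; simpl. rewrite pt_0. field. Qed.

(** [cb (n - j) * pt j / pt n] is the expected number of subtrees of size j hanging in a tree of
    size n. Its recursion is [cb_pt_conv], applied for each j after the order of summation is
    exchanged. *)
Lemma toll_mean_S t n :
  toll_mean t (S n) =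
  rootavg n (fun k => toll_mean t k + toll_mean t (n - k)%nat) + t (S n).
Proof.
  rewrite (rootavg_pair n (toll_mean t)). pose proof (pt_pos (S n)) as Hp.
  pose (g := fun j i => pt j * t j * (cb i * pt (n - j - i)%nat)).
  rewrite (rsum_ext _ _ (fun k => rsum (S k) (fun j => g j (k - j)%nat))).
  - rewrite rsum_triangle. unfold g.
    rewrite (rsum_ext _ _ (fun j => 2 * (cb (S n - j) * (pt j * t j)))).
    + unfold toll_mean. rewrite rsum_scal, (rsum_S (S n)), Nat.sub_diag. simpl (cb 0).
      field; lra.
    + intros j Hj. replace (S n - j)%nat with (S (n - j)) by lia.
      rewrite rsum_scal, cb_pt_conv. ring.
  - intros k Hk. unfold toll_mean. pose proof (pt_pos k).
    replace (pt k * (rsum (S k) (fun j => cb (k - j) * (pt j * t j)) / pt k) * pt (n - k))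
      with (pt (n - k) * rsum (S k) (fun j => cb (k - j) * (pt j * t j))) by (field; lra).
    unfold g. rewrite <- rsum_scal. apply rsum_ext; intros j Hj.
    replace (n - j - (k - j))%nat with (n - k)%nat by lia. ring.
Qed.

Lemma sqrt_ge1_props x : 1 <= x -> 0 <= sqrt x /\ sqrt x ^ 2 = x /\ 1 <= sqrt x.
Proof.
  intros H. split; [apply sqrt_pos|]. split; [apply pow2_sqrt; lra|].
  rewrite <- sqrt_1 at 1. apply sqrt_le_1_alt, H.
Qed.

(** The power (j+1)^(3/2) is the largest that [pt j] absorbs, see [pt_weight]. *)
Lemma cb_ratio n j : (j <= n)%nat ->
  0 <= cb (n - j) / cb n - 1 <=
  8 * ((INR j + 1) * sqrt (INR j + 1)) / (INR n + 1).
Proof.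
  intros Hj. set (x := cb (n - j) / cb n).
  assert (Hx : 1 <= x).
  { unfold x, Rdiv. pose proof (inv_cb_le (n - j) n ltac:(lia)).
    rewrite <- (Rinv_r (cb (n - j))) by apply Rgt_not_eq, cb_pos.
    apply Rmult_le_compat_l; [apply Rlt_le, cb_pos|assumption]. }
  split; [lra|].
  assert (Hn : 0 < INR n + 1) by (posn; lra).
  assert (Hs : 1 <= INR j + 1) by (posn; lra).
  destruct (sqrt_ge1_props _ Hs) as [Hs0 [Hs2 Hs1]].
  set (s := sqrt (INR j + 1)) in *.
  apply Rle_div_r; [lra|].
  assert (Hx2 : x ^ 2 = / cb n ^ 2 * cb (n - j) ^ 2).
  { unfold x. pose proof (cb_pos n). field. lra. }
  destruct inv_cb_sq_linear as [A [HA Hq]].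
  pose proof (proj1 (inv_cb_sq_bounds (n - j))) as Hb.
  pose proof (pow_lt _ 2 (cb_pos (n - j))) as Hc.
  assert (Hc1 : cb (n - j) ^ 2 * / cb (n - j) ^ 2 = 1) by (field; apply Rgt_not_eq, cb_pos).
  rewrite minus_INR in Hb by lia.
  set (d := cb (n - j) ^ 2) in *.
  (* For j <= n/2 the linear asymptotics of [/ cb n ^ 2] give x^2 - 1 = O((j+1) / (n+1)). For larger
     j, n + 1 is at most 2 (j+1) and the crude bound x^2 <= 4 (n+1) suffices. *)
  destruct (le_lt_dec (2 * j) n) as [H|H].
  - apply le_INR in H. rewrite mult_INR in H. simpl (INR 2) in H.
    assert (H1 : x ^ 2 - 1 <= 4 * (INR j + 1) * d).
    { rewrite Hx2, <- Hc1. pose proof (proj2 (Hq n)). pose proof (proj1 (Hq (n - j)%nat)).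
      fold d in H1. rewrite minus_INR in H1 by lia.
      assert (/ cb n ^ 2 - / d <= 4 * (INR j + 1)) by nra. nra. }
    assert (H2 : d * (INR n + 1) <= 1) by nra.
    posn.
    assert (Hm : (x ^ 2 - 1) * (INR n + 1) <= 4 * (INR j + 1)).
    { apply Rle_trans with (4 * (INR j + 1) * d * (INR n + 1)).
      - apply Rmult_le_compat_r; lra.
      - rewrite Rmult_assoc. rewrite <- (Rmult_1_r (4 * (INR j + 1))) at 2.
        apply Rmult_le_compat_l; lra. }
    assert ((x - 1) * (INR n + 1) <= (x ^ 2 - 1) * (INR n + 1)).
    { apply Rmult_le_compat_r; nra. }
    nra.
  - apply lt_INR in H. rewrite mult_INR in H. simpl (INR 2) in H.
    assert (Hd : d <= 1).
    { assert (0 <= INR n - INR j) by (apply le_INR in Hj; lra). nra. }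
    pose proof (proj2 (inv_cb_sq_bounds n)) as Hqn.
    assert (H1 : x ^ 2 <= 4 * (INR n + 1)).
    { rewrite Hx2. pose proof (Rinv_0_lt_compat _ (pow_lt _ 2 (cb_pos n))). nra. }
    assert (H2 : x ^ 2 <= (4 * s) ^ 2) by (rewrite Rpow_mult_distr, Hs2; lra).
    assert (H3 : x <= 4 * s).
    { apply Rnot_lt_le; intros Hlt. nra. }
    assert ((x - 1) * (INR n + 1) <= 4 * s * (2 * (INR j + 1))).
    { apply Rmult_le_compat; lra. }
    lra.
Qed.

Lemma pt_weight j : pt j * ((INR j + 1) * sqrt (INR j + 1)) <= 1.
Proof.
  rewrite <- Rmult_assoc, (Rmult_comm (pt j)), <- cb_pt.
  pose proof (proj1 (inv_cb_bounds j)). pose proof (cb_pos j).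
  apply Rle_trans with (cb j * / cb j).
  - apply Rmult_le_compat_l; lra.
  - right; field; lra.
Qed.

(** The mean is (n+1) times the partial sum of [pt j * t j], plus a correction from the ratios
    [cb (n - j) / cb n]. A zero total makes the first part bounded; the correction is a harmonic
    sum. *)
Lemma toll_mean_bound (t : nat -> R) K :
  0 <= K -> (forall j, Rabs (t j) <= K / (INR j + 1)) ->
  is_lim_seq (fun n => rsum (S n) (fun j => pt j * t j)) 0 ->
  forall n, Rabs (toll_mean t n) <= 10 * K * (1 + harm (S n)).
Proof.
  intros HK Ht Hlim n.
  assert (Hsum : forall m n0, (n0 <= m)%nat ->
     Rabs (rsum (S m) (fun j => pt j * t j) - rsum (S n0) (fun j => pt j * t j))
     <= K / (INR n0 + 1) * (rsum (S m) pt - rsum (S n0) pt)).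
  { intros m n0 Hm. induction Hm as [|m Hm IH].
    - rewrite !Rminus_diag, Rabs_R0, Rmult_0_r. lra.
    - rewrite (rsum_S (S m)), (rsum_S (S m) pt).
      replace (rsum (S m) (fun j => pt j * t j) + pt (S m) * t (S m)
         - rsum (S n0) (fun j => pt j * t j)) with
        (rsum (S m) (fun j => pt j * t j) - rsum (S n0) (fun j => pt j * t j)
         + pt (S m) * t (S m)) by ring.
      eapply Rle_trans; [apply Rabs_triang|].
      rewrite Rabs_mult, (Rabs_pos_eq (pt (S m))) by apply Rlt_le, pt_pos.
      assert (Rabs (t (S m)) <= K / (INR n0 + 1)).
      { eapply Rle_trans; [apply Ht|]. apply Rmult_le_compat_l; [lra|].
        apply le_INR in Hm. rewrite S_INR. posn. apply Rinv_le_contravar; lra. }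
      pose proof (pt_pos (S m)). nra. }
  set (T := rsum (S n) (fun j => pt j * t j)).
  (* As the full sum is 0, T is minus its tail, on which the toll is at most K / (n+1). *)
  assert (HT : Rabs T <= 2 * (K / (INR n + 1))).
  { rewrite <- Rabs_Ropp. replace (- T) with (0 - T) by ring.
    change (Rbar_le (Rabs (0 - T)) (2 * (K / (INR n + 1)))).
    apply (is_lim_seq_le_loc
      (fun m => Rabs (rsum (S m) (fun j => pt j * t j) - T)) (fun _ => 2 * (K / (INR n + 1)))).
    - exists n; intros m Hm. eapply Rle_trans; [apply Hsum, Hm|].
      rewrite !pt_sum. pose proof (cb_pos (S m)).
      assert (0 < INR n + 1) by (posn; lra).
      assert (0 <= K / (INR n + 1)) by (apply Rdiv_le_0_compat; lra).
      pose proof (cb_pos (S n)).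
      assert (cb (S n) <= 1).
      { pose proof (inv_cb_le 0 (S n) ltac:(lia)) as Hi. simpl cb at 1 in Hi.
        rewrite Rinv_1 in Hi. apply Rmult_le_reg_r with (/ cb (S n)); [lra|].
        rewrite Rinv_r by lra. lra. }
      nra.
    - apply (is_lim_seq_abs _ (Finite (0 - T))).
      apply is_lim_seq_minus'; [exact Hlim|apply is_lim_seq_const].
    - apply is_lim_seq_const. }
  assert (Hn : 0 < INR n + 1) by (posn; lra).
  unfold toll_mean.
  (* Uses [pt n] = [cb n] / (n+1) and writes the ratio of central binomials as 1 plus its excess. *)
  replace (rsum (S n) (fun j => cb (n - j) * (pt j * t j)) / pt n) with
    ((INR n + 1) * (rsum (S n) (fun j => (cb (n - j) / cb n - 1) * (pt j * t j)) + T)).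
  2:{ unfold T. rewrite <- rsum_plus, <- rsum_scal. pose proof (pt_pos n) as Hp.
      unfold Rdiv at 2. rewrite (Rmult_comm _ (/ pt n)), <- rsum_scal.
      apply rsum_ext; intros j Hj. rewrite (cb_pt n). field; lra. }
  rewrite Rabs_mult, (Rabs_pos_eq (INR n + 1)) by lra.
  apply Rle_trans with ((INR n + 1) * (8 * K / (INR n + 1) * harm (S n) + 2 * (K / (INR n + 1)))).
  - apply Rmult_le_compat_l; [lra|]. eapply Rle_trans; [apply Rabs_triang|].
    apply Rplus_le_compat; [|exact HT].
    eapply Rle_trans; [apply lsum_abs|].
    replace (harm (S n)) with (rsum (S n) (fun j => / (INR j + 1))).
    2:{ generalize (S n); intros m. induction m as [|m IH]; [reflexivity|].
        rewrite rsum_S, IH. reflexivity. }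
    rewrite <- rsum_scal. apply rsum_le; intros j Hj.
    rewrite !Rabs_mult. pose proof (cb_ratio n j ltac:(lia)) as [Hr0 Hr1].
    rewrite (Rabs_pos_eq (cb (n - j) / cb n - 1)) by exact Hr0.
    pose proof (pt_pos j) as Hp. rewrite (Rabs_pos_eq (pt j)) by lra.
    apply Rle_trans with (8 * ((INR j + 1) * sqrt (INR j + 1)) / (INR n + 1)
       * (pt j * (K / (INR j + 1)))).
    + apply Rmult_le_compat; [lra| |exact Hr1|].
      * apply Rmult_le_pos; [lra|apply Rabs_pos].
      * apply Rmult_le_compat_l; [lra|apply Ht].
    + replace (8 * ((INR j + 1) * sqrt (INR j + 1)) / (INR n + 1) * (pt j * (K / (INR j + 1))))
        with (pt j * ((INR j + 1) * sqrt (INR j + 1)) * (8 * K / (INR n + 1) * / (INR j + 1)))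
        by (posn; field; lra).
      rewrite <- (Rmult_1_l (8 * K / (INR n + 1) * / (INR j + 1))) at 2.
      apply Rmult_le_compat_r; [|apply pt_weight].
      apply Rmult_le_pos; [apply Rdiv_le_0_compat; lra|].
      apply Rlt_le, Rinv_0_lt_compat; posn; lra.
  - replace ((INR n + 1) * (8 * K / (INR n + 1) * harm (S n) + 2 * (K / (INR n + 1))))
      with (K * (8 * harm (S n) + 2)) by (field; lra).
    assert (0 <= harm (S n)).
    { generalize (S n). intros m; induction m as [|m IH]; simpl; [lra|].
      pose proof (Rinv_0_lt_compat (INR m + 1) ltac:(posn; lra)). lra. }
    nra.
Qed.

(** * The series [C0] and the cancellation of the linear term *)

Lemma root8_lim : is_lim_seq root8 p_infty.
Proof.
  assert (H : forall u, is_lim_seq u p_infty -> is_lim_seq (fun n => sqrt (u n)) p_infty).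
  { intros u Hu. apply (filterlim_comp _ _ _ u sqrt eventually (Rbar_locally p_infty));
      [exact Hu|apply filterlim_sqrt_p]. }
  unfold root8. do 3 apply H.
  apply is_lim_seq_ext with (fun n => INR (S n)).
  - intros n; apply S_INR.
  - apply -> is_lim_seq_incr_1. apply is_lim_seq_INR.
Qed.

Lemma inv_root8_lim : is_lim_seq (fun n => / root8 n) 0.
Proof.
  replace (Finite 0) with (Rbar_inv p_infty) by reflexivity.
  apply is_lim_seq_inv; [apply root8_lim|discriminate].
Qed.

Lemma cb_le_root8 n : cb n <= / root8 n ^ 4.
Proof.
  rewrite root8_pow4. pose proof (proj1 (inv_cb_bounds n)) as H.
  rewrite <- (Rinv_inv (cb n)). apply Rinv_le_contravar; [|exact H].
  apply sqrt_lt_R0. posn; lra.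
Qed.

Lemma cb_hodd_lim : is_lim_seq (fun n => cb n * hodd n) 0.
Proof.
  destruct hodd_le_root8 as [K [HK Hh]].
  apply (is_lim_seq_le_le (fun _ => 0) _ (fun n => K * / root8 n)).
  - intros n. pose proof (cb_pos n). pose proof (hodd_ge0 n). split; [nra|].
    pose proof (root8_ge1 n) as Hr.
    apply Rle_trans with (/ root8 n ^ 4 * (K * root8 n)).
    + apply Rmult_le_compat; try lra; [apply cb_le_root8|apply Hh].
    + replace (/ root8 n ^ 4 * (K * root8 n)) with (K * / root8 n ^ 3) by (field; lra).
      apply Rmult_le_compat_l; [lra|]. apply Rinv_le_contravar; [lra|]. nra.
  - apply is_lim_seq_const.
  - replace (Finite 0) with (Rbar_mult K 0) by (simpl; f_equal; ring).
    apply is_lim_seq_scal_l, inv_root8_lim.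
Qed.

Lemma cb_lim : is_lim_seq cb 0.
Proof.
  apply (is_lim_seq_le_le (fun _ => 0) _ (fun n => / root8 n)).
  - intros n. pose proof (cb_pos n). split; [lra|].
    eapply Rle_trans; [apply cb_le_root8|].
    pose proof (root8_ge1 n). apply Rinv_le_contravar; [lra|].
    replace (root8 n) with (root8 n ^ 1) at 1 by ring. apply Rle_pow; [lra|lia].
  - apply is_lim_seq_const.
  - apply inv_root8_lim.
Qed.

Lemma sum_n_rsum (f : nat -> R) n : sum_n f n = rsum (S n) f.
Proof.
  induction n as [|n IH].
  - rewrite sum_O, rsum_S. unfold rsum, lsum; simpl. ring.
  - rewrite sum_Sn, IH, (rsum_S (S n)). reflexivity.
Qed.

Lemma ln_INR_ge0 n : 0 <= ln (INR (S n)).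
Proof.
  rewrite <- ln_1. apply ln_le; [lra|]. rewrite S_INR; posn; lra.
Qed.

(** [Series] is a total function, so convergence has to be shown: the terms are nonnegative, and
    replacing ln by [hodd] plus a constant bounds the partial sums through [pt_hodd_sum] and
    [pt_sum]. *)
Lemma C0_lim : is_lim_seq (fun n => rsum (S n) (fun k => pt (S k) * ln (INR (S k)))) C0.
Proof.
  set (a := fun k => ln (INR (S k)) * beta (S k) / 4 ^ S k).
  assert (Ha : forall k, a k = pt (S k) * ln (INR (S k))).
  { intros k; unfold a; rewrite pt_beta; unfold Rdiv; ring. }
  apply is_lim_seq_ext with (sum_n a).
  { intros n. rewrite sum_n_rsum. apply rsum_ext; auto. }
  assert (Hex : ex_finite_lim_seq (sum_n a)).
  { destruct hodd_asymptotics as [kappa Hk].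
    apply ex_finite_lim_seq_incr with (4 + 2 * (Rabs kappa + 1)).
    - intros n. rewrite sum_Sn. unfold plus; simpl AbelianMonoid.plus.
      rewrite Ha. pose proof (pt_pos (S (S n))). pose proof (ln_INR_ge0 (S n)).
      unfold plus; simpl. assert (0 <= pt (S (S n)) * ln (INR (S (S n)))) by nra.
      simpl in *. lra.
    - intros n. rewrite sum_n_rsum.
      apply Rle_trans with (rsum (S n) (fun k =>
         pt (S k) * (hodd (S k) - 2) + (Rabs kappa + 3) * pt (S k))).
      + apply rsum_le; intros k _. rewrite Ha.
        specialize (Hk (S k) ltac:(lia)). apply Rabs_le_between in Hk.
        assert (/ INR (S k) <= 1).
        { rewrite <- Rinv_1. apply Rinv_le_contravar; [lra|]. rewrite S_INR; posn; lra. }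
        pose proof (Rle_abs (- kappa)). rewrite Rabs_Ropp in H0.
        pose proof (pt_pos (S k)). nra.
      + rewrite rsum_plus, rsum_scal.
        pose proof (pt_hodd_sum (S n)) as H1. rewrite rsum_S_l, pt_0 in H1. simpl (hodd 0) in H1.
        pose proof (pt_sum (S (S n))) as H2. rewrite rsum_S_l, pt_0 in H2.
        pose proof (cb_pos (S (S n))). pose proof (hodd_ge0 (S (S n))).
        pose proof (Rabs_pos kappa).
        assert (0 <= cb (S (S n)) * hodd (S (S n))) by nra.
        assert (rsum (S n) (fun k => pt (S k)) <= 1) by lra. nra. }
  apply Series_correct. destruct Hex as [l Hl]. exists l. exact Hl.
Qed.

(** The toll left after removing [hodd - 2] and the constant mean kappa - 2. On the empty tree this
    leaves -C0 + 2 - (kappa - 2) = 4 - C0 - kappa, and the -C0 cancels the series of logarithms. *)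
Lemma toll_sum_lim kappa :
  is_lim_seq (fun n => rsum (S n) (fun j => pt j *
    match j with
    | O => 4 - C0 - kappa
    | S _ => ln (INR j) - hodd j + kappa
    end)) 0.
Proof.
  apply is_lim_seq_incr_1.
  apply is_lim_seq_ext with (fun n =>
    rsum (S n) (fun k => pt (S k) * ln (INR (S k))) - C0
    + (2 * (cb (S (S n)) * hodd (S (S n))) - 2 * (kappa - 2) * cb (S (S n)))).
  - intros n. rewrite (rsum_S_l (S n)), pt_0.
    rewrite (rsum_ext _ (fun k => pt (S k) * (ln (INR (S k)) - hodd (S k) + kappa))
       (fun k => pt (S k) * ln (INR (S k)) - pt (S k) * (hodd (S k) - 2)
                 + (kappa - 2) * pt (S k))) by (intros; ring).
    rewrite rsum_plus, rsum_minus, rsum_scal.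
    pose proof (pt_hodd_sum (S n)) as H1. rewrite rsum_S_l, pt_0 in H1. simpl (hodd 0) in H1.
    pose proof (pt_sum (S (S n))) as H2. rewrite rsum_S_l, pt_0 in H2.
    replace (rsum (S n) (fun k => pt (S k) * (hodd (S k) - 2))) with
      (- 2 * (cb (S (S n)) * hodd (S (S n))) + 2) by lra.
    replace (rsum (S n) (fun k => pt (S k))) with (1 - 2 * cb (S (S n))) by lra.
    ring.
  - replace (Finite 0) with (Finite (C0 - C0 + (2 * 0 - 2 * (kappa - 2) * 0)))
      by (f_equal; ring).
    apply is_lim_seq_plus'.
    + apply is_lim_seq_minus'; [apply C0_lim|apply is_lim_seq_const].
    + apply is_lim_seq_minus'; apply is_lim_seq_mult'; try apply is_lim_seq_const.
      * apply (is_lim_seq_incr_1 (fun n => cb (S n) * hodd (S n))),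
          (is_lim_seq_incr_1 (fun n => cb n * hodd n)), cb_hodd_lim.
      * apply (is_lim_seq_incr_1 (fun n => cb (S n))), (is_lim_seq_incr_1 cb), cb_lim.
Qed.

(* The toll [hodd n - 2] has the closed-form mean [- 2 / cb n]; replacing [ln n]
   by it changes the mean by a slowly varying term only. *)
Lemma shape_mean_error (m : nat -> R) :
  m 0%nat = - C0 ->
  (forall n, m (S n) = rootavg n (fun k => m k + m (n - k)%nat) + ln (INR (S n))) ->
  exists K, 0 <= K /\ forall n, Rabs (m n + 2 / cb n) <= K * root8 n.
Proof.
  intros Hm0 HmS. destruct hodd_asymptotics as [kappa Hk].
  set (t := fun j => match j with
            | O => 4 - C0 - kappa | S _ => ln (INR j) - hodd j + kappa end).
  (* A constant c solves the recursion with toll -c, so the decomposition of the toll is ln n =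
     (hodd n - 2) - (kappa - 2) + t n. *)
  assert (E : forall n, m n = - 2 / cb n + (kappa - 2) + toll_mean t n).
  { intros n. induction n as [n IH] using lt_wf_ind. destruct n as [|n].
    - rewrite toll_mean_0, Hm0. simpl. field.
    - rewrite HmS, toll_mean_S.
      rewrite (rootavg_ext n _ (fun k => (- 2 / cb k + - 2 / cb (n - k)) +
         (2 * (kappa - 2) + (toll_mean t k + toll_mean t (n - k)%nat)))).
      + rewrite rootavg_plus, rootavg_mean, rootavg_plus, rootavg_const.

        change (t (S n)) with (ln (INR (S n)) - hodd (S n) + kappa). ring.
      + intros k Hkn. rewrite (IH k), (IH (n - k)%nat) by lia. ring. }
  set (K := 1 + Rabs (4 - C0 - kappa)).
  assert (Ht : forall j, Rabs (t j) <= 2 * K / (INR j + 1)).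
  { assert (0 <= Rabs (4 - C0 - kappa)) by apply Rabs_pos.
    intros [|j]; unfold t.
    - simpl (INR 0). rewrite Rplus_0_l, Rdiv_1_r. unfold K. lra.
    - rewrite <- Rabs_Ropp.
      replace (- (ln (INR (S j)) - hodd (S j) + kappa)) with
        (hodd (S j) - ln (INR (S j)) - kappa) by ring.
      eapply Rle_trans; [apply Hk; lia|]. rewrite S_INR. posn.
      apply Rle_trans with (2 / (INR j + 1 + 1)).
      + apply Rle_div_r; [lra|]. apply Rle_trans with (/ (INR j + 1) * (2 * (INR j + 1))).
        * apply Rmult_le_compat_l; [apply Rlt_le, Rinv_0_lt_compat; lra|lra].
        * right; field; lra.
      + apply Rmult_le_compat_r; [apply Rlt_le, Rinv_0_lt_compat; lra|unfold K; lra]. }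
  assert (HK : 0 <= K) by (unfold K; pose proof (Rabs_pos (4 - C0 - kappa)); lra).
  pose proof (toll_mean_bound t (2 * K) ltac:(lra) Ht (toll_sum_lim kappa)) as Hb.
  destruct hodd_le_root8 as [Kh [HKh Hh]].
  exists (Rabs (kappa - 2) + 20 * K * (2 + Kh)).
  split. { pose proof (Rabs_pos (kappa - 2)). nra. }
  intros n. rewrite E.
  replace (- 2 / cb n + (kappa - 2) + toll_mean t n + 2 / cb n) with
    (kappa - 2 + toll_mean t n) by (unfold Rdiv; ring).
  eapply Rle_trans; [apply Rabs_triang|].
  specialize (Hb n). pose proof (root8_ge1 n) as Hr.
  pose proof (Rabs_pos (kappa - 2)).
  assert (Hharm : harm (S n) <= Kh * root8 n + 1).
  { cbn [harm]. pose proof (harm_le_hodd n). pose proof (Hh n).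
    assert (/ (INR n + 1) <= 1); [|lra].
    rewrite <- Rinv_1. apply Rinv_le_contravar; posn; lra. }
  assert (10 * (2 * K) * (1 + harm (S n)) <= 20 * K * ((2 + Kh) * root8 n)).
  { replace (10 * (2 * K)) with (20 * K) by ring. apply Rmult_le_compat_l; nra. }
  nra.
Qed.

(** * One-step moments *)

Lemma sigma2_pos : 0 < sigma2.
Proof.
  unfold sigma2. pose proof ln_lt_2. pose proof (ln_le_sub1 2 ltac:(lra)).
  assert (ln 2 <> 1); [|lra]. intros E.
  pose proof (exp_ineq1 1 ltac:(lra)). rewrite <- E, exp_ln in H1; lra.
Qed.

Definition vlead (n : nat) : R := sigma2 * ((INR n + 1) * hodd n).

Lemma vlead_ge0 n : 0 <= vlead n.
Proof.
  unfold vlead. pose proof sigma2_pos. pose proof (hodd_ge0 n). posn.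
  apply Rmult_le_pos; [lra|]. apply Rmult_le_pos; lra.
Qed.

(* The increment, at a node with subtrees of sizes [k] and [n - k], of the martingale of
   conditional means. *)
Definition mean_dev (m : nat -> R) (n k : nat) : R :=
  m k + m (n - k)%nat + ln (INR (S n)) - m (S n).

Definition var_dev (n k : nat) : R :=
  vlead k + vlead (n - k) - vlead (S n).

(** Common gauge for a split: [var_dev] is bounded by a multiple of its square root, [mean_dev] by
    that root over sqrt (n+2) up to a slowly growing term, and its average is known exactly from
    [rootavg_prod]. *)
Definition area (n k : nat) : R := (INR k + 1) * (INR (n - k) + 1).

Lemma area_pos n k : 0 < area n k.
Proof. unfold area. posn. apply Rmult_lt_0_compat; [lra|]. pose proof (pos_INR (n - k)); lra. Qed.

Lemma area_le n k : (k <= n)%nat -> area n k / (INR n + 2) <= INR n + 2.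
Proof.
  intros H. unfold area. rewrite minus_INR by exact H. apply le_INR in H. posn.
  apply Rle_div_l; nra.
Qed.

Lemma var_dev_bound n k : (k <= n)%nat ->
  Rabs (var_dev n k) <= 8 * sigma2 * sqrt (area n k).
Proof.
  intros H.
  assert (G : forall i j, (i + j = n)%nat ->
    0 <= (INR i + 1) * (hodd (S n) - hodd i) <= 4 * sqrt (area n i)).
  { intros i j E. pose proof (hodd_gap i (S j)) as Hg.
    replace (i + S j)%nat with (S n) in Hg by lia.
    assert (Hi : 0 < INR i + 1) by (posn; lra).
    assert (Hm : hodd i <= hodd (S n)).
    { assert (forall b, hodd i <= hodd (i + b)) as Hb.
      { intros b; induction b as [|b IH]; [rewrite Nat.add_0_r; lra|].
        rewrite Nat.add_succ_r; simpl. eapply Rle_trans; [exact IH|].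
        pose proof (pos_INR (i + b)).
        assert (0 < 2 / (2 * INR (i + b) + 1)) by (apply Rdiv_lt_0_compat; lra). lra. }
      replace (S n) with (i + S j)%nat by lia. apply Hb. }
    split; [apply Rmult_le_pos; lra|].
    apply Rle_trans with ((INR i + 1) * (4 * sqrt (INR (S j) / (INR i + 1)))).
    - apply Rmult_le_compat_l; lra.
    - right.
      replace (area n i) with ((INR i + 1) ^ 2 * (INR (S j) / (INR i + 1))).
      + rewrite sqrt_mult_alt by apply pow2_ge_0. rewrite sqrt_pow2 by lra. ring.
      + unfold area. replace (n - i)%nat with j by lia. rewrite S_INR. field; lra. }
  pose proof (G k (n - k)%nat ltac:(lia)) as G1.
  pose proof (G (n - k)%nat k ltac:(lia)) as G2.
  replace (area n (n - k)) with (area n k) in G2.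
  2:{ unfold area. replace (n - (n - k))%nat with k by lia. ring. }
  pose proof sigma2_pos.
  (* The weights k + 1 and n - k + 1 add up to n + 2, so [vlead (S n)] splits over the two
     subtrees. *)
  assert (E : var_dev n k = - sigma2 * ((INR k + 1) * (hodd (S n) - hodd k)
     + (INR (n - k) + 1) * (hodd (S n) - hodd (n - k)))).
  { unfold var_dev, vlead. rewrite S_INR, minus_INR by exact H. ring. }
  rewrite E, Rabs_mult, Rabs_Ropp, (Rabs_pos_eq sigma2) by lra.
  rewrite Rabs_pos_eq by lra. nra.
Qed.

(** Like sqrt k + sqrt (n-k) - sqrt n, the deviation is at most of the order of the root of the
    smaller part: the squares of [/ cb] are linear up to O(1), so dropping i nodes changes the
    square by O(i+1). *)
Lemma inv_cb_dev n k : (k <= n)%nat ->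
  Rabs (/ cb k + / cb (n - k) - / cb (S n)) <= 16 * sqrt (area n k / (INR n + 2)).
Proof.
  intros H. destruct inv_cb_sq_linear as [A [HA Hq]].
  assert (G : forall i j, (i + j = n)%nat ->
    Rabs (/ cb i + / cb j - / cb (S n)) <= 8 * sqrt (INR i + 1)).
  { intros i j E. posn.
    pose proof (proj2 (inv_cb_bounds i)) as Hi.
    pose proof (Rinv_0_lt_compat _ (cb_pos i)).
    pose proof (Rinv_0_lt_compat _ (cb_pos j)).
    pose proof (inv_cb_le j (S n) ltac:(lia)) as Hmon.
    pose proof (proj1 (inv_cb_bounds (S n))) as Hn.
    set (s := sqrt (INR i + 1)) in *.
    assert (Hs : 0 < s) by (apply sqrt_lt_R0; lra).
    assert (Hs2 : s ^ 2 = INR i + 1) by (apply pow2_sqrt; lra).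
    assert (Hsn : s <= / cb (S n)).
    { eapply Rle_trans; [|exact Hn]. apply sqrt_le_1_alt. rewrite S_INR.
      assert (INR i <= INR n) by (apply le_INR; lia). lra. }
    assert (Hd : (/ cb (S n) - / cb j) * / cb (S n) <= 8 * s ^ 2).
    { pose proof (proj2 (Hq (S n))) as Q1. pose proof (proj1 (Hq j)) as Q2.
      rewrite <- !pow_inv in *.
      assert (INR n = INR i + INR j) by (rewrite <- plus_INR; f_equal; lia).
      rewrite S_INR in Q1. rewrite Hs2.
      apply Rle_trans with ((/ cb (S n)) ^ 2 - (/ cb j) ^ 2); [nra|].
      nra. }
    apply Rabs_le. split; [|lra].
    assert (/ cb (S n) - / cb j <= 8 * s); [|lra].
    apply Rnot_lt_le; intros Hlt. nra. }
  set (y := area n k / (INR n + 2)).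
  (* The larger factor is at least half of n + 2; the constant 4 has a rational square root. *)
  assert (Hmin : Rmin (INR k + 1) (INR (n - k) + 1) <= 4 * y).
  { unfold y, area. rewrite minus_INR by exact H. apply le_INR in H. posn.
    replace (4 * ((INR k + 1) * (INR n - INR k + 1) / (INR n + 2))) with
      (4 * ((INR k + 1) * (INR n - INR k + 1)) / (INR n + 2)) by (field; lra).
    apply Rle_div_r; [lra|].
    unfold Rmin; destruct Rle_dec; nra. }
  assert (Hsq : sqrt (4 * y) = 2 * sqrt y).
  { rewrite sqrt_mult_alt by lra. f_equal. replace 4 with (2 ^ 2) by ring.
    apply sqrt_pow2; lra. }
  apply Rle_trans with (8 * sqrt (4 * y)); [|rewrite Hsq; lra].
  apply Rle_trans with (8 * sqrt (Rmin (INR k + 1) (INR (n - k) + 1))).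
  - unfold Rmin; destruct Rle_dec.
    + apply G; lia.
    + rewrite (Rplus_comm (/ cb k)). apply G; lia.
  - apply Rmult_le_compat_l; [lra|]. apply sqrt_le_1_alt, Hmin.
Qed.

Lemma rootavg_area n : rootavg n (fun k => area n k / (INR n + 2)) <= root8 (S n) ^ 4.
Proof.
  rewrite (rootavg_ext n _ (fun k => / (INR n + 2) * area n k))
    by (intros; unfold Rdiv; ring).
  rewrite rootavg_scal. unfold area. rewrite rootavg_prod.
  pose proof (cb_pos (S n)). pose proof (proj2 (inv_cb_bounds (S n))) as H0.
  rewrite <- root8_pow4 in H0. rewrite cb_pt, S_INR in *.
  pose proof (pt_pos (S n)). posn.
  replace (/ (INR n + 2) * / (4 * pt (S n))) with
    (/ ((INR n + 1 + 1) * pt (S n)) / 4) by (field; lra).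
  pose proof (root8_ge1 (S n)) as Hr. apply (pow_R1_Rle _ 4%nat) in Hr. lra.
Qed.

(* With the toll [hodd n - 2] the one-step variance can be evaluated exactly:
   this is where [sigma2 = 8 (1 - ln 2)] comes from, as the limit of
   [4 (harm n - hodd n + 2)]. *)
Lemma rootavg_sq_model : exists K, 0 <= K /\ forall n,
  Rabs (rootavg n (fun k =>
     (- 2 / cb k + - 2 / cb (n - k) + (hodd (S n) - 2) - (- 2 / cb (S n))) ^ 2
     + var_dev n k)) <= K * root8 (S n) ^ 2.
Proof.
  destruct hodd_le_root8 as [Kh [HKh Hh]].
  destruct inv_cb_sq_linear as [A [HA Hq]].
  pose proof sigma2_pos as Hsig.
  exists (32 + 48 + 4 * sigma2 + (Kh + 2) ^ 2). split. { nra. }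
  intros n.
  set (b := hodd (S n) - 2). set (c := cb (S n)).
  assert (Hc : 0 < c) by apply cb_pos.
  assert (E : rootavg n (fun k =>
     (- 2 / cb k + - 2 / cb (n - k) + b - (- 2 / c)) ^ 2 + var_dev n k) =
     4 * (rootavg n (fun k => / cb k ^ 2 + / cb (n - k) ^ 2) - / c ^ 2)
     + 4 / c * (harm (S n) - hodd (S n) + 2 * ln 2)
     - b ^ 2 - sigma2 / (c * (INR n + 1))).
  { rewrite (rootavg_ext n _ (fun k =>
      4 * (/ cb k ^ 2 + / cb (n - k) ^ 2) + (8 * / (cb k * cb (n - k))
      + (2 * (b + 2 / c) * (- 2 / cb k + - 2 / cb (n - k))
      + ((b + 2 / c) ^ 2 + (sigma2 * ((INR k + 1) * hodd k + (INR (n - k) + 1) * hodd (n - k))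
         - vlead (S n))))))).
    - rewrite !rootavg_plus, rootavg_minus, !rootavg_scal, !rootavg_const.
      rewrite rootavg_cross, rootavg_mean, rootavg_var. fold b c.
      unfold vlead. rewrite S_INR. replace (pt (S n)) with (c / (INR n + 2)).
      + unfold sigma2. posn. fold b.
        replace (hodd (S n)) with (b + 2) by (unfold b; ring).
        rewrite ?rootavg_plus. field. lra.
      + unfold c. rewrite cb_pt, S_INR. posn. field. lra.
    - intros k Hk. unfold var_dev, vlead. pose proof (cb_pos k). pose proof (cb_pos (n - k)).
      field. lra. }
  rewrite E. clear E.
  pose proof (root8_ge1 (S n)) as Hr.
  assert (Hr2 : 1 <= root8 (S n) ^ 2) by (apply pow_R1_Rle; exact Hr).
  (* The linear parts A k + A (n-k) and A (n+1) cancel up to a constant, so the order n disappears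
     whatever A is. *)
  assert (H1 : Rabs (rootavg n (fun k => / cb k ^ 2 + / cb (n - k) ^ 2) - / c ^ 2) <= 8).
  { assert (U : rootavg n (fun k => / cb k ^ 2 + / cb (n - k) ^ 2)
                <= rootavg n (fun _ => A * (INR n + 2))).
    { apply rootavg_le; intros k Hk. pose proof (proj2 (Hq k)).
      pose proof (proj2 (Hq (n - k)%nat)) as Q. rewrite minus_INR in Q by exact Hk. nra. }
    assert (W : rootavg n (fun _ => A * INR n)
                <= rootavg n (fun k => / cb k ^ 2 + / cb (n - k) ^ 2)).
    { apply rootavg_le; intros k Hk. pose proof (proj1 (Hq k)).
      pose proof (proj1 (Hq (n - k)%nat)) as Q. rewrite minus_INR in Q by exact Hk. nra. }
    rewrite rootavg_const in U, W. pose proof (Hq (S n)) as [Q1 Q2].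
    fold c in Q1, Q2. rewrite S_INR in Q1, Q2. apply Rabs_le. nra. }
  assert (Hci : / c <= 2 * (INR n + 2)).
  { unfold c. pose proof (proj2 (inv_cb_bounds (S n))) as Hb. rewrite S_INR in Hb. posn.
    assert (sqrt (INR n + 1 + 1) <= INR n + 2).
    { pose proof (sqrt_pos (INR n + 1 + 1)).
      pose proof (pow2_sqrt (INR n + 1 + 1) ltac:(lra)).
      apply Rnot_lt_le; intros Hlt. nra. }
    lra. }
  assert (Hcn : / c / (INR n + 1) <= 4) by (posn; apply Rle_div_l; lra).
  assert (Hci0 : 0 < / c) by (apply Rinv_0_lt_compat; exact Hc).
  assert (H2 : Rabs (4 / c * (harm (S n) - hodd (S n) + 2 * ln 2)) <= 48).
  { rewrite Rabs_mult, (Rabs_pos_eq (4 / c)) by (unfold Rdiv; lra).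
    pose proof (hodd_sub_harm n) as Hd. rewrite <- Rabs_Ropp in Hd.
    replace (- (hodd (S n) - harm (S n) - 2 * ln 2)) with
      (harm (S n) - hodd (S n) + 2 * ln 2) in Hd by ring.
    apply Rle_trans with (4 / c * (3 / (INR n + 1))).
    - apply Rmult_le_compat_l; [unfold Rdiv; lra|exact Hd].
    - replace (4 / c * (3 / (INR n + 1))) with (12 * (/ c / (INR n + 1)))
        by (posn; field; lra). lra. }
  assert (H3 : 0 <= sigma2 / (c * (INR n + 1)) <= 4 * sigma2).
  { replace (sigma2 / (c * (INR n + 1))) with (sigma2 * (/ c / (INR n + 1)))
      by (posn; field; lra).
    assert (0 <= / c / (INR n + 1)) by (posn; apply Rdiv_le_0_compat; lra). nra. }
  assert (H4 : 0 <= b ^ 2 <= (Kh + 2) ^ 2 * root8 (S n) ^ 2).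
  { split; [apply pow2_ge_0|]. rewrite <- Rpow_mult_distr. apply pow_maj_Rabs.
    pose proof (Hh (S n)). pose proof (hodd_ge0 (S n)). apply Rabs_le. unfold b. nra. }
  apply Rabs_le_between in H1, H2. apply Rabs_le. nra.
Qed.

(** The averages entering one Taylor step. The gauge makes [dev_second] of order n^(3/8), below sqrt
    n. A variance increment counts as two orders, so [dev_fourth] concerns its square; there
    [/ pt (S n)] is of order n^(3/2). *)
Record dev_moments (m : nat -> R) (K : R) (n : nat) : Prop := {
  dev_first : rootavg n (mean_dev m n) = 0;
  dev_second : Rabs (rootavg n (fun k => mean_dev m n k ^ 2 + var_dev n k))
               <= K * root8 (S n) ^ 3;
  dev_third : rootavg n (fun k => Rabs (mean_dev m n k) ^ 3) <= K * (INR n + 2);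
  dev_mixed : rootavg n (fun k => Rabs (mean_dev m n k) * Rabs (var_dev n k))
              <= K * (INR n + 2);
  dev_fourth : rootavg n (fun k => var_dev n k ^ 2) <= K / pt (S n)
}.

Lemma dev_moments_le m K K' n : K <= K' -> dev_moments m K n -> dev_moments m K' n.
Proof.
  intros HK [H1 H2 H3 H4 H5]. pose proof (root8_ge1 (S n)) as Hr.
  assert (0 < root8 (S n) ^ 3) by (apply pow_lt; lra).
  assert (0 < / pt (S n)) by (apply Rinv_0_lt_compat, pt_pos).
  posn. unfold Rdiv in *.
  constructor; [exact H1| | | |]; (eapply Rle_trans; [eassumption|]);
    apply Rmult_le_compat_r; lra.
Qed.

Lemma shape_dev_moments (m : nat -> R) :
  m 0%nat = - C0 ->
  (forall n, m (S n) = rootavg n (fun k => m k + m (n - k)%nat) + ln (INR (S n))) ->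
  exists K, 0 <= K /\ forall n, dev_moments m K n.
Proof.
  intros Hm0 HmS.
  destruct (shape_mean_error m Hm0 HmS) as [Ke [HKe He]].
  destruct hodd_le_root8 as [Kh [HKh Hh]].
  destruct rootavg_sq_model as [Km [HKm Hmod]].
  pose proof sigma2_pos as Hsig.
  (* 32 = 2 * 16 from [inv_cb_dev], 8 from [ln_le_root8], 2 from the toll [hodd - 2], [Kh] from
     [hodd] itself and [3 * Ke] from the three mean errors. *)
  set (K1 := 42 + 3 * Ke + Kh).
  assert (HK1 : 32 <= K1) by (unfold K1; lra).
  assert (Hbound : forall n k, (k <= n)%nat ->
    let s := sqrt (area n k / (INR n + 2)) in let r := root8 (S n) in
    let D' := - 2 / cb k + - 2 / cb (n - k) + (hodd (S n) - 2) - (- 2 / cb (S n)) in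
    Rabs D' <= K1 * (s + r) /\ Rabs (mean_dev m n k - D') <= K1 * r).
  { intros n k Hk s r D'.
    assert (Hs : 0 <= s) by apply sqrt_pos.
    assert (Hr : 1 <= r) by apply root8_ge1.
    pose proof (hodd_ge0 (S n)) as Hh0. pose proof (Hh (S n)) as Hh1. fold r in Hh1.
    split.
    - replace D' with (- 2 * (/ cb k + / cb (n - k) - / cb (S n)) + (hodd (S n) - 2))
        by (unfold D', Rdiv; ring).
      pose proof (inv_cb_dev n k Hk) as Hd. fold s in Hd. apply Rabs_le_between in Hd.
      apply Rabs_le. unfold K1. nra.
    - unfold mean_dev.
      replace (m k + m (n - k)%nat + ln (INR (S n)) - m (S n) - D') with
        ((m k + 2 / cb k) + (m (n - k)%nat + 2 / cb (n - k)) - (m (S n) + 2 / cb (S n))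
         + (ln (INR (S n)) - hodd (S n) + 2)) by (unfold D', Rdiv; ring).
      pose proof (He k) as E1. pose proof (He (n - k)%nat) as E2. pose proof (He (S n)) as E3.
      pose proof (root8_le k (S n) ltac:(lia)) as R1.
      pose proof (root8_le (n - k) (S n) ltac:(lia)) as R2.
      pose proof (root8_le n (S n) ltac:(lia)) as R3. fold r in R1, R2, R3, E3.
      pose proof (ln_le_root8 n) as L1. pose proof (ln_INR_ge0 n) as L0.
      assert (Ke * root8 k <= Ke * r) by (apply Rmult_le_compat_l; lra).
      assert (Ke * root8 (n - k) <= Ke * r) by (apply Rmult_le_compat_l; lra).
      apply Rabs_le_between in E1, E2, E3.
      apply Rabs_le. unfold K1. nra. }
  set (K2 := 2 * K1).
  assert (HD : forall n k, (k <= n)%nat ->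
    Rabs (mean_dev m n k) <= K2 * (sqrt (area n k / (INR n + 2)) + root8 (S n))).
  { intros n k Hk. destruct (Hbound n k Hk) as [B1 B2]. cbv zeta in B1, B2.
    set (D' := - 2 / cb k + - 2 / cb (n - k) + (hodd (S n) - 2) - (- 2 / cb (S n))) in *.
    replace (mean_dev m n k) with (D' + (mean_dev m n k - D')) by ring.
    eapply Rle_trans; [apply Rabs_triang|].
    pose proof (sqrt_pos (area n k / (INR n + 2))). unfold K2. nra. }
  assert (HK2 : 0 < K2) by (unfold K2; lra).
  set (K := (Km + 5 * K1 ^ 2) + 8 * K2 ^ 3 + 16 * sigma2 * K2 + 16 * sigma2 ^ 2).
  assert (Hp1 : 0 <= K1 ^ 2) by apply pow2_ge_0.
  assert (Hp2 : 0 <= K2 ^ 3) by (apply pow_le; lra).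
  assert (Hp3 : 0 <= sigma2 * K2) by nra.
  assert (Hp4 : 0 <= sigma2 ^ 2) by apply pow2_ge_0.
  exists K. split; [unfold K; lra|].
  intros n. set (r := root8 (S n)).
  assert (Hr : 1 <= r) by apply root8_ge1.
  assert (Hr8 : r ^ 8 = INR n + 2) by (unfold r; rewrite root8_pow8, S_INR; ring).
  assert (Hr4 : r ^ 4 = sqrt (INR n + 2))
    by (unfold r; rewrite root8_pow4, S_INR; f_equal; ring).
  assert (Hn : 0 < INR n + 2) by (posn; lra).
  pose (y := fun k => area n k / (INR n + 2)).
  assert (Hy0 : forall k, 0 <= y k).
  { intros k. apply Rlt_le, Rdiv_lt_0_compat; [apply area_pos|lra]. }
  assert (Hy2 : forall k, sqrt (y k) ^ 2 = y k) by (intros; apply pow2_sqrt, Hy0).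
  assert (Hy4 : forall k, (k <= n)%nat -> sqrt (y k) <= r ^ 4).
  { intros k Hk. rewrite Hr4. apply sqrt_le_1_alt, area_le, Hk. }
  assert (Hys : forall k, 0 <= sqrt (y k)) by (intros; apply sqrt_pos).
  assert (Havg : rootavg n y <= r ^ 4) by apply rootavg_area.
  assert (Hp : 1 <= r ^ 2) by (apply pow_R1_Rle; exact Hr).
  assert (Hp' : 1 <= r ^ 3) by (apply pow_R1_Rle; exact Hr).
  assert (Hp'' : 1 <= r ^ 4) by (apply pow_R1_Rle; exact Hr).
  apply (dev_moments_le m (Rmax (Rmax (Km + 5 * K1 ^ 2) (8 * K2 ^ 3))
                           (Rmax (16 * sigma2 * K2) (16 * sigma2 ^ 2)))).
  { unfold K. repeat apply Rmax_lub; lra. }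
  assert (Hall : forall a b c d,
    rootavg n (mean_dev m n) = 0 ->
    Rabs (rootavg n (fun k => mean_dev m n k ^ 2 + var_dev n k)) <= a * r ^ 3 ->
    rootavg n (fun k => Rabs (mean_dev m n k) ^ 3) <= b * (INR n + 2) ->
    rootavg n (fun k => Rabs (mean_dev m n k) * Rabs (var_dev n k)) <= c * (INR n + 2) ->
    rootavg n (fun k => var_dev n k ^ 2) <= d / pt (S n) ->
    dev_moments m (Rmax (Rmax a b) (Rmax c d)) n).
  { intros a b c d H1 H2 H3 H4 H5.
    pose proof (Rmax_l a b). pose proof (Rmax_r a b).
    pose proof (Rmax_l c d). pose proof (Rmax_r c d).
    pose proof (Rmax_l (Rmax a b) (Rmax c d)). pose proof (Rmax_r (Rmax a b) (Rmax c d)).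
    assert (0 < / pt (S n)) by (apply Rinv_0_lt_compat, pt_pos). unfold Rdiv in *.
    constructor; [exact H1| | | |]; (eapply Rle_trans; [eassumption|]);
      fold r; apply Rmult_le_compat_r; lra. }
  apply Hall; clear Hall.
  - unfold mean_dev. rewrite rootavg_minus, rootavg_plus, !rootavg_const, HmS. ring.
  - pose (D' := fun k => - 2 / cb k + - 2 / cb (n - k) + (hodd (S n) - 2) - (- 2 / cb (S n))).
    (* D^2 = D'^2 + (D - D') (2 D' + (D - D')): the exactly evaluated model plus a cross term in
       which D - D' is only O(r). *)
    rewrite (rootavg_ext n _ (fun k => (D' k ^ 2 + var_dev n k)
       + (mean_dev m n k - D' k) * (2 * D' k + (mean_dev m n k - D' k)))) by (intros; ring).
    rewrite rootavg_plus. eapply Rle_trans; [apply Rabs_triang|].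
    replace ((Km + 5 * K1 ^ 2) * r ^ 3) with (Km * r ^ 3 + 5 * K1 ^ 2 * r ^ 3) by ring.
    apply Rplus_le_compat.
    + eapply Rle_trans; [apply (Hmod n)|]. fold r. apply Rmult_le_compat_l; [lra|].
      apply Rle_pow; [lra|lia].
    + eapply Rle_trans; [apply rootavg_abs|].
      apply Rle_trans with (rootavg n (fun k => K1 ^ 2 * (/ r * y k) + K1 ^ 2 * (r ^ 3 + 3 * r ^ 2))).
      * apply rootavg_le; intros k Hk. destruct (Hbound n k Hk) as [B1 B2].
        cbv zeta in B1, B2. fold (D' k) in B1, B2. fold r in B1, B2. fold (y k) in B1.
        rewrite Rabs_mult.
        assert (B3 : Rabs (2 * D' k + (mean_dev m n k - D' k)) <= K1 * (2 * sqrt (y k) + 3 * r)).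
        { eapply Rle_trans; [apply Rabs_triang|].
          rewrite Rabs_mult, (Rabs_pos_eq 2) by lra. lra. }
        eapply Rle_trans.
        { apply Rmult_le_compat; [apply Rabs_pos|apply Rabs_pos|exact B2|exact B3]. }
        replace (K1 * r * (K1 * (2 * sqrt (y k) + 3 * r))) with
          (K1 ^ 2 * (2 * sqrt (y k) * r + 3 * r ^ 2)) by ring.
        rewrite <- Rmult_plus_distr_l. apply Rmult_le_compat_l; [lra|].
        (* AM-GM: [2 s r <= s^2 / r + r^3] *)
        assert (2 * sqrt (y k) * r <= / r * y k + r ^ 3); [|lra].
        apply (Rmult_le_reg_l r); [lra|].
        replace (r * (/ r * y k + r ^ 3)) with (y k + r ^ 4) by (field; lra).
        rewrite <- (Hy2 k) at 2. pose proof (pow2_ge_0 (sqrt (y k) - r ^ 2)). nra.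
      * rewrite rootavg_plus, rootavg_const, !rootavg_scal.
        assert (/ r * rootavg n y <= r ^ 3).
        { apply Rle_trans with (/ r * r ^ 4).
          - apply Rmult_le_compat_l; [apply Rlt_le, Rinv_0_lt_compat; lra|exact Havg].
          - right; field; lra. }
        assert (r ^ 2 <= r ^ 3) by (apply Rle_pow; [lra|lia]).
        assert (K1 ^ 2 * (/ r * rootavg n y + (r ^ 3 + 3 * r ^ 2)) <= K1 ^ 2 * (5 * r ^ 3))
          by (apply Rmult_le_compat_l; lra).
        lra.
  (* In sqrt(y)^3 one factor is bounded by its maximum r^4, and the remaining y has average at most
     r^4; together r^8 = n + 2. *)
  - apply Rle_trans with (rootavg n (fun k => 4 * K2 ^ 3 * (r ^ 4 * y k) + 4 * K2 ^ 3 * r ^ 3)).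
    + apply rootavg_le; intros k Hk. pose proof (HD n k Hk) as B. fold r (y k) in B.
      apply Rle_trans with ((K2 * (sqrt (y k) + r)) ^ 3).
      { apply pow_incr. split; [apply Rabs_pos|exact B]. }
      pose proof (Hys k) as Hs0. pose proof (Hy4 k Hk) as Hs4.
      rewrite Rpow_mult_distr, <- Rmult_plus_distr_l.
      replace (4 * K2 ^ 3 * (r ^ 4 * y k + r ^ 3)) with (K2 ^ 3 * (4 * (r ^ 4 * y k + r ^ 3)))
        by ring.
      apply Rmult_le_compat_l; [lra|].
      apply Rle_trans with (4 * (sqrt (y k) ^ 3 + r ^ 3)).
      * assert (0 <= (sqrt (y k) - r) ^ 2 * (sqrt (y k) + r)).
        { apply Rmult_le_pos; [apply pow2_ge_0|lra]. } nra.
      * apply Rmult_le_compat_l; [lra|]. apply Rplus_le_compat_r.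
        replace (sqrt (y k) ^ 3) with (sqrt (y k) * sqrt (y k) ^ 2) by ring.
        rewrite Hy2. apply Rmult_le_compat_r; [apply Hy0|exact Hs4].
    + rewrite rootavg_plus, rootavg_const, !rootavg_scal.
      assert (r ^ 3 <= r ^ 8) by (apply Rle_pow; [lra|lia]).
      assert (r ^ 4 * rootavg n y <= r ^ 8).
      { replace (r ^ 8) with (r ^ 4 * r ^ 4) by ring. apply Rmult_le_compat_l; lra. }
      rewrite <- Hr8.
      assert (K2 ^ 3 * (r ^ 4 * rootavg n y + r ^ 3) <= K2 ^ 3 * (2 * r ^ 8))
        by (apply Rmult_le_compat_l; lra).
      lra.
  - apply Rle_trans with (rootavg n (fun k => 8 * sigma2 * K2 * (r ^ 4 * (3 / 2 * y k))
                                   + 8 * sigma2 * K2 * (r ^ 4 * (r ^ 2 / 2)))).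
    + apply rootavg_le; intros k Hk. pose proof (HD n k Hk) as B. fold r (y k) in B.
      pose proof (var_dev_bound n k Hk) as V.
      replace (area n k) with (y k * (INR n + 2)) in V by (unfold y; field; lra).
      rewrite sqrt_mult_alt, <- Hr4 in V by apply Hy0.
      eapply Rle_trans.
      { apply Rmult_le_compat; [apply Rabs_pos|apply Rabs_pos|exact B|exact V]. }
      pose proof (Hys k) as Hs0.
      replace (K2 * (sqrt (y k) + r) * (8 * sigma2 * (sqrt (y k) * r ^ 4))) with
        (8 * (sigma2 * K2) * (r ^ 4 * (sqrt (y k) ^ 2 + r * sqrt (y k)))) by ring.
      pose proof (Hy2 k) as E. set (s := sqrt (y k)) in *. rewrite <- E.
      replace (8 * sigma2 * K2 * (r ^ 4 * (3 / 2 * s ^ 2)) +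
               8 * sigma2 * K2 * (r ^ 4 * (r ^ 2 / 2))) with
        (8 * (sigma2 * K2) * (r ^ 4 * (3 / 2 * s ^ 2 + r ^ 2 / 2))) by field.
      apply Rmult_le_compat_l; [lra|]. apply Rmult_le_compat_l; [lra|].
      pose proof (pow2_ge_0 (s - r)). nra.
    + rewrite rootavg_plus, rootavg_const, !rootavg_scal.
      assert (r ^ 2 <= r ^ 4) by (apply Rle_pow; [lra|lia]).
      rewrite <- Hr8.
      assert (r ^ 4 * (3 / 2 * rootavg n y + r ^ 2 / 2) <= r ^ 4 * (2 * r ^ 4))
        by (apply Rmult_le_compat_l; lra).
      replace (r ^ 8) with (r ^ 4 * r ^ 4) by ring.
      assert (sigma2 * K2 * (r ^ 4 * (3 / 2 * rootavg n y + r ^ 2 / 2))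
              <= sigma2 * K2 * (r ^ 4 * (2 * r ^ 4)))
        by (apply Rmult_le_compat_l; lra).
      lra.
  - apply Rle_trans with (rootavg n (fun k => 64 * sigma2 ^ 2 * area n k)).
    + apply rootavg_le; intros k Hk. pose proof (var_dev_bound n k Hk) as V.
      rewrite <- (pow2_abs (var_dev n k)).
      apply Rle_trans with ((8 * sigma2 * sqrt (area n k)) ^ 2).
      * apply pow_incr. split; [apply Rabs_pos|exact V].
      * rewrite Rpow_mult_distr, pow2_sqrt by apply Rlt_le, area_pos. right; ring.
    + rewrite rootavg_scal. unfold area. rewrite rootavg_prod.
      pose proof (pt_pos (S n)). right; field; lra.
Qed.

(** * The heat kernel *)

Definition gauss (z : R) : R := exp (- z ^ 2 / 2).

Lemma gauss_pos z : 0 < gauss z.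
Proof. apply exp_pos. Qed.

Ltac gauss_field :=
  unfold Rdiv; simpl;
  match goal with |- context [exp ?a] => generalize (exp a) end; intros ?; field.

Lemma gauss_derive z : is_derive gauss z (- z * gauss z).
Proof. unfold gauss. auto_derive; [exact I|]. gauss_field. Qed.

Lemma gauss_continuous z : continuous gauss z.
Proof. apply (ex_derive_continuous gauss). eexists; apply gauss_derive. Qed.

Lemma gauss_ex_RInt a b : ex_RInt gauss a b.
Proof. apply (ex_RInt_continuous gauss). intros; apply gauss_continuous. Qed.

Definition Phi0 (y : R) : R := RInt gauss 0 y.

Lemma Phi0_derive y : is_derive Phi0 y (gauss y).
Proof.
  apply is_derive_RInt with 0.
  - apply filter_forall. intros b. apply (RInt_correct gauss), gauss_ex_RInt.
  - apply gauss_continuous.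
Qed.

Lemma exp_ge_quadratic x : 0 <= x -> 1 + x + x ^ 2 / 2 <= exp x.
Proof.
  intros Hx.
  destruct (MVT_gen (fun t => exp t - (1 + t + t ^ 2 / 2)) 0 x
    (fun t => exp t - (1 + t))) as [c [Hc E]].
  - intros t _. auto_derive; [exact I|]. field.
  - intros t _. apply derivable_continuous_pt.
    exists (exp t - (1 + t)). apply is_derive_Reals. auto_derive; [exact I|]. field.
  - rewrite exp_0 in E. rewrite Rmin_left in Hc by lra.
    pose proof (exp_ineq1_le c). nra.
Qed.

(** [exp_ge_quadratic] at z^2 / 2. Degree four dominates every polynomial factor in the derivatives
    of the kernel. *)
Lemma gauss_moment z : (1 + z ^ 2 / 2 + z ^ 4 / 8) * gauss z <= 1.
Proof.
  pose proof (exp_ge_quadratic (z ^ 2 / 2) ltac:(pose proof (pow2_ge_0 z); lra)) as H.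
  unfold gauss. replace (- z ^ 2 / 2) with (- (z ^ 2 / 2)) by field. rewrite exp_Ropp.
  pose proof (exp_pos (z ^ 2 / 2)) as Hp.
  apply (Rmult_le_reg_r (exp (z ^ 2 / 2))); [exact Hp|].
  rewrite Rmult_assoc, Rinv_l by lra. nra.
Qed.

(** An affine map away from the distribution function of N(0,w), which preserves the heat equation;
    integrating from 0 avoids improper integrals until the normalization. *)
Definition heat (x w : R) : R := Phi0 (x / sqrt w).
Definition heat_x (x w : R) : R := gauss (x / sqrt w) / sqrt w.
Definition heat_xx (x w : R) : R := - (x / sqrt w) * gauss (x / sqrt w) / w.
Definition heat_xxx (x w : R) : R :=
  ((x / sqrt w) ^ 2 - 1) * gauss (x / sqrt w) / (w * sqrt w).
Definition heat_ww (x w : R) : R :=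
  (3 * (x / sqrt w) - (x / sqrt w) ^ 3) / 4 * gauss (x / sqrt w) / w ^ 2.

Lemma sqrt_sq_pos w : 0 < w -> 0 < sqrt w /\ w = sqrt w ^ 2.
Proof. intros H; split; [apply sqrt_lt_R0, H|symmetry; apply pow2_sqrt; lra]. Qed.

Lemma heat_derive_x x w : 0 < w -> is_derive (fun x => heat x w) x (heat_x x w).
Proof.
  intros Hw. destruct (sqrt_sq_pos w Hw) as [Hs Hs2].
  evar_last.
  - apply (is_derive_comp Phi0 (fun x => x / sqrt w)); [apply Phi0_derive|].
    auto_derive; [exact I|reflexivity].
  - unfold scal; simpl; unfold mult; simpl. unfold heat_x. field. lra.
Qed.

Lemma heat_x_derive_x x w : 0 < w -> is_derive (fun x => heat_x x w) x (heat_xx x w).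
Proof.
  intros Hw. destruct (sqrt_sq_pos w Hw) as [Hs Hs2].
  unfold heat_x, heat_xx, gauss. auto_derive; [exact I|].
  set (s := sqrt w) in *. rewrite Hs2. gauss_field. lra.
Qed.

Lemma heat_xx_derive_x x w : 0 < w -> is_derive (fun x => heat_xx x w) x (heat_xxx x w).
Proof.
  intros Hw. destruct (sqrt_sq_pos w Hw) as [Hs Hs2].
  unfold heat_xxx, heat_xx, gauss. auto_derive; [exact I|].
  set (s := sqrt w) in *. rewrite Hs2.
  gauss_field. lra.
Qed.

Lemma heat_derive_w x w : 0 < w -> is_derive (fun w => heat x w) w (/ 2 * heat_xx x w).
Proof.
  intros Hw. destruct (sqrt_sq_pos w Hw) as [Hs Hs2].
  evar_last.
  - apply (is_derive_comp Phi0 (fun w => x / sqrt w)); [apply Phi0_derive|].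
    auto_derive; [|reflexivity]. repeat split; lra.
  - unfold scal; simpl; unfold mult; simpl. unfold heat_xx.
    set (s := sqrt w) in *. rewrite Hs2. field. lra.
Qed.

Lemma heat_w_derive_w x w : 0 < w ->
  is_derive (fun w => / 2 * heat_xx x w) w (heat_ww x w).
Proof.
  intros Hw. destruct (sqrt_sq_pos w Hw) as [Hs Hs2].
  unfold heat_xx, heat_ww, gauss. auto_derive; [repeat split; lra|].
  set (s := sqrt w) in *. rewrite Hs2.
  gauss_field. lra.
Qed.

(** * Taylor estimates for the heat kernel *)

Lemma MVT_is_derive (f df : R -> R) a b :
  (forall t, Rmin a b <= t <= Rmax a b -> is_derive f t (df t)) ->
  exists c, Rmin a b <= c <= Rmax a b /\ f b - f a = df c * (b - a).
Proof.
  intros H. apply MVT_gen.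
  - intros t Ht; apply H; lra.
  - intros t Ht. apply continuity_pt_filterlim, (ex_derive_continuous f).
    eexists; apply H, Ht.
Qed.

Lemma segment_dist a b c t :
  Rmin a b <= t <= Rmax a b -> Rmin a t <= c <= Rmax a t ->
  Rmin a b <= c <= Rmax a b /\ Rabs (c - a) <= Rabs (t - a).
Proof.
  unfold Rmin, Rmax, Rabs.
  repeat destruct Rle_dec; repeat destruct Rcase_abs; lra.
Qed.

Lemma segment_end a b : Rmin a b <= b <= Rmax a b.
Proof. split; [apply Rmin_r|apply Rmax_r]. Qed.

Lemma taylor1 (f df : R -> R) a b M :
  (forall t, Rmin a b <= t <= Rmax a b -> is_derive f t (df t)) ->
  (forall t, Rmin a b <= t <= Rmax a b -> Rabs (df t) <= M) ->
  Rabs (f b - f a) <= M * Rabs (b - a).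
Proof.
  intros H HM. destruct (MVT_is_derive f df a b H) as [c [Hc ->]].
  rewrite Rabs_mult. apply Rmult_le_compat_r; [apply Rabs_pos|apply HM, Hc].
Qed.

Lemma taylor2 (f df ddf : R -> R) a b M :
  (forall t, Rmin a b <= t <= Rmax a b -> is_derive f t (df t)) ->
  (forall t, Rmin a b <= t <= Rmax a b -> is_derive df t (ddf t)) ->
  (forall t, Rmin a b <= t <= Rmax a b -> Rabs (ddf t) <= M) ->
  Rabs (f b - f a - (b - a) * df a) <= M * Rabs (b - a) ^ 2.
Proof.
  intros H1 H2 HM.
  destruct (MVT_is_derive (fun t => f t - (t - a) * df a) (fun t => df t - df a) a b)
    as [c [Hc E]].
  - intros t Ht. apply (is_derive_minus f (fun t => (t - a) * df a)).
    + apply H1, Ht.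
    + auto_derive; [exact I|ring].
  - destruct (segment_dist a b c b (segment_end a b) Hc) as [Hc' Hd].
    replace (f b - f a - (b - a) * df a) with ((df c - df a) * (b - a)) by lra.
    rewrite Rabs_mult. simpl. rewrite Rmult_1_r, <- Rmult_assoc.
    apply Rmult_le_compat_r; [apply Rabs_pos|].
    assert (HM0 : 0 <= M) by (eapply Rle_trans; [apply Rabs_pos|apply (HM c Hc)]).
    apply Rle_trans with (M * Rabs (c - a)).
    + apply (taylor1 df ddf).
      * intros t Ht. apply H2, (segment_dist a b t c Hc Ht).
      * intros t Ht. apply HM, (segment_dist a b t c Hc Ht).
    + apply Rmult_le_compat_l; assumption.
Qed.

(** Iterated mean value theorem; it loses the factorial in the remainder, which is harmless here. *)
Lemma taylor3 (f df ddf dddf : R -> R) a b M :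
  (forall t, Rmin a b <= t <= Rmax a b -> is_derive f t (df t)) ->
  (forall t, Rmin a b <= t <= Rmax a b -> is_derive df t (ddf t)) ->
  (forall t, Rmin a b <= t <= Rmax a b -> is_derive ddf t (dddf t)) ->
  (forall t, Rmin a b <= t <= Rmax a b -> Rabs (dddf t) <= M) ->
  Rabs (f b - f a - (b - a) * df a - (b - a) ^ 2 / 2 * ddf a) <= M * Rabs (b - a) ^ 3.
Proof.
  intros H1 H2 H3 HM.
  destruct (MVT_is_derive (fun t => f t - ((t - a) * df a + (t - a) ^ 2 / 2 * ddf a))
    (fun t => df t - (df a + (t - a) * ddf a)) a b) as [c [Hc E]].
  - intros t Ht. apply (is_derive_minus f (fun t => (t - a) * df a + (t - a) ^ 2 / 2 * ddf a)).
    + apply H1, Ht.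
    + auto_derive; [exact I|field].
  - destruct (segment_dist a b c b (segment_end a b) Hc) as [Hc' Hd].
    replace (f b - f a - (b - a) * df a - (b - a) ^ 2 / 2 * ddf a)
      with ((df c - df a - (c - a) * ddf a) * (b - a)) by lra.
    rewrite Rabs_mult.
    replace (M * Rabs (b - a) ^ 3) with (M * Rabs (b - a) ^ 2 * Rabs (b - a)) by ring.
    apply Rmult_le_compat_r; [apply Rabs_pos|].
    assert (HM0 : 0 <= M) by (eapply Rle_trans; [apply Rabs_pos|apply (HM c Hc)]).
    apply Rle_trans with (M * Rabs (c - a) ^ 2).
    + apply (taylor2 df ddf dddf).
      * intros t Ht. apply H2, (segment_dist a b t c Hc Ht).
      * intros t Ht. apply H3, (segment_dist a b t c Hc Ht).
      * intros t Ht. apply HM, (segment_dist a b t c Hc Ht).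
    + apply Rmult_le_compat_l; [exact HM0|]. apply pow_incr. split; [apply Rabs_pos|exact Hd].
Qed.

Lemma gauss_poly_bound (p : R -> R) c z :
  Rabs (p z) <= c * (1 + z ^ 2 / 2 + z ^ 4 / 8) -> 0 <= c ->
  Rabs (p z * gauss z) <= c.
Proof.
  intros H Hc. pose proof (gauss_pos z) as Hg. pose proof (gauss_moment z) as Hm.
  rewrite Rabs_mult, (Rabs_pos_eq (gauss z)) by lra.
  apply Rle_trans with (c * (1 + z ^ 2 / 2 + z ^ 4 / 8) * gauss z).
  - apply Rmult_le_compat_r; lra.
  - rewrite Rmult_assoc. rewrite <- (Rmult_1_r c) at 2. apply Rmult_le_compat_l; lra.
Qed.

Lemma Rabs_div_le a b c d : Rabs a <= c -> 0 <= c -> 0 < d <= b -> Rabs (a / b) <= c / d.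
Proof.
  intros H Hc Hd. unfold Rdiv. rewrite Rabs_mult, Rabs_inv, (Rabs_pos_eq b) by lra.
  apply Rmult_le_compat; [apply Rabs_pos| |exact H|].
  - apply Rlt_le, Rinv_0_lt_compat; lra.
  - apply Rinv_le_contravar; lra.
Qed.

Lemma heat_xx_bound tau x w : 0 < tau -> tau ^ 2 <= w -> Rabs (heat_xx x w) <= 1 / tau ^ 2.
Proof.
  intros Ht Hw. unfold heat_xx. apply Rabs_div_le; [|lra|split; [apply pow_lt, Ht|exact Hw]].
  generalize (x / sqrt w); intros z.
  apply (gauss_poly_bound (fun z => - z)); [|lra].
  pose proof (pow2_ge_0 (z ^ 2)). apply Rabs_le.
  pose proof (pow2_ge_0 (z - 1)). pose proof (pow2_ge_0 (z + 1)). nra.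
Qed.

Lemma heat_xxx_bound tau x w : 0 < tau -> tau ^ 2 <= w -> Rabs (heat_xxx x w) <= 2 / tau ^ 3.
Proof.
  intros Ht Hw. unfold heat_xxx.
  assert (Hs : tau <= sqrt w).
  { rewrite <- (sqrt_pow2 tau) by lra. apply sqrt_le_1_alt, Hw. }
  apply Rabs_div_le; [|lra|].
  - generalize (x / sqrt w); intros z.
    apply (gauss_poly_bound (fun z => z ^ 2 - 1)); [|lra].
    pose proof (pow2_ge_0 (z ^ 2)). pose proof (pow2_ge_0 z). apply Rabs_le. nra.
  - split; [apply pow_lt, Ht|]. replace (tau ^ 3) with (tau ^ 2 * tau) by ring.
    apply Rmult_le_compat; try lra. apply pow_le; lra.
Qed.

Lemma heat_ww_bound tau x w : 0 < tau -> tau ^ 2 <= w -> Rabs (heat_ww x w) <= 4 / tau ^ 4.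
Proof.
  intros Ht Hw. unfold heat_ww. apply Rabs_div_le; [|lra|].
  - generalize (x / sqrt w); intros z.
    apply (gauss_poly_bound (fun z => (3 * z - z ^ 3) / 4)); [|lra].
    pose proof (pow2_ge_0 (z ^ 2)). pose proof (pow2_ge_0 z).
    pose proof (pow2_ge_0 (z - 1)). pose proof (pow2_ge_0 (z + 1)).
    pose proof (pow2_ge_0 (z ^ 2 - z)). pose proof (pow2_ge_0 (z ^ 2 + z)).
    apply Rabs_le. split; nra.
  - split; [apply pow_lt, Ht|]. replace (tau ^ 4) with ((tau ^ 2) ^ 2) by ring.
    apply pow_incr. split; [apply pow2_ge_0|exact Hw].
Qed.

(* The heat equation [heat_w = heat_xx / 2] merges the second-order term in [D]
   with the first-order term in [W]. *)
Lemma heat_step tau x w D W : 0 < tau -> tau ^ 2 <= w -> tau ^ 2 <= w + W ->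
  Rabs (heat (x - D) (w + W) - heat x w + D * heat_x x w
        - / 2 * (D ^ 2 + W) * heat_xx x w)
  <= 2 / tau ^ 3 * Rabs D ^ 3 + / tau ^ 3 * (Rabs D * Rabs W) + 4 / tau ^ 4 * W ^ 2.
Proof.
  intros Ht Hw HwW.
  assert (Ht2 : 0 < tau ^ 2) by (apply pow_lt, Ht).
  pose proof (taylor3 (fun x => heat x w) (fun x => heat_x x w) (fun x => heat_xx x w)
    (fun x => heat_xxx x w) x (x - D) (2 / tau ^ 3)) as T1.
  pose proof (taylor1 (fun x => heat_xx x w) (fun x => heat_xxx x w) x (x - D) (2 / tau ^ 3)) as T2.
  pose proof (taylor2 (fun w => heat (x - D) w) (fun w => / 2 * heat_xx (x - D) w)
    (fun w => heat_ww (x - D) w) w (w + W) (4 / tau ^ 4)) as T3.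
  replace (x - D - x) with (- D) in T1, T2 by ring. replace (w + W - w) with W in T3 by ring.
  rewrite Rabs_Ropp in T1, T2. rewrite pow2_abs in T3.
  assert (B1 : Rabs (heat (x - D) w - heat x w - - D * heat_x x w - (- D) ^ 2 / 2 * heat_xx x w)
               <= 2 / tau ^ 3 * Rabs D ^ 3).
  { apply T1; intros; [apply heat_derive_x|apply heat_x_derive_x|apply heat_xx_derive_x
      |apply heat_xxx_bound]; lra. }
  assert (B2 : Rabs (heat_xx (x - D) w - heat_xx x w) <= 2 / tau ^ 3 * Rabs D).
  { apply T2; intros; [apply heat_xx_derive_x|apply heat_xxx_bound]; lra. }
  assert (Hseg : forall t, Rmin w (w + W) <= t <= Rmax w (w + W) -> tau ^ 2 <= t).
  { intros t [Ht' _]. eapply Rle_trans; [|exact Ht']. apply Rmin_glb; assumption. }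
  assert (B3 : Rabs (heat (x - D) (w + W) - heat (x - D) w - W * (/ 2 * heat_xx (x - D) w))
               <= 4 / tau ^ 4 * W ^ 2).
  { apply T3; intros t Hts; apply Hseg in Hts;
      [apply heat_derive_w|apply heat_w_derive_w|apply heat_ww_bound]; lra. }
  (* Move in space at fixed w, bring the w-derivative back from x - D to x, then move in w at x - D.
     The middle term produces the mixed product of D and W. *)
  replace (heat (x - D) (w + W) - heat x w + D * heat_x x w - / 2 * (D ^ 2 + W) * heat_xx x w)
    with ((heat (x - D) w - heat x w - - D * heat_x x w - (- D) ^ 2 / 2 * heat_xx x w)
      + / 2 * W * (heat_xx (x - D) w - heat_xx x w)
      + (heat (x - D) (w + W) - heat (x - D) w - W * (/ 2 * heat_xx (x - D) w))) by field.
  eapply Rle_trans; [apply Rabs_triang|]. apply Rplus_le_compat; [|exact B3].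
  eapply Rle_trans; [apply Rabs_triang|]. apply Rplus_le_compat; [exact B1|].
  rewrite !Rabs_mult, (Rabs_pos_eq (/ 2)) by lra.
  replace (/ tau ^ 3 * (Rabs D * Rabs W)) with (/ 2 * Rabs W * (2 / tau ^ 3 * Rabs D))
    by (field; lra).
  apply Rmult_le_compat_l; [|exact B2]. pose proof (Rabs_pos W); lra.
Qed.

(** * Normal approximation along the recursion *)

(* Supersolutions of the tree recursion for the tolls [sqrt n], [1] and [n]. *)
Definition supersol (a b c : R) (n : nat) : R :=
  a * ((INR n + 1) * hodd n) + b * INR n + c * / pt n.

Lemma supersol_0 a b c : supersol a b c 0 = c.
Proof. unfold supersol. simpl hodd. rewrite pt_0. simpl. field. Qed.

(** The parts b and c solve their recursions exactly; the part a is an inequality because the exact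
    toll of [rootavg_var] is at least [/ cb (S n)], hence at least sqrt (n+2). *)
Lemma supersol_S a b c n : 0 <= a ->
  rootavg n (fun k => supersol a b c k + supersol a b c (n - k))
  + (a * root8 (S n) ^ 4 + b + c * (INR n + 2)) <= supersol a b c (S n).
Proof.
  intros Ha.
  rewrite (rootavg_ext n _ (fun k =>
    a * ((INR k + 1) * hodd k + (INR (n - k) + 1) * hodd (n - k))
    + (b * INR n + c * (/ pt k + / pt (n - k))))).
  2:{ intros k Hk. unfold supersol. rewrite minus_INR by exact Hk. ring. }
  rewrite !rootavg_plus, rootavg_const, !rootavg_scal, rootavg_var, rootavg_recip_pt.
  unfold supersol. rewrite root8_pow4, S_INR.
  assert (H : sqrt (INR n + 1 + 1) <= / ((INR n + 1) * pt (S n))).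
  { pose proof (proj1 (inv_cb_bounds (S n))) as H. rewrite S_INR in H.
    eapply Rle_trans; [exact H|]. rewrite cb_pt, S_INR. pose proof (pt_pos (S n)). posn.
    apply Rinv_le_contravar; [apply Rmult_lt_0_compat; lra|].
    apply Rmult_le_compat_r; lra. }
  assert (a * sqrt (INR n + 1 + 1) <= a * / ((INR n + 1) * pt (S n)))
    by (apply Rmult_le_compat_l; lra).
  replace (INR n + 1 + 1) with (INR n + 2) in * by ring. lra.
Qed.

(** Applied to r = [root8], it turns the toll n^(3/8) into an arbitrarily small multiple of sqrt n
    plus a constant, both covered by [supersol]. *)
Lemma cube_le_quartic eta r : 0 < eta -> 0 < r -> r ^ 3 <= eta * r ^ 4 + / eta ^ 3.
Proof.
  intros He Hr. assert (0 < / eta ^ 3) by (apply Rinv_0_lt_compat, pow_lt, He).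
  assert (0 < r ^ 3) by (apply pow_lt, Hr).
  destruct (Rle_lt_dec 1 (eta * r)) as [H1|H1].
  - assert (1 * r ^ 3 <= eta * r * r ^ 3) by (apply Rmult_le_compat_r; lra).
    replace (eta * r ^ 4) with (eta * r * r ^ 3) by ring. lra.
  - assert (0 <= eta * r ^ 4) by (apply Rmult_le_pos; [lra|apply pow_le; lra]).
    assert (r ^ 3 <= / eta ^ 3); [|lra]. rewrite <- pow_inv. apply pow_incr.
    split; [lra|]. apply (Rmult_le_reg_l eta); [lra|]. rewrite Rinv_r; lra.
Qed.

Definition cshape (t : btree) : R := shape t - C0 * (INR (bsize t) + 1).

Lemma cshape_node l r :
  cshape (Node l r) = cshape l + cshape r + ln (INR (S (bsize l + bsize r))).
Proof.
  unfold cshape, shape. cbn [addfun bsize]. rewrite S_INR, plus_INR. ring.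
Qed.

Section Tree_CLT.

Context (L : nat -> list btree) (HL : forall n, enumerates (L n) n).

Definition cmean (n : nat) : R := mean (L n) cshape.

Definition cvar (n : nat) : R := mean (L n) (fun t => (cshape t - cmean n) ^ 2).

Lemma cmean_0 : cmean 0 = - C0.
Proof.
  unfold cmean. rewrite (mean_0 L HL). unfold cshape, shape. simpl. ring.
Qed.

Lemma mean_node n (F : btree -> R) (G : R -> R) :
  (forall t, F t = G (cshape t)) ->
  mean (L (S n)) F = rootavg n (fun k => mean (L k) (fun l =>
    mean (L (n - k)) (fun r => G (cshape l + cshape r + ln (INR (S n)))))).
Proof.
  intros H. rewrite (mean_S L HL). apply rootavg_ext; intros k Hk.
  apply (mean_ext L HL); intros l Hl. apply (mean_ext L HL); intros r Hr.
  rewrite H, cshape_node, Hl, Hr. do 5 f_equal. lia.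
Qed.

Lemma cmean_S n :
  cmean (S n) = rootavg n (fun k => cmean k + cmean (n - k)) + ln (INR (S n)).
Proof.
  unfold cmean at 1. rewrite (mean_node n cshape (fun y => y)) by reflexivity.
  transitivity (rootavg n (fun k => cmean k + cmean (n - k) + ln (INR (S n)))).
  2:{ rewrite rootavg_plus, rootavg_const. reflexivity. }
  apply rootavg_ext; intros k Hk.
  rewrite (mean_ext L HL k _ (fun l => cshape l + (cmean (n - k) + ln (INR (S n))))).
  - rewrite (mean_plus L HL), (mean_const L HL).
    change (cmean k + (cmean (n - k) + ln (INR (S n)))
      = cmean k + cmean (n - k) + ln (INR (S n))). ring.
  - intros l _. rewrite (mean_ext L HL (n - k) _
      (fun r => (cshape l + ln (INR (S n))) + cshape r)) by (intros; ring).
    rewrite (mean_plus L HL), (mean_const L HL).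
    change (cshape l + ln (INR (S n)) + cmean (n - k)
      = cshape l + (cmean (n - k) + ln (INR (S n)))). ring.
Qed.

Lemma mean_shift_sq n a :
  mean (L n) (fun t => (a + (cshape t - cmean n)) ^ 2) = a ^ 2 + cvar n.
Proof.
  rewrite (mean_ext L HL n _ (fun t => (a ^ 2 - 2 * a * cmean n)
     + (2 * a * cshape t + (cshape t - cmean n) ^ 2))) by (intros; ring).
  rewrite !(mean_plus L HL), (mean_const L HL), (mean_scal L HL).
  change (a ^ 2 - 2 * a * cmean n + (2 * a * cmean n + cvar n) = a ^ 2 + cvar n). ring.
Qed.

Lemma cvar_0 : cvar 0 = 0.
Proof. unfold cvar. rewrite (mean_0 L HL), cmean_0. unfold cshape, shape. simpl. ring. Qed.

Lemma cvar_S n :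
  cvar (S n) = rootavg n (fun k => cvar k + cvar (n - k) + mean_dev cmean n k ^ 2).
Proof.
  unfold cvar at 1.
  rewrite (mean_node n _ (fun y => (y - cmean (S n)) ^ 2)) by reflexivity.
  apply rootavg_ext; intros k Hk.
  rewrite (mean_ext L HL k _ (fun l =>
     (mean_dev cmean n k + (cshape l - cmean k)) ^ 2 + cvar (n - k))).
  - rewrite (mean_plus L HL), (mean_const L HL), mean_shift_sq. ring.
  - intros l _. rewrite <- mean_shift_sq. apply (mean_ext L HL); intros r _.
    unfold mean_dev. ring.
Qed.

Lemma cvar_error K : 0 <= K -> (forall n, dev_moments cmean K n) ->
  forall eta, 0 < eta -> forall n,
  Rabs (cvar n - vlead n) <= supersol (K * eta) (K / eta ^ 3) 0 n.
Proof.
  intros HK HM eta He n.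
  assert (Ha : 0 <= K * eta) by nra.
  apply (rootavg_compare n (fun n => Rabs (cvar n - vlead n))); [| |lia].
  - rewrite cvar_0, supersol_0. unfold vlead. simpl hodd.
    rewrite !Rmult_0_r, Rminus_0_r, Rabs_R0. lra.
  - intros i _. exists (K * root8 (S i) ^ 3). split.
    + replace (cvar (S i) - vlead (S i)) with
        (rootavg i (fun k => (cvar k - vlead k) + (cvar (i - k) - vlead (i - k)))
         + rootavg i (fun k => mean_dev cmean i k ^ 2 + var_dev i k)).
      * eapply Rle_trans; [apply Rabs_triang|].
        apply Rplus_le_compat; [|apply (dev_second _ _ _ (HM i))].
        eapply Rle_trans; [apply rootavg_abs|]. apply rootavg_le; intros k _.
        apply Rabs_triang.
      * rewrite cvar_S, <- (rootavg_const i (vlead (S i))), <- rootavg_plus, <- rootavg_minus.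
        apply rootavg_ext; intros k _. unfold var_dev. ring.
    + eapply Rle_trans; [|apply (supersol_S _ _ _ i Ha)]. apply Rplus_le_compat_l.
      pose proof (root8_ge1 (S i)) as Hr.
      pose proof (cube_le_quartic eta (root8 (S i)) He ltac:(lra)) as Hc.
      apply (Rmult_le_compat_l K) in Hc; [|exact HK]. unfold Rdiv. lra.
Qed.

(* Zolotarev-type comparison: smoothing by the heat kernel replaces the law of
   [cshape] by the normal law with mean [cmean n] and variance [vlead n]; the bound is
   uniform in [x] and in [w >= tau ^ 2], so the two subtrees can be replaced one
   after the other. *)
Lemma smoothing_error K : 0 <= K -> (forall n, dev_moments cmean K n) ->
  forall eta tau N, 0 < eta -> 0 < tau ->
  forall n, (n <= N)%nat -> forall x w, tau ^ 2 <= w ->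
  Rabs (mean (L n) (fun t => heat (x - cshape t) w) - heat (x - cmean n) (w + vlead n))
  <= supersol (K / tau ^ 2 * eta) (K / tau ^ 2 / eta ^ 3)
       (3 * K / tau ^ 3 + 8 * K * sqrt (INR N + 1) / tau ^ 4) n.
Proof.
  intros HK HM eta tau N He Ht n.
  set (a := K / tau ^ 2 * eta). set (b := K / tau ^ 2 / eta ^ 3).
  (* The squared variance increments give a toll n^(3/2), outside the range of [supersol]; since n
     <= N, it is at most a multiple of sqrt (N+1) times n. *)
  set (c := 3 * K / tau ^ 3 + 8 * K * sqrt (INR N + 1) / tau ^ 4).
  assert (Ht2 : 0 < / tau ^ 2) by (apply Rinv_0_lt_compat, pow_lt, Ht).
  assert (Ht3 : 0 < / tau ^ 3) by (apply Rinv_0_lt_compat, pow_lt, Ht).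
  assert (Ht4 : 0 < / tau ^ 4) by (apply Rinv_0_lt_compat, pow_lt, Ht).
  assert (Ha : 0 <= a) by (unfold a, Rdiv; apply Rmult_le_pos; [nra|lra]).
  assert (Hc : 0 <= c).
  { unfold c, Rdiv. pose proof (sqrt_pos (INR N + 1)).
    apply Rplus_le_le_0_compat; apply Rmult_le_pos; nra. }
  induction n as [n IH] using lt_wf_ind. intros Hn x w Hw.
  destruct n as [|n].
  { rewrite (mean_0 L HL), supersol_0, cmean_0. unfold vlead. simpl hodd.
    unfold cshape, shape. simpl.
    replace (x - (0 - C0 * (0 + 1))) with (x - - C0) by ring.
    replace (w + sigma2 * ((0 + 1) * 0)) with w by ring.
    rewrite Rminus_diag, Rabs_R0. exact Hc. }
  set (x' := x - cmean (S n)). set (w' := w + vlead (S n)).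
  assert (Hw' : tau ^ 2 <= w') by (unfold w'; pose proof (vlead_ge0 (S n)); lra).
  assert (H1 : Rabs (mean (L (S n)) (fun t => heat (x - cshape t) w)
      - rootavg n (fun k => heat (x' - mean_dev cmean n k) (w' + var_dev n k)))
      <= rootavg n (fun k => supersol a b c k + supersol a b c (n - k))).
  { rewrite (mean_node n _ (fun y => heat (x - y) w)) by reflexivity.
    rewrite <- rootavg_minus. eapply Rle_trans; [apply rootavg_abs|].
    apply rootavg_le; intros k Hk.
    set (y := x - ln (INR (S n))).
    pose proof (vlead_ge0 k). pose proof (vlead_ge0 (n - k)).
    replace (heat (x' - mean_dev cmean n k) (w' + var_dev n k)) with
      (heat (y - cmean (n - k) - cmean k) (w + vlead (n - k) + vlead k))
      by (f_equal; unfold mean_dev, var_dev, x', w', y; ring).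
    pose proof (IH k ltac:(lia) ltac:(lia) (y - cmean (n - k)) (w + vlead (n - k)) ltac:(lra))
      as I1.
    (* The hybrid average: the right subtree is already Gaussian, the left one still random. [I2]
       applies the induction hypothesis for each fixed left subtree; [I1] applies it at the larger
       variance w + [vlead (n - k)]. *)
    set (M1 := mean (L k) (fun t => heat (y - cmean (n - k) - cshape t) (w + vlead (n - k)))) in *.
    set (M2 := mean (L k) _).
    assert (I2 : Rabs (M2 - M1) <= supersol a b c (n - k)).
    { apply Rabs_le. unfold M1, M2. split.
      - apply Ropp_le_cancel. rewrite Ropp_involutive.
        assert (Hm : mean (L k) (fun t => heat (y - cmean (n - k) - cshape t) (w + vlead (n - k)))
           <= mean (L k) (fun l => mean (L (n - k)) (fun r =>
                heat (x - (cshape l + cshape r + ln (INR (S n)))) w) + supersol a b c (n - k))).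
        { apply (mean_le L HL); intros l.
          pose proof (IH (n - k)%nat ltac:(lia) ltac:(lia) (y - cshape l) w Hw) as I.
          rewrite (mean_ext L HL (n - k) _ (fun r => heat (x - (cshape l + cshape r
             + ln (INR (S n)))) w)) in I by (intros; f_equal; unfold y; ring).
          replace (y - cshape l - cmean (n - k)) with (y - cmean (n - k) - cshape l) in I by ring.
          apply Rabs_le_between in I. lra. }
        rewrite (mean_plus L HL), (mean_const L HL) in Hm. lra.
      - assert (Hm : mean (L k) (fun l => mean (L (n - k)) (fun r =>
                heat (x - (cshape l + cshape r + ln (INR (S n)))) w))
           <= mean (L k) (fun t => heat (y - cmean (n - k) - cshape t) (w + vlead (n - k))
                 + supersol a b c (n - k))).
        { apply (mean_le L HL); intros l.
          pose proof (IH (n - k)%nat ltac:(lia) ltac:(lia) (y - cshape l) w Hw) as I.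
          rewrite (mean_ext L HL (n - k) _ (fun r => heat (x - (cshape l + cshape r
             + ln (INR (S n)))) w)) in I by (intros; f_equal; unfold y; ring).
          replace (y - cshape l - cmean (n - k)) with (y - cmean (n - k) - cshape l) in I by ring.
          apply Rabs_le_between in I. lra. }
        rewrite (mean_plus L HL), (mean_const L HL) in Hm. lra. }
    apply Rabs_le_between in I1, I2. apply Rabs_le. lra. }
  destruct (HM n) as [D1 D2 D3 D4 D5].
  assert (H2 : Rabs (rootavg n (fun k => heat (x' - mean_dev cmean n k) (w' + var_dev n k))
      - heat x' w') <= a * root8 (S n) ^ 4 + b + c * (INR n + 2)).
  (* The linear term may be inserted since [mean_dev] averages to 0. The second-order term is
     averaged before taking absolute values, because D^2 and W cancel only on average. *)
  { assert (E : rootavg n (fun k => heat (x' - mean_dev cmean n k) (w' + var_dev n k))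
       - heat x' w' =
       rootavg n (fun k => heat (x' - mean_dev cmean n k) (w' + var_dev n k) - heat x' w'
          + mean_dev cmean n k * heat_x x' w'
          - / 2 * (mean_dev cmean n k ^ 2 + var_dev n k) * heat_xx x' w')
       + / 2 * heat_xx x' w' * rootavg n (fun k => mean_dev cmean n k ^ 2 + var_dev n k)).
    { rewrite <- rootavg_scal, <- rootavg_plus.
      rewrite (rootavg_ext n (fun k => _ + / 2 * heat_xx x' w' * _)
        (fun k => (heat (x' - mean_dev cmean n k) (w' + var_dev n k) - heat x' w')
          + heat_x x' w' * mean_dev cmean n k)) by (intros; ring).
      rewrite rootavg_plus, rootavg_minus, rootavg_const, rootavg_scal, D1. ring. }
    rewrite E. eapply Rle_trans; [apply Rabs_triang|].
    assert (E1 : Rabs (rootavg n (fun k => heat (x' - mean_dev cmean n k) (w' + var_dev n k)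
          - heat x' w' + mean_dev cmean n k * heat_x x' w'
          - / 2 * (mean_dev cmean n k ^ 2 + var_dev n k) * heat_xx x' w'))
       <= c * (INR n + 2)).
    { eapply Rle_trans; [apply rootavg_abs|].
      eapply Rle_trans.
      { apply rootavg_le with (g := fun k => 2 / tau ^ 3 * Rabs (mean_dev cmean n k) ^ 3
          + (/ tau ^ 3 * (Rabs (mean_dev cmean n k) * Rabs (var_dev n k))
             + 4 / tau ^ 4 * var_dev n k ^ 2)).
        intros k Hk. rewrite <- Rplus_assoc. apply heat_step; [exact Ht|exact Hw'|].
        unfold w', var_dev. pose proof (vlead_ge0 k). pose proof (vlead_ge0 (n - k)). lra. }
      rewrite !rootavg_plus, !rootavg_scal.
      assert (P1 : 2 / tau ^ 3 * rootavg n (fun k => Rabs (mean_dev cmean n k) ^ 3)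
                   <= 2 / tau ^ 3 * (K * (INR n + 2)))
        by (apply Rmult_le_compat_l; [unfold Rdiv; lra|exact D3]).
      assert (P2 : / tau ^ 3 * rootavg n (fun k => Rabs (mean_dev cmean n k) * Rabs (var_dev n k))
                   <= / tau ^ 3 * (K * (INR n + 2)))
        by (apply Rmult_le_compat_l; [lra|exact D4]).
      assert (P3 : 4 / tau ^ 4 * rootavg n (fun k => var_dev n k ^ 2)
                   <= 4 / tau ^ 4 * (K * ((INR n + 2) * (2 * sqrt (INR N + 1))))).
      { apply Rmult_le_compat_l; [unfold Rdiv; lra|]. eapply Rle_trans; [exact D5|].
        apply Rmult_le_compat_l; [exact HK|].
        pose proof (proj2 (inv_cb_bounds (S n))) as Hi. pose proof (cb_pos (S n)).
        replace (/ pt (S n)) with ((INR n + 2) * / cb (S n)).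
        - apply Rmult_le_compat_l; [posn; lra|]. eapply Rle_trans; [exact Hi|].
          apply Rmult_le_compat_l; [lra|]. apply sqrt_le_1_alt.
          apply le_INR in Hn. lra.
        - unfold pt. rewrite S_INR. posn. field. split; lra. }
      replace (c * (INR n + 2)) with (2 / tau ^ 3 * (K * (INR n + 2))
        + (/ tau ^ 3 * (K * (INR n + 2))
        + 4 / tau ^ 4 * (K * ((INR n + 2) * (2 * sqrt (INR N + 1))))))
        by (unfold c; field; lra).
      lra. }
    assert (E2 : Rabs (/ 2 * heat_xx x' w' *
        rootavg n (fun k => mean_dev cmean n k ^ 2 + var_dev n k))
       <= a * root8 (S n) ^ 4 + b).
    { rewrite !Rabs_mult, (Rabs_pos_eq (/ 2)) by lra.
      pose proof (heat_xx_bound tau x' w' Ht Hw') as Hx.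
      pose proof (root8_ge1 (S n)) as Hr.
      assert (Hr3 : 0 <= K * root8 (S n) ^ 3)
        by (apply Rmult_le_pos; [lra|apply pow_le; lra]).
      apply Rle_trans with (/ tau ^ 2 * (K * root8 (S n) ^ 3)).
      - apply Rmult_le_compat; [|apply Rabs_pos| |exact D2].
        + pose proof (Rabs_pos (heat_xx x' w')). lra.
        + unfold Rdiv in Hx. pose proof (Rabs_pos (heat_xx x' w')). lra.
      - pose proof (cube_le_quartic eta (root8 (S n)) He ltac:(lra)) as Hq.
        apply (Rmult_le_compat_l (K / tau ^ 2)) in Hq.
        + unfold a, b, Rdiv in *. lra.
        + unfold Rdiv; apply Rmult_le_pos; lra. }
    lra. }
  pose proof (supersol_S a b c n Ha) as H3.
  apply Rabs_le_between in H1, H2. fold x' w'. apply Rabs_le. lra.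
Qed.

End Tree_CLT.

(** * The Gaussian integral *)

Lemma derive_zero_const (f : R -> R) :
  (forall x, is_derive f x 0) -> forall x, f x = f 0.
Proof.
  intros H x. destruct (MVT_is_derive f (fun _ => 0) 0 x) as [c [_ E]].
  - intros t _; apply H.
  - lra.
Qed.

Lemma Phi0_0 : Phi0 0 = 0.
Proof. apply (RInt_point (V := R_CompleteNormedModule) 0 gauss). Qed.

Lemma gauss_even z : gauss (- z) = gauss z.
Proof. unfold gauss. f_equal. field. Qed.

Lemma Phi0_odd y : Phi0 (- y) = - Phi0 y.
Proof.
  assert (H : Phi0 y + Phi0 (- y) = Phi0 0 + Phi0 (- 0)).
  { apply (derive_zero_const (fun y => Phi0 y + Phi0 (- y))). intros x.
    evar_last.
    - apply (is_derive_plus Phi0 (fun y => Phi0 (- y))); [apply Phi0_derive|].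
      apply (is_derive_comp Phi0 Ropp x (gauss (- x)) (-1)); [apply Phi0_derive|].
      auto_derive; [exact I|ring].
    - rewrite gauss_even. unfold plus, scal; simpl. unfold mult; simpl. ring. }
  rewrite Ropp_0, Phi0_0 in H. lra.
Qed.

Lemma Phi0_incr a b : a <= b -> Phi0 a <= Phi0 b.
Proof.
  intros H. destruct (MVT_is_derive Phi0 gauss a b) as [c [_ E]].
  - intros; apply Phi0_derive.
  - pose proof (gauss_pos c). nra.
Qed.

(* [Phi0 x ^ 2 / 2 + polar x] is constant: differentiate under the integral. *)
Definition polar_integrand (x y : R) : R := exp (- (x ^ 2 * (1 + y ^ 2)) / 2) / (1 + y ^ 2).

Definition polar (x : R) : R := RInt (polar_integrand x) 0 1.

Lemma one_plus_sq_pos y : 0 < 1 + y ^ 2.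
Proof. pose proof (pow2_ge_0 y); lra. Qed.

Lemma polar_integrand_derive x y :
  is_derive (fun x => polar_integrand x y) x (- x * (gauss x * gauss (x * y))).
Proof.
  pose proof (one_plus_sq_pos y).
  unfold polar_integrand, gauss. rewrite <- exp_plus.
  replace (- x ^ 2 / 2 + - (x * y) ^ 2 / 2) with (- (x ^ 2 * (1 + y ^ 2)) / 2) by field.
  auto_derive; [lra|].
  gauss_field. simpl in H. lra.
Qed.

Lemma polar_integrand_ex_RInt x a b : ex_RInt (polar_integrand x) a b.
Proof.
  apply (ex_RInt_continuous (polar_integrand x)). intros y _.
  apply (ex_derive_continuous (polar_integrand x)). pose proof (one_plus_sq_pos y).
  unfold polar_integrand. auto_derive. simpl in H. lra.
Qed.

Lemma polar_derive x : is_derive polar x (- Phi0 x * gauss x).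
Proof.
  evar_last.
  - apply (is_derive_RInt_param polar_integrand 0 1 x).
    + apply filter_forall. intros u t _. eexists; apply polar_integrand_derive.
    + intros t _.
      apply continuity_2d_pt_ext with (fun u v => - u * (gauss u * gauss (u * v))).
      * intros u v. symmetry. apply is_derive_unique, polar_integrand_derive.
      * assert (Hg : forall z, continuity_pt gauss z).
        { intros z. apply continuity_pt_filterlim, gauss_continuous. }
        apply continuity_2d_pt_mult; [apply continuity_2d_pt_opp, continuity_2d_pt_id1|].
        apply continuity_2d_pt_mult.
        -- apply (continuity_1d_2d_pt_comp gauss (fun u _ => u)); [apply Hg|].
           apply continuity_2d_pt_id1.
        -- apply (continuity_1d_2d_pt_comp gauss (fun u v => u * v)); [apply Hg|].
           apply continuity_2d_pt_mult; [apply continuity_2d_pt_id1|apply continuity_2d_pt_id2].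
    + apply filter_forall. intros u. apply polar_integrand_ex_RInt.
  - rewrite (RInt_ext _ (fun t => scal (- gauss x) (x * gauss (x * t + 0)))).
    + rewrite (RInt_scal (V := R_CompleteNormedModule) (fun t => x * gauss (x * t + 0))).
      * pose proof (RInt_comp_lin gauss x 0 0 1) as E.
        unfold scal in *; simpl in *; unfold mult in *; simpl in *.
        rewrite E by apply gauss_ex_RInt.
        replace (x * 0 + 0) with 0 by ring. replace (x * 1 + 0) with x by ring.
        fold (Phi0 x). ring.
      * apply (ex_RInt_comp_lin gauss x 0 0 1), gauss_ex_RInt.
    + intros t _. rewrite Rplus_0_r.
      etransitivity; [apply is_derive_unique, polar_integrand_derive|].
      unfold scal; simpl; unfold mult; simpl. ring.
Qed.

Lemma polar_0 : polar 0 = PI / 4.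
Proof.
  unfold polar. apply is_RInt_unique.
  replace (PI / 4) with (atan 1 - atan 0) by (rewrite atan_1, atan_0; ring).
  assert (E : forall y, / (1 + y ^ 2) = polar_integrand 0 y).
  { intros y. unfold polar_integrand.
    replace (- (0 ^ 2 * (1 + y ^ 2)) / 2) with 0 by field. rewrite exp_0. unfold Rdiv; ring. }
  apply (is_RInt_ext (fun y => / (1 + y ^ 2))).
  - intros y _. apply E.
  - apply (is_RInt_derive atan).
    + intros y _. evar_last; [apply is_derive_atan|]. unfold Rsqr. f_equal. ring.
    + intros y _. apply (ex_derive_continuous (fun y => / (1 + y ^ 2))).
      auto_derive. pose proof (one_plus_sq_pos y). simpl in H. lra.
Qed.

Lemma polar_bound x : 0 <= polar x <= gauss x.
Proof.
  assert (H : forall y, 0 <= y <= 1 -> 0 <= polar_integrand x y <= gauss x).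
  { intros y _. unfold polar_integrand, gauss. pose proof (one_plus_sq_pos y) as Hy.
    pose proof (exp_pos (- (x ^ 2 * (1 + y ^ 2)) / 2)) as He.
    split; [apply Rdiv_le_0_compat; lra|].
    apply Rle_div_l; [lra|]. pose proof (exp_pos (- x ^ 2 / 2)).
    apply Rle_trans with (exp (- x ^ 2 / 2)).
    - apply Rnot_lt_le; intros Hlt. apply exp_lt_inv in Hlt.
      pose proof (pow2_ge_0 (x * y)) as Hxy. rewrite Rpow_mult_distr in Hxy. lra.
    - pose proof (pow2_ge_0 y). nra. }
  split.
  - apply RInt_ge_0; [lra|apply polar_integrand_ex_RInt|]. intros y Hy; apply H; lra.
  - replace (gauss x) with (RInt (fun _ => gauss x) 0 1).
    + apply RInt_le; [lra|apply polar_integrand_ex_RInt|apply ex_RInt_const|].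
      intros y Hy; apply H; lra.
    + rewrite RInt_const. unfold scal; simpl; unfold mult; simpl. ring.
Qed.

Lemma Phi0_sq y : Phi0 y ^ 2 = PI / 2 - 2 * polar y.
Proof.
  assert (H : Phi0 y ^ 2 / 2 + polar y = Phi0 0 ^ 2 / 2 + polar 0).
  { apply (derive_zero_const (fun y => Phi0 y ^ 2 / 2 + polar y)). intros x.
    evar_last.
    - apply (is_derive_plus (fun y => Phi0 y ^ 2 / 2) polar); [|apply polar_derive].
      apply (is_derive_ext (fun y => / 2 * (Phi0 y * Phi0 y))); [intros; simpl; field|].
      apply is_derive_scal, (is_derive_mult Phi0 Phi0); try apply Phi0_derive.
      intros; apply Rmult_comm.
    - unfold plus, mult, scal; simpl. unfold mult; simpl. field. }
  rewrite Phi0_0, polar_0 in H. lra.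
Qed.

Lemma PI_gt_2 : 2 < PI.
Proof. pose proof PI2_1. lra. Qed.

(** By [Phi0_sq] the difference of squares is 2 [polar y], at most 2 [gauss y]; the conjugate factor
    is at least 1. A polynomial rate is enough later. *)
Lemma Phi0_tail y : 0 < y -> 0 <= sqrt (PI / 2) - Phi0 y <= 4 / y ^ 2.
Proof.
  intros Hy. pose proof PI_gt_2. pose proof (Phi0_sq y) as E.
  pose proof (polar_bound y) as [P0 P1].
  assert (H0 : 0 <= Phi0 y) by (rewrite <- Phi0_0; apply Phi0_incr; lra).
  assert (Hs2 : sqrt (PI / 2) ^ 2 = PI / 2) by (apply pow2_sqrt; lra).
  assert (Hs1 : 1 <= sqrt (PI / 2)).
  { rewrite <- sqrt_1. apply sqrt_le_1_alt. lra. }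
  set (c := sqrt (PI / 2)) in *.
  assert (Hle : Phi0 y <= c) by (apply Rnot_lt_le; intros Hlt; nra).
  split; [lra|].
  assert (Hg : gauss y <= 2 / y ^ 2).
  { assert (0 < y ^ 2) by (apply pow_lt, Hy). apply Rle_div_r; [lra|].
    pose proof (gauss_moment y). pose proof (gauss_pos y).
    assert (0 <= y ^ 4) by (apply pow_le; lra). nra. }
  assert ((c - Phi0 y) * 1 <= (c - Phi0 y) * (c + Phi0 y)) by (apply Rmult_le_compat_l; lra).
  replace (4 / y ^ 2) with (2 * (2 / y ^ 2)) by (field; lra). nra.
Qed.

(** * The normal distribution function *)

Definition Phi (y : R) : R := / 2 + Phi0 y / sqrt (2 * PI).

Lemma sqrt_2PI : sqrt (2 * PI) = 2 * sqrt (PI / 2) /\ 1 <= sqrt (PI / 2).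
Proof.
  pose proof PI_gt_2. split.
  - replace (2 * PI) with (2 ^ 2 * (PI / 2)) by field.
    rewrite sqrt_mult_alt by lra. rewrite sqrt_pow2 by lra. reflexivity.
  - rewrite <- sqrt_1. apply sqrt_le_1_alt. lra.
Qed.

Lemma Phi_incr a b : a <= b -> Phi a <= Phi b.
Proof.
  intros H. apply Phi0_incr in H. destruct sqrt_2PI as [E1 E2].
  apply Rplus_le_compat_l. apply Rmult_le_compat_r; [|exact H].
  apply Rlt_le, Rinv_0_lt_compat. lra.
Qed.

Lemma Phi_opp y : Phi (- y) = 1 - Phi y.
Proof. unfold Phi. rewrite Phi0_odd. unfold Rdiv. lra. Qed.

Lemma Phi_tail y : 0 < y -> 1 - 4 / y ^ 2 <= Phi y <= 1.
Proof.
  intros Hy. pose proof (Phi0_tail y Hy) as H. destruct sqrt_2PI as [E1 E2].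
  unfold Phi. rewrite E1. set (c := sqrt (PI / 2)) in *.
  assert (Hq : Phi0 y / (2 * c) = / 2 - (c - Phi0 y) / (2 * c)) by (field; lra).
  rewrite Hq.
  assert (H1 : 0 <= (c - Phi0 y) / (2 * c)) by (apply Rdiv_le_0_compat; lra).
  assert (H2 : (c - Phi0 y) / (2 * c) <= c - Phi0 y).
  { apply Rle_div_l; [lra|]. nra. }
  lra.
Qed.

Lemma Phi_bounds y : 0 <= Phi y <= 1.
Proof.
  assert (H : forall z, 0 <= z -> 0 <= Phi z <= 1).
  { intros z Hz. split.
    - apply Rle_trans with (Phi 0); [unfold Phi; rewrite Phi0_0; lra|apply Phi_incr, Hz].
    - apply Rle_trans with (Phi (z + 1)); [apply Phi_incr; lra|apply Phi_tail; lra]. }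
  destruct (Rle_lt_dec 0 y) as [Hy|Hy]; [apply H, Hy|].
  specialize (H (- y)). rewrite Phi_opp in H. lra.
Qed.

Lemma Phi_continuous y : continuous Phi y.
Proof.
  apply (continuous_plus (fun _ => / 2) (fun y => Phi0 y / sqrt (2 * PI))).
  - apply continuous_const.
  - apply (continuous_mult Phi0 (fun _ => / sqrt (2 * PI))); [|apply continuous_const].
    apply (ex_derive_continuous Phi0). eexists; apply Phi0_derive.
Qed.

Lemma normal_cdf_Phi s2 x : 0 < s2 -> normal_cdf s2 x = Phi (x / sqrt s2).
Proof.
  intros Hs. destruct (sqrt_sq_pos s2 Hs) as [Hr Hr2].
  destruct sqrt_2PI as [E1 E2]. pose proof PI_gt_2.
  set (F := fun u => Phi (u / sqrt s2)).
  assert (HD : forall u, is_derive F u (/ sqrt (2 * PI * s2) * exp (- u ^ 2 / (2 * s2)))).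
  { intros u. evar_last.
    - apply (is_derive_comp Phi (fun u => u / sqrt s2) u (gauss (u / sqrt s2) / sqrt (2 * PI))
               (/ sqrt s2)).
      + unfold Phi. evar_last.
        * apply (is_derive_plus (fun _ => / 2) (fun y => Phi0 y / sqrt (2 * PI))).
          -- apply (is_derive_const (/ 2)).
          -- apply (is_derive_ext (fun y => / sqrt (2 * PI) * Phi0 y));
               [intros; apply Rmult_comm|].
             apply is_derive_scal, Phi0_derive.
        * change (0 + / sqrt (2 * PI) * gauss (u / sqrt s2)
                  = gauss (u / sqrt s2) / sqrt (2 * PI)). unfold Rdiv; ring.
      + auto_derive; [exact I|ring].
    - rewrite (sqrt_mult (2 * PI) s2) by lra. unfold gauss.
      replace (- (u / sqrt s2) ^ 2 / 2) with (- u ^ 2 / (2 * s2)).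
      + unfold scal; simpl; unfold mult; simpl. field. lra.
      + rewrite Hr2 at 1. field. lra. }
  unfold normal_cdf. apply is_RInt_gen_unique.
  replace (Phi (x / sqrt s2)) with (F x - 0) by (unfold F; ring).
  apply (is_RInt_gen_ext (Derive F)).
  - apply filter_forall. intros ab u _. apply is_derive_unique, HD.
  - apply is_RInt_gen_Derive.
    + apply filter_forall. intros ab u _. eexists; apply HD.
    + apply filter_forall. intros ab u _.
      apply (continuous_ext (fun u => / sqrt (2 * PI * s2) * exp (- u ^ 2 / (2 * s2)))).
      * intros z. symmetry. apply is_derive_unique, HD.
      * apply (ex_derive_continuous (fun u => / sqrt (2 * PI * s2) * exp (- u ^ 2 / (2 * s2)))).
        auto_derive. exact I.
    + apply (proj2 (filterlim_locally F 0)). intros eps.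
      pose proof (cond_pos eps) as He.
      (* As M > 1, eps * M^2 >= eps * M = eps + 4 > 4, so the tail bound 4 / M^2 is below eps. *)
      set (M := 1 + 4 / eps).
      assert (HM : 1 < M) by (unfold M; assert (0 < 4 / eps) by (apply Rdiv_lt_0_compat; lra); lra).
      exists (- (M * sqrt s2)). intros u Hu.
      assert (Hy : M <= - u / sqrt s2).
      { apply Rle_div_r; lra. }
      pose proof (Phi_tail (- u / sqrt s2) ltac:(lra)) as Ht.
      replace (- u / sqrt s2) with (- (u / sqrt s2)) in * by (field; lra).
      rewrite Phi_opp in Ht. fold (F u) in Ht.
      assert (H4 : 4 / (- (u / sqrt s2)) ^ 2 < eps).
      { apply Rlt_div_l; [apply pow_lt; lra|].
        apply Rlt_le_trans with (eps * M).
        - unfold M. replace (eps * (1 + 4 / eps)) with (eps + 4) by (field; lra). lra.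
        - apply Rmult_le_compat_l; [lra|]. simpl. nra. }
      change (Rabs (F u - 0) < eps). rewrite Rminus_0_r.
      apply Rabs_def1; lra.
    + apply filterlim_locally. intros eps. unfold at_point. apply ball_center.
Qed.

(** * Limits *)

(** States that the upper limit of |u| is below every eps. The bound v may depend on eps, so
    auxiliary parameters can be fixed before n grows. *)
Lemma lim_zero_by_eps (u : nat -> R) :
  (forall eps, 0 < eps -> exists (v : nat -> R) (l : R),
     is_lim_seq v l /\ l < eps /\ eventually (fun n => Rabs (u n) <= v n)) ->
  is_lim_seq u 0.
Proof.
  intros H. apply is_lim_seq_spec. intros eps.
  destruct (H eps (cond_pos eps)) as [v [l [Hv [Hl Hu]]]].
  apply is_lim_seq_spec in Hv.
  assert (He : 0 < eps - l) by lra.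
  specialize (Hv (mkposreal _ He)). simpl in Hv.
  generalize (filter_and _ _ Hu Hv). apply filter_imp. intros n [H1 H2].
  rewrite Rminus_0_r. apply Rabs_lt_between in H2. lra.
Qed.

Definition scale (n : nat) : R := sqrt (INR n * ln (INR n)).

Lemma ln_INR_lim : is_lim_seq (fun n => ln (INR n)) p_infty.
Proof.
  apply (is_lim_comp_seq ln INR p_infty p_infty).
  - apply is_lim_ln_p.
  - exists 0%nat. discriminate.
  - apply is_lim_seq_INR.
Qed.

Lemma scale_pos n : (2 <= n)%nat ->
  0 < scale n /\ scale n ^ 2 = INR n * ln (INR n) /\ 0 < ln (INR n) /\ 2 <= INR n.
Proof.
  intros Hn. apply le_INR in Hn. simpl in Hn.
  assert (0 < ln (INR n)) by (rewrite <- ln_1; apply ln_increasing; lra).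
  assert (0 < INR n * ln (INR n)) by (apply Rmult_lt_0_compat; lra).
  split; [apply sqrt_lt_R0; assumption|].
  split; [apply pow2_sqrt; lra|]. lra.
Qed.

(** Of order (ln n)^(-1/2): the error terms of lower order than n ln n are measured by its
    powers. *)
Definition scale_ratio (n : nat) : R := sqrt (INR n + 1) / scale n.

Lemma scale_ratio_lim : is_lim_seq scale_ratio 0.
Proof.
  apply (is_lim_seq_le_le_loc (fun _ => 0) _ (fun n => sqrt (2 * / ln (INR n)))).
  - exists 2%nat. intros n Hn. destruct (scale_pos n Hn) as [Hs [Hs2 [Hl Hn2]]].
    unfold scale_ratio. split; [apply Rdiv_le_0_compat; [apply sqrt_pos|exact Hs]|].
    unfold scale. rewrite <- sqrt_div by (try lra; apply Rmult_lt_0_compat; lra).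
    apply sqrt_le_1_alt. apply Rle_div_l; [apply Rmult_lt_0_compat; lra|].
    replace (2 * / ln (INR n) * (INR n * ln (INR n))) with (2 * INR n) by (field; lra). lra.
  - apply is_lim_seq_const.
  - rewrite <- sqrt_0. apply (is_lim_seq_continuous sqrt).
    + apply continuity_pt_sqrt. lra.
    + replace (Finite 0) with (Rbar_mult 2 0) by (simpl; f_equal; ring).
      apply is_lim_seq_scal_l. replace (Finite 0) with (Rbar_inv p_infty) by reflexivity.
      apply is_lim_seq_inv; [apply ln_INR_lim|discriminate].
Qed.

Lemma inv_INR_lim : is_lim_seq (fun n => / INR n) 0.
Proof.
  replace (Finite 0) with (Rbar_inv p_infty) by reflexivity.
  apply is_lim_seq_inv; [apply is_lim_seq_INR|discriminate].
Qed.

Lemma hodd_scale_lim : is_lim_seq (fun n => (INR n + 1) * hodd n / scale n ^ 2) 1.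
Proof.
  destruct hodd_asymptotics as [kappa Hk].
  assert (H : is_lim_seq (fun n => (hodd n - ln (INR n)) * / ln (INR n)) 0).
  { apply (is_lim_seq_abs_0 _).
    apply (is_lim_seq_le_le_loc (fun _ => 0) _ (fun n => (Rabs kappa + 1) * / ln (INR n))).
    - exists 2%nat. intros n Hn. destruct (scale_pos n Hn) as [_ [_ [Hl Hn2]]].
      split; [apply Rabs_pos|]. rewrite Rabs_mult, (Rabs_pos_eq (/ ln (INR n)))
        by (apply Rlt_le, Rinv_0_lt_compat; exact Hl).
      apply Rmult_le_compat_r; [apply Rlt_le, Rinv_0_lt_compat; exact Hl|].
      replace (hodd n - ln (INR n)) with (kappa + (hodd n - ln (INR n) - kappa)) by ring.
      eapply Rle_trans; [apply Rabs_triang|]. apply Rplus_le_compat_l.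
      eapply Rle_trans; [apply Hk; lia|]. rewrite <- Rinv_1.
      apply Rinv_le_contravar; lra.
    - apply is_lim_seq_const.
    - replace (Finite 0) with (Rbar_mult (Rabs kappa + 1) 0) by (simpl; f_equal; ring).
      apply is_lim_seq_scal_l. replace (Finite 0) with (Rbar_inv p_infty) by reflexivity.
      apply is_lim_seq_inv; [apply ln_INR_lim|discriminate]. }
  apply is_lim_seq_ext_loc with
    (fun n => (1 + / INR n) * (1 + (hodd n - ln (INR n)) * / ln (INR n))).
  - exists 2%nat. intros n Hn. destruct (scale_pos n Hn) as [_ [-> [Hl Hn2]]]. field. lra.
  - replace (Finite 1) with (Finite ((1 + 0) * (1 + 0))) by (f_equal; ring).
    apply is_lim_seq_mult'; apply is_lim_seq_plus'; try apply is_lim_seq_const.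
    + apply inv_INR_lim.
    + exact H.
Qed.

Lemma vlead_scale_lim : is_lim_seq (fun n => vlead n / scale n ^ 2) sigma2.
Proof.
  apply is_lim_seq_ext with (fun n => sigma2 * ((INR n + 1) * hodd n / scale n ^ 2)).
  - intros n. unfold vlead, Rdiv. ring.
  - replace (Finite sigma2) with (Rbar_mult sigma2 1) by (simpl; f_equal; ring).
    apply is_lim_seq_scal_l, hodd_scale_lim.
Qed.

Lemma INR_scale_le n : (2 <= n)%nat -> INR n / scale n ^ 2 <= scale_ratio n ^ 2.
Proof.
  intros Hn. destruct (scale_pos n Hn) as [Hs [_ [_ Hn2]]].
  unfold scale_ratio, Rdiv. rewrite Rpow_mult_distr, pow_inv, pow2_sqrt by lra.
  apply Rmult_le_compat_r; [apply Rlt_le, Rinv_0_lt_compat, pow_lt, Hs|lra].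
Qed.

Lemma inv_pt_le n : / pt n <= 2 * sqrt (INR n + 1) ^ 3.
Proof.
  pose proof (proj2 (inv_cb_bounds n)) as H. posn.
  replace (/ pt n) with ((INR n + 1) * / cb n).
  - replace (sqrt (INR n + 1) ^ 3) with (sqrt (INR n + 1) ^ 2 * sqrt (INR n + 1)) by ring.
    rewrite pow2_sqrt by lra.
    apply (Rmult_le_compat_l (INR n + 1)) in H; lra.
  - unfold pt. pose proof (cb_pos n). field. lra.
Qed.

(** The bound at tau = kappa * scale n. Only the first term survives in the limit, with value K eta
    / kappa^2, which is small once eta is chosen after kappa. *)
Lemma supersol_scale K eta kappa n : 0 <= K -> 0 < eta -> 0 < kappa -> (2 <= n)%nat ->
  supersol (K / (kappa * scale n) ^ 2 * eta) (K / (kappa * scale n) ^ 2 / eta ^ 3)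
    (3 * K / (kappa * scale n) ^ 3 + 8 * K * sqrt (INR n + 1) / (kappa * scale n) ^ 4) n
  <= K * eta / kappa ^ 2 * ((INR n + 1) * hodd n / scale n ^ 2)
     + (K / kappa ^ 2 / eta ^ 3 * scale_ratio n ^ 2
     + (6 * K / kappa ^ 3 * scale_ratio n ^ 3 + 16 * K / kappa ^ 4 * scale_ratio n ^ 4)).
Proof.
  intros HK He Hk Hn. destruct (scale_pos n Hn) as [Hs [_ [_ Hn2]]].
  pose proof (INR_scale_le n Hn) as H1. pose proof (inv_pt_le n) as H2.
  pose proof (sqrt_pos (INR n + 1)) as Hq.
  unfold supersol, scale_ratio in *. set (s := scale n) in *. set (q := sqrt (INR n + 1)) in *.
  assert (Hp : forall k, 0 < / kappa ^ k) by (intros; apply Rinv_0_lt_compat, pow_lt, Hk).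
  assert (Hsp : forall k, 0 < / s ^ k) by (intros; apply Rinv_0_lt_compat, pow_lt, Hs).
  assert (He3 : 0 < / eta ^ 3) by (apply Rinv_0_lt_compat, pow_lt, He).
  replace (K / (kappa * s) ^ 2 * eta * ((INR n + 1) * hodd n)) with
    (K * eta / kappa ^ 2 * ((INR n + 1) * hodd n / s ^ 2)) by (field; lra).
  rewrite Rplus_assoc. apply Rplus_le_compat_l. apply Rplus_le_compat.
  - replace (K / (kappa * s) ^ 2 / eta ^ 3 * INR n) with
      (K / kappa ^ 2 / eta ^ 3 * (INR n / s ^ 2)) by (field; lra).
    apply Rmult_le_compat_l; [|exact H1].
    unfold Rdiv. pose proof (Hp 2%nat). apply Rmult_le_pos; [apply Rmult_le_pos|]; lra.
  - replace (6 * K / kappa ^ 3 * (q / s) ^ 3 + 16 * K / kappa ^ 4 * (q / s) ^ 4) with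
      ((3 * K / (kappa * s) ^ 3 + 8 * K * q / (kappa * s) ^ 4) * (2 * q ^ 3)) by (field; lra).
    apply Rmult_le_compat_l; [|exact H2].
    assert (forall k, 0 < / (kappa * s) ^ k).
    { intros k. apply Rinv_0_lt_compat, pow_lt, Rmult_lt_0_compat; assumption. }
    unfold Rdiv. pose proof (H 3%nat). pose proof (H 4%nat).
    apply Rplus_le_le_0_compat; apply Rmult_le_pos; nra.
Qed.

Lemma supersol_scale_lim a b c d :
  is_lim_seq (fun n => a * ((INR n + 1) * hodd n / scale n ^ 2)
     + (b * scale_ratio n ^ 2 + (c * scale_ratio n ^ 3 + d * scale_ratio n ^ 4))) a.
Proof.
  replace (Finite a) with (Finite (a * 1 + (b * 0 ^ 2 + (c * 0 ^ 3 + d * 0 ^ 4))))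
    by (f_equal; ring).
  assert (Hp : forall k, is_lim_seq (fun n => scale_ratio n ^ k) (0 ^ k)).
  { induction k as [|k IH]; simpl; [apply is_lim_seq_const|].
    apply is_lim_seq_mult'; [apply scale_ratio_lim|exact IH]. }
  assert (Hs : forall e k, is_lim_seq (fun n => e * scale_ratio n ^ k) (e * 0 ^ k)).
  { intros e k. apply is_lim_seq_mult'; [apply is_lim_seq_const|apply Hp]. }
  apply is_lim_seq_plus'.
  - apply is_lim_seq_mult'; [apply is_lim_seq_const|apply hodd_scale_lim].
  - apply is_lim_seq_plus'; [apply Hs|]. apply is_lim_seq_plus'; apply Hs.
Qed.

Section Limit.

Context (L : nat -> list btree) (HL : forall n, enumerates (L n) n).

Let m := cmean L.

Lemma cmean_dev_moments : exists K, 0 <= K /\ forall n, dev_moments m K n.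
Proof. apply shape_dev_moments; [apply (cmean_0 L HL)|apply (cmean_S L HL)]. Qed.

Lemma cmean_scale_lim : is_lim_seq (fun n => m n / scale n) 0.
Proof.
  destruct (shape_mean_error m (cmean_0 L HL) (cmean_S L HL)) as [K [HK He]].
  apply is_lim_seq_abs_0.
  apply (is_lim_seq_le_le_loc (fun _ => 0) _ (fun n => (4 + K) * scale_ratio n)).
  - exists 2%nat. intros n Hn. destruct (scale_pos n Hn) as [Hs _].
    split; [apply Rabs_pos|]. unfold scale_ratio, Rdiv.
    rewrite Rabs_mult, (Rabs_pos_eq (/ scale n)) by (apply Rlt_le, Rinv_0_lt_compat, Hs).
    rewrite <- Rmult_assoc.
    apply Rmult_le_compat_r; [apply Rlt_le, Rinv_0_lt_compat, Hs|].
    specialize (He n). pose proof (proj2 (inv_cb_bounds n)) as Hc.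
    pose proof (Rinv_0_lt_compat _ (cb_pos n)).
    assert (Hr : root8 n <= sqrt (INR n + 1)).
    { rewrite <- root8_pow4. rewrite <- (pow_1 (root8 n)) at 1.
      apply Rle_pow; [apply root8_ge1|lia]. }
    apply (Rmult_le_compat_l K) in Hr; [|exact HK].
    apply Rabs_le_between in He. unfold Rdiv in He. apply Rabs_le. lra.
  - apply is_lim_seq_const.
  - replace (Finite 0) with (Rbar_mult (4 + K) 0) by (simpl; f_equal; ring).
    apply is_lim_seq_scal_l, scale_ratio_lim.
Qed.

Lemma cvar_scale_lim : is_lim_seq (fun n => cvar L n / scale n ^ 2) sigma2.
Proof.
  destruct cmean_dev_moments as [K [HK HM]].
  apply is_lim_seq_ext with
    (fun n => vlead n / scale n ^ 2 + (cvar L n - vlead n) / scale n ^ 2).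
  { intros n. unfold Rdiv. ring. }
  replace (Finite sigma2) with (Finite (sigma2 + 0)) by (f_equal; ring).
  apply is_lim_seq_plus'; [apply vlead_scale_lim|].
  apply lim_zero_by_eps. intros eps Heps.
  set (eta := eps / (2 * (K + 1))).
  assert (Heta : 0 < eta) by (apply Rdiv_lt_0_compat; lra).
  exists (fun n => K * eta * ((INR n + 1) * hodd n / scale n ^ 2)
     + (K / eta ^ 3 * scale_ratio n ^ 2
     + (0 * scale_ratio n ^ 3 + 0 * scale_ratio n ^ 4))), (K * eta).
  split; [apply supersol_scale_lim|]. split.
  - unfold eta. replace (K * (eps / (2 * (K + 1)))) with (eps * (K / (2 * (K + 1))))
      by (field; lra).
    rewrite <- (Rmult_1_r eps) at 2. apply Rmult_lt_compat_l; [lra|].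
    apply Rlt_div_l; lra.
  - exists 2%nat. intros n Hn. destruct (scale_pos n Hn) as [Hs _].
    assert (Hs2 : 0 < / scale n ^ 2) by (apply Rinv_0_lt_compat, pow_lt, Hs).
    unfold Rdiv at 1. rewrite Rabs_mult, (Rabs_pos_eq (/ scale n ^ 2)) by lra.
    eapply Rle_trans.
    { apply Rmult_le_compat_r; [lra|]. apply (cvar_error L HL K HK HM eta Heta). }
    unfold supersol. rewrite Rmult_0_l, Rplus_0_r, !Rmult_0_l, !Rplus_0_r.
    rewrite Rmult_plus_distr_r. apply Rplus_le_compat; [right; unfold Rdiv; ring|].
    rewrite Rmult_assoc. apply Rmult_le_compat_l; [|apply INR_scale_le, Hn].
    apply Rdiv_le_0_compat; [exact HK|apply pow_lt, Heta].
Qed.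

Definition cdf (n : nat) (y : R) : R :=
  mean (L n) (fun t => if Rle_dec (cshape t) y then 1 else 0).

(** The average is the distribution function at x of [cshape] plus independent centred normal noise
    of standard deviation tau. Normalizing [heat] multiplies errors by 1 / sqrt (2 PI) < 1. *)
Lemma smooth_cdf K : 0 <= K -> (forall n, dev_moments m K n) ->
  forall eta tau x n, 0 < eta -> 0 < tau ->
  Rabs (mean (L n) (fun t => Phi ((x - cshape t) / tau))
        - Phi ((x - m n) / sqrt (tau ^ 2 + vlead n)))
  <= supersol (K / tau ^ 2 * eta) (K / tau ^ 2 / eta ^ 3)
       (3 * K / tau ^ 3 + 8 * K * sqrt (INR n + 1) / tau ^ 4) n.
Proof.
  intros HK HM eta tau x n He Ht.
  pose proof (smoothing_error L HL K HK HM eta tau n He Ht n ltac:(lia) x (tau ^ 2) ltac:(lra))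
    as H. fold m in H.
  eapply Rle_trans; [|exact H]. clear H.
  destruct sqrt_2PI as [E1 E2].
  rewrite (mean_ext L HL n _ (fun t => / 2 + / sqrt (2 * PI) * heat (x - cshape t) (tau ^ 2))).
  - rewrite (mean_plus L HL), (mean_const L HL), (mean_scal L HL).
    change (Phi ((x - m n) / sqrt (tau ^ 2 + vlead n))) with
      (/ 2 + heat (x - m n) (tau ^ 2 + vlead n) / sqrt (2 * PI)).
    set (a := mean _ _). set (b := heat _ _).
    replace (/ 2 + / sqrt (2 * PI) * a - (/ 2 + b / sqrt (2 * PI))) with
      (/ sqrt (2 * PI) * (a - b)) by (field; lra).
    rewrite Rabs_mult, Rabs_pos_eq by (apply Rlt_le, Rinv_0_lt_compat; lra).
    rewrite <- (Rmult_1_l (Rabs (a - b))) at 2.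
    apply Rmult_le_compat_r; [apply Rabs_pos|].
    rewrite <- Rinv_1. apply Rinv_le_contravar; lra.
  - intros t _. unfold Phi, heat. rewrite sqrt_pow2 by lra. unfold Rdiv; ring.
Qed.

(** The noise exceeds lambda * tau in a given direction with probability at most 4 / lambda^2;
    shifting the threshold by lambda * tau absorbs it otherwise. *)
Lemma cdf_sandwich lambda tau y n : 0 < lambda -> 0 < tau ->
  mean (L n) (fun t => Phi ((y - lambda * tau - cshape t) / tau)) - 4 / lambda ^ 2
  <= cdf n y <=
  mean (L n) (fun t => Phi ((y + lambda * tau - cshape t) / tau)) + 4 / lambda ^ 2.
Proof.
  intros Hl Ht. pose proof (Phi_tail lambda Hl) as H1.
  pose proof (Phi_opp lambda) as H2.
  assert (H0 : 0 < 4 / lambda ^ 2) by (apply Rdiv_lt_0_compat; [lra|apply pow_lt, Hl]).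
  split.
  - assert (H : mean (L n) (fun t => Phi ((y - lambda * tau - cshape t) / tau))
                <= mean (L n) (fun t => (if Rle_dec (cshape t) y then 1 else 0) + 4 / lambda ^ 2)).
    { apply (mean_le L HL). intros t.
      pose proof (Phi_bounds ((y - lambda * tau - cshape t) / tau)).
      destruct Rle_dec as [Hd|Hd]; [lra|].
      assert (Hp : Phi ((y - lambda * tau - cshape t) / tau) <= Phi (- lambda)); [|lra].
      apply Phi_incr. apply Rle_div_l; lra. }
    rewrite (mean_plus L HL), (mean_const L HL) in H. unfold cdf. lra.
  - assert (H : cdf n y <=
       mean (L n) (fun t => Phi ((y + lambda * tau - cshape t) / tau) + 4 / lambda ^ 2)).
    { apply (mean_le L HL). intros t.
      pose proof (Phi_bounds ((y + lambda * tau - cshape t) / tau)).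
      destruct Rle_dec as [Hd|Hd]; [|lra].
      assert (Hp : Phi lambda <= Phi ((y + lambda * tau - cshape t) / tau)); [|lra].
      apply Phi_incr. apply Rle_div_r; lra. }
    rewrite (mean_plus L HL), (mean_const L HL) in H. exact H.
Qed.

(** A threshold varying with n makes both normalizations instances. The parameters are fixed in the
    order lambda (noise tail), kappa (noise level), eta (recursion error), each contributing a share
    of eps. *)
Lemma cdf_lim (y : nat -> R) (z : R) :
  is_lim_seq (fun n => y n / scale n) z ->
  is_lim_seq (fun n => cdf n (y n)) (Phi (z / sqrt sigma2)).
Proof.
  intros Hy. pose proof sigma2_pos as Hsig.
  destruct cmean_dev_moments as [K [HK HM]].
  set (target := Phi (z / sqrt sigma2)).
  apply is_lim_seq_ext with (fun n => (cdf n (y n) - target) + target); [intros; ring|].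
  replace (Finite target) with (Finite (0 + target)) by (f_equal; ring).
  apply is_lim_seq_plus'; [|apply is_lim_seq_const].
  apply lim_zero_by_eps. intros eps Heps.
  set (lambda := 1 + 32 / eps).
  assert (Hl1 : 1 < lambda).
  { unfold lambda. assert (0 < 32 / eps) by (apply Rdiv_lt_0_compat; lra). lra. }
  assert (Hl : 4 / lambda ^ 2 <= eps / 8).
  { apply Rle_div_l; [apply pow_lt; lra|].
    apply Rle_trans with (eps / 8 * lambda).
    - unfold lambda. replace (eps / 8 * (1 + 32 / eps)) with (eps / 8 + 4) by (field; lra). lra.
    - apply Rmult_le_compat_l; [lra|]. simpl; nra. }
  (* Limit of the Gaussian approximation at noise level kappa and threshold shift a * kappa; at
     kappa = 0 it equals [target], so continuity lets kappa be chosen. *)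
  set (psi := fun a kappa => Phi ((z + a * kappa) / sqrt (kappa ^ 2 + sigma2))).
  assert (Hpsi : forall a, exists d, 0 < d /\ forall kappa, 0 < kappa < d ->
     Rabs (psi a kappa - target) < eps / 8).
  { intros a.
    assert (Hc : continuous (psi a) 0).
    { apply (continuous_comp (fun kappa => (z + a * kappa) / sqrt (kappa ^ 2 + sigma2)) Phi).
      - apply (ex_derive_continuous (fun kappa => (z + a * kappa) / sqrt (kappa ^ 2 + sigma2))).
        assert (0 < sqrt (0 ^ 2 + sigma2)) by (apply sqrt_lt_R0; simpl; lra).
        auto_derive. simpl in *. repeat split; lra.
      - apply Phi_continuous. }
    assert (He8 : 0 < eps / 8) by lra.
    apply filterlim_locally with (eps := mkposreal _ He8) in Hc.
    destruct Hc as [d Hd]. exists d. split; [apply cond_pos|]. intros kappa Hk.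
    specialize (Hd kappa). unfold psi in Hd at 1. rewrite Rmult_0_r, Rplus_0_r in Hd.
    replace (0 ^ 2 + sigma2) with sigma2 in Hd by ring. apply Hd.
    change (Rabs (kappa - 0) < d). rewrite Rminus_0_r, Rabs_pos_eq; lra. }
  destruct (Hpsi lambda) as [d1 [Hd1 P1]]. destruct (Hpsi (- lambda)) as [d2 [Hd2 P2]].
  set (kappa := Rmin d1 d2 / 2).
  assert (Hk : 0 < kappa /\ kappa < d1 /\ kappa < d2).
  { unfold kappa. pose proof (Rmin_l d1 d2). pose proof (Rmin_r d1 d2).
    assert (0 < Rmin d1 d2) by (apply Rmin_glb_lt; assumption). lra. }
  specialize (P1 kappa ltac:(lra)). specialize (P2 kappa ltac:(lra)).
  destruct Hk as [Hk _].
  assert (Hk2 : 0 < kappa ^ 2) by (apply pow_lt, Hk).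
  (* Makes the surviving error K eta / kappa^2 at most eps / 8. *)
  set (eta := eps * kappa ^ 2 / (8 * (K + 1))).
  assert (Heta : 0 < eta).
  { apply Rdiv_lt_0_compat; [apply Rmult_lt_0_compat; lra|lra]. }
  set (arg := fun a n => (y n / scale n + a * kappa - m n / scale n)
                         / sqrt (kappa ^ 2 + vlead n / scale n ^ 2)).
  assert (Harg : forall a, is_lim_seq (fun n => Phi (arg a n)) (psi a kappa)).
  { intros a. unfold psi. apply (is_lim_seq_continuous Phi).
    - apply continuity_pt_filterlim, Phi_continuous.
    - apply is_lim_seq_div'.
      + replace (z + a * kappa) with (z + a * kappa - 0) by ring.
        apply is_lim_seq_minus'; [|apply cmean_scale_lim].
        apply is_lim_seq_plus'; [exact Hy|apply is_lim_seq_const].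
      + apply (is_lim_seq_continuous sqrt); [apply continuity_pt_sqrt; lra|].
        apply is_lim_seq_plus'; [apply is_lim_seq_const|apply vlead_scale_lim].
      + apply Rgt_not_eq, sqrt_lt_R0. lra. }
  set (B := fun n => K * eta / kappa ^ 2 * ((INR n + 1) * hodd n / scale n ^ 2)
     + (K / kappa ^ 2 / eta ^ 3 * scale_ratio n ^ 2
     + (6 * K / kappa ^ 3 * scale_ratio n ^ 3 + 16 * K / kappa ^ 4 * scale_ratio n ^ 4))).
  exists (fun n => Rabs (Phi (arg lambda n) - target) + Rabs (Phi (arg (- lambda) n) - target)
     + (B n + eps / 8)).
  exists (Rabs (psi lambda kappa - target) + Rabs (psi (- lambda) kappa - target)
     + (K * eta / kappa ^ 2 + eps / 8)).
  split; [|split].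
  - assert (Habs : forall a, is_lim_seq (fun n => Rabs (Phi (arg a n) - target))
       (Rabs (psi a kappa - target))).
    { intros a. apply (is_lim_seq_abs _ (Finite (psi a kappa - target))).
      apply is_lim_seq_minus'; [apply Harg|apply is_lim_seq_const]. }
    apply is_lim_seq_plus'; [apply is_lim_seq_plus'; apply Habs|].
    apply is_lim_seq_plus'; [apply supersol_scale_lim|apply is_lim_seq_const].
  - assert (K * eta / kappa ^ 2 <= eps / 8); [|lra].
    unfold eta. replace (K * (eps * kappa ^ 2 / (8 * (K + 1))) / kappa ^ 2)
      with (eps / 8 * (K / (K + 1))) by (field; lra).
    rewrite <- (Rmult_1_r (eps / 8)) at 2. apply Rmult_le_compat_l; [lra|].
    apply Rle_div_l; lra.
  - exists 2%nat. intros n Hn. destruct (scale_pos n Hn) as [Hs _].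
    set (tau := kappa * scale n).
    assert (Ht : 0 < tau) by (apply Rmult_lt_0_compat; assumption).
    assert (Harg_eq : forall a, (y n + a * tau - m n) / sqrt (tau ^ 2 + vlead n) = arg a n).
    { intros a. unfold arg, tau.
      replace ((kappa * scale n) ^ 2 + vlead n) with
        (scale n ^ 2 * (kappa ^ 2 + vlead n / scale n ^ 2)) by (field; lra).
      rewrite sqrt_mult_alt by apply pow2_ge_0. rewrite sqrt_pow2 by lra.
      field. split; [lra|]. apply Rgt_not_eq, sqrt_lt_R0.
      assert (0 <= vlead n / scale n ^ 2); [|lra].
      apply Rdiv_le_0_compat; [apply vlead_ge0|apply pow_lt, Hs]. }
    pose proof (supersol_scale K eta kappa n HK Heta Hk Hn) as HB. fold tau in HB. fold (B n) in HB.
    destruct (cdf_sandwich lambda tau (y n) n ltac:(lra) Ht) as [S1 S2].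
    pose proof (smooth_cdf K HK HM eta tau (y n + lambda * tau) n Heta Ht) as U.
    pose proof (smooth_cdf K HK HM eta tau (y n - lambda * tau) n Heta Ht) as V.
    rewrite Harg_eq in U.
    replace (y n - lambda * tau - m n) with (y n + - lambda * tau - m n) in V by ring.
    rewrite Harg_eq in V.
    apply Rabs_le_between in U, V.
    pose proof (Rle_abs (Phi (arg lambda n) - target)).
    pose proof (Rle_abs (- (Phi (arg (- lambda) n) - target))) as Ha. rewrite Rabs_Ropp in Ha.
    pose proof (Rabs_pos (Phi (arg lambda n) - target)).
    pose proof (Rabs_pos (Phi (arg (- lambda) n) - target)).
    apply Rabs_le. lra.
Qed.

Lemma length_filter_lsum (p : btree -> bool) l :
  INR (length (filter p l)) = lsum (fun t => if p t then 1 else 0) l.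
Proof.
  induction l as [|t l IH]; [reflexivity|].
  rewrite lsum_cons. simpl filter. destruct (p t); simpl length; rewrite ?S_INR, IH; ring.
Qed.

Lemma prob_le_cdf n (g : btree -> R) x y :
  (forall t, bsize t = n -> (g t <= x <-> cshape t <= y)) ->
  prob_le (L n) g x = cdf n y.
Proof.
  intros H. unfold prob_le, cdf. rewrite length_filter_lsum, mean_lsum. f_equal.
  apply lsum_ext. intros t Ht. apply HL, H in Ht.
  destruct (Rle_dec (g t) x), (Rle_dec (cshape t) y); tauto.
Qed.

Lemma mean_shape n : mean (L n) shape = m n + C0 * (INR n + 1).
Proof.
  rewrite (mean_ext L HL n shape (fun t => cshape t + C0 * (INR n + 1))).
  - rewrite (mean_plus L HL), (mean_const L HL). reflexivity.
  - intros t <-. unfold cshape. ring.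
Qed.

Lemma variance_shape n : variance (L n) shape = cvar L n.
Proof.
  unfold variance, cvar. apply (mean_ext L HL). intros t Ht.
  rewrite mean_shape. fold m. unfold cshape. rewrite Ht. ring.
Qed.

End Limit.

Theorem theorem4p2 :
  forall L : nat -> list btree,
    (forall n, enumerates (L n) n) ->
    conv_normal L
      (fun n t => (shape t - C0 * INR (n + 1)) / sqrt (INR n * ln (INR n)))
      sigma2
    /\
    conv_normal L
      (fun n t => (shape t - mean (L n) shape) / sqrt (variance (L n) shape))
      1.
Proof.
  intros L HL. pose proof sigma2_pos as Hsig.
  destruct (sqrt_sq_pos sigma2 Hsig) as [Hs Hs2].
  split; intros x.
  - rewrite normal_cdf_Phi by exact Hsig.
    apply is_lim_seq_ext_loc with (fun n => cdf L n (x * scale n)).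
    + exists 2%nat. intros n Hn. destruct (scale_pos n Hn) as [Hp _].
      symmetry. apply (prob_le_cdf L HL). intros t Ht. fold (scale n).
      unfold cshape. rewrite Ht, plus_INR. simpl (INR 1).
      apply (Rle_div_l _ _ (scale n)), Hp.
    + apply (cdf_lim L HL).
      apply is_lim_seq_ext_loc with (fun _ => x); [|apply is_lim_seq_const].
      exists 2%nat. intros n Hn. destruct (scale_pos n Hn) as [Hp _]. field. lra.
  - rewrite normal_cdf_Phi by lra. rewrite sqrt_1, Rdiv_1_r.
    pose proof (cvar_scale_lim L HL) as Hv.
    (* The variance vanishes for the smallest sizes, where the standardization divides by zero; its
       asymptotics make it positive eventually. *)
    assert (Hev : eventually (fun n => (2 <= n)%nat /\ 0 < cvar L n)).
    { apply is_lim_seq_spec in Hv. specialize (Hv (mkposreal _ Hsig)). cbn [pos] in Hv.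
      destruct Hv as [N HN]. exists (Nat.max 2 N). intros n Hn.
      specialize (HN n ltac:(lia)). split; [lia|].
      destruct (scale_pos n ltac:(lia)) as [Hp _].
      apply Rabs_lt_between in HN.
      assert (Hq : 0 < cvar L n / scale n ^ 2) by lra.
      apply (Rmult_lt_compat_r (scale n ^ 2)) in Hq; [|apply pow_lt, Hp].
      replace (cvar L n / scale n ^ 2 * scale n ^ 2) with (cvar L n) in Hq by (field; lra).
      lra. }
    (* Standardization becomes a moving threshold: divided by [scale n] it tends to x * sqrt
       sigma2. *)
    apply is_lim_seq_ext_loc with (fun n => cdf L n (cmean L n + x * sqrt (cvar L n))).
    + revert Hev. apply filter_imp. intros n [_ Hc]. symmetry.
      rewrite (mean_shape L HL), (variance_shape L HL).
      apply (prob_le_cdf L HL). intros t Ht. apply sqrt_lt_R0 in Hc.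
      rewrite Rle_div_l by exact Hc. unfold cshape. rewrite Ht.
      split; intros H; lra.
    + replace (Phi x) with (Phi (x * sqrt sigma2 / sqrt sigma2)) by (f_equal; field; lra).
      apply (cdf_lim L HL).
      apply is_lim_seq_ext_loc with
        (fun n => cmean L n / scale n + x * sqrt (cvar L n / scale n ^ 2)).
      * revert Hev. apply filter_imp. intros n [Hn Hc]. destruct (scale_pos n Hn) as [Hp _].
        rewrite sqrt_div by (try lra; apply pow_lt, Hp). rewrite sqrt_pow2 by lra. field. lra.
      * replace (x * sqrt sigma2) with (0 + x * sqrt sigma2) by ring.
        apply is_lim_seq_plus'; [apply (cmean_scale_lim L HL)|].
        apply is_lim_seq_mult'; [apply is_lim_seq_const|].
        apply (is_lim_seq_continuous sqrt); [apply continuity_pt_sqrt; lra|exact Hv].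
Qed.
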